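(* Let $T_0,\mu_1,\mu_2$ be positive real numbers with $\mu_2>\mu_1$, let $\omega$ be a modulus of continuity, and let $\theta:(0,T_0)\to(0,+\infty)$ be a continuous and nonincreasing function. For every $\lambda>0$ let $$m(\lambda):=\min\left\{\lambda\,\omega\left(\frac1\lambda\right)s+\int_s^{T_0}\theta(t)\,dt:\ s\in[0,T_0]\right\}.$$ Let $A$ be a linear nonnegative self-adjoint operator in a real Hilbert space $H$, and consider the Cauchy problem $$u''(t)+c(t)Au(t)=0,\qquad u(0)=u_0,\quad u'(0)=u_1.\qquad( * )$$ (1) (Estimate from above for the derivative loss.) For every $c\in\mathcal{PS}(T_0,\mu_1,\mu_2,\omega,\theta)$: - if $m(\lambda)$ is bounded as $\lambda\to+\infty$, then $( * )$ is well-posed with no derivative loss; - if $m(\lambda)\to+\infty$ and $m(\lambda)/\log\lambda\to0$ as $\lambda\to+\infty$, then $( * )$ is well-posed with at most an arbitrarily small derivative loss; - if $0<\liminf_{\lambda\to+\infty}m(\lambda)/\log\lambda\le\limsup_{\lambda\to+\infty}m(\lambda)/\log\lambda<+\infty$, then $( * )$ is well-posed with at most a finite derivative loss. (If $m(\lambda)/\log\lambda\to+\infty$ the prescribed loss is infinite and nothing is claimed in (1).) (2) (Optimality of the derivative loss.) If $A$ is unbounded, then the set of coefficients $c\in\mathcal{PS}(T_0,\mu_1,\mu_2,\omega,\theta)$ for which $( * )$ exhibits exactly the following derivative loss is residual in $\mathcal{PS}(T_0,\mu_1,\mu_2,\omega,\theta)$: - if $m(\lambda)$ is bounded as $\lambda\to+\infty$: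 well-posedness with no derivative loss; - if $m(\lambda)\to+\infty$ and $m(\lambda)/\log\lambda\to0$: well-posedness with at most an arbitrarily small derivative loss, and the arbitrarily small derivative loss does actually happen; - if $0<\liminf_{\lambda\to+\infty}m(\lambda)/\log\lambda\le\limsup_{\lambda\to+\infty}m(\lambda)/\log\lambda<+\infty$: well-posedness with at most a finite derivative loss, and the finite derivative loss does actually happen; - if $m(\lambda)/\log\lambda\to+\infty$: infinite derivative loss.
   Context: A modulus of continuity is a function $\omega:[0,+\infty)\to[0,+\infty)$ such that $\omega(\sigma)>0$ for $\sigma>0$, $\omega(\sigma)\to0$ as $\sigma\to0^+$, $\sigma\mapsto\omega(\sigma)$ is nondecreasing, and $\sigma\mapsto\sigma/\omega(\sigma)$ is nondecreasing (for $\sigma>0$). $\mathcal{PS}(T_0,\mu_1,\mu_2,\omega,\theta)$ is the set of functions $c\in W^{1,\infty}_{loc}((0,T_0))$ (extended by continuity to $[0,T_0]$) such that $\mu_1\le c(t)\le\mu_2$ for every $t$; $|c(t)-c(s)|\le\omega(|t-s|)$ for all $t,s\in[0,T_0]$; and $|c'(t)|\le\theta(t)$ for almost every $t\in(0,T_0)$. It is a complete metric space with the distance induced by the norm of $L^\infty((0,T_0))$; ''residual'' is meant in this metric space in the sense of Baire category (the set contains a countable intersection of dense open sets). Powers of $A$ and solutions: by the spectral theorem, identify $H$ with $L^2(M,\mu)$ for some measure space so that $A$ becomes multiplication by $\lambda(\xi)^2$, with $\lambda:M\to[0,+\infty)$ measurable. For every real $\beta$, $D(A^\beta)$ is the space of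 (generalized) vectors $w$ whose transform $\widehat w$ is measurable with $(1+\lambda(\xi)^2)^\beta\,\widehat w(\xi)\in L^2(M,\mu)$ (for $\beta<0$ this is a space larger than $H$). For initial data in these spaces, the unique solution $u$ of the Cauchy problem is the one whose transform $\widehat u(t,\xi)$ solves, for almost every $\xi$, $\widehat u_{tt}+\lambda(\xi)^2c(t)\widehat u=0$ on $[0,T_0]$ with $\widehat u(0,\xi)=\widehat u_0(\xi)$, $\widehat u_t(0,\xi)=\widehat u_1(\xi)$. Types of derivative loss (by linearity none of these definitions depends on the choice of the real number $\beta$); $u$ denotes the solution with data $(u_0,u_1)$: - Well-posed with no derivative loss: for every $(u_0,u_1)\in D(A^{\beta+1/2})\times D(A^\beta)$ one has $(u(t),u'(t))\in D(A^{\beta+1/2})\times D(A^\beta)$ for all $t\in[0,T_0]$. - Well-posed with at most an arbitrarily small derivative loss: for every such data, $(u(t),u'(t))\in D(A^{\beta-\varepsilon+1/2})\times D(A^{\beta-\varepsilon})$ for all $t\in[0,T_0]$ and all $\varepsilon>0$. The arbitrarily small derivative loss does actually happen if there exist such data with $(u(t),u'(t))\notin D(A^{\beta+1/2})\times D(A^\beta)$ for all $t\in(0,T_0]$. - Well-posed with at most a finite derivative loss: there is $\delta>0$ such that, for every such data, $(u(t),u'(t))\in D(A^{\beta-\delta+1/2})\times D(A^{\beta-\delta})$ for all $t\in[0,T_0]$. The finite derivative loss does actually happen if there exist a function $\delta:(0,T_0]\to(0,+\infty)$ and such data with $(u(t),u'(t))\notin D(A^{\beta-\delta(t)+1/2})\times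 D(A^{\beta-\delta(t)})$ for all $t\in(0,T_0]$. - Infinite derivative loss: there exist data $(u_0,u_1)\in D(A^{\beta+1/2})\times D(A^\beta)$ with $(u(t),u'(t))\notin D(A^{-\gamma+1/2})\times D(A^{-\gamma})$ for all $\gamma>0$ and all $t\in(0,T_0]$. *)

(* Defs.v *)
From HB Require Import structures.
From mathcomp Require Import all_boot all_order all_algebra.
From mathcomp Require Import all_classical all_reals all_analysis.
Set Implicit Arguments.
Unset Strict Implicit.
Unset Printing Implicit Defensive.
Import Order.TTheory GRing.Theory Num.Theory.
Import numFieldNormedType.Exports.
Local Open Scope classical_set_scope.
Local Open Scope ring_scope.

Record is_modulus (R : realType) (omega : R -> R) : Prop := IsModulus {
  modulus_ge0 : forall s, 0 <= s -> 0 <= omega s;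
  modulus_gt0 : forall s, 0 < s -> 0 < omega s;
  modulus_cvg0 : omega s @[s --> 0^'+] --> (0 : R);
  modulus_nd : forall s t, 0 <= s -> s <= t -> omega s <= omega t;
  modulus_div_nd : forall s t, 0 < s -> s <= t -> s / omega s <= t / omega t }.

(* The integral may be infinite for s = 0, so the minimized expression takes
   values in \bar R.  It is finite for s = T0, hence so is the infimum, which
   is attained because the expression is lower semicontinuous in s. *)
Definition loss_cost (R : realType) (T0 : R) (omega theta : R -> R) (l s : R)
  : \bar R :=
  ((l * omega l^-1 * s)%:E
   + \int[lebesgue_measure]_(t in `]s, T0[) (theta t)%:E)%E.

Definition loss (R : realType) (T0 : R) (omega theta : R -> R) (l : R) : R :=
  fine (ereal_inf [set loss_cost T0 omega theta l s | s in `[0, T0]]).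

Section regimes.
Context (R : realType).
Implicit Type m : R -> R.

Definition bounded_regime m := bounded_near m (pinfty_nbhs R).

Definition sublog_regime m :=
  m l @[l --> +oo] --> +oo /\ m l / ln l @[l --> +oo] --> (0 : R).

Definition log_regime m :=
  [/\ (0 < limf_einf (fun l => (m l / ln l)%:E) (pinfty_nbhs R))%E,
      (limf_einf (fun l => (m l / ln l)%:E) (pinfty_nbhs R)
       <= limf_esup (fun l => (m l / ln l)%:E) (pinfty_nbhs R))%E
    & (limf_esup (fun l => (m l / ln l)%:E) (pinfty_nbhs R) < +oo)%E].

Definition superlog_regime m := m l / ln l @[l --> +oo] --> +oo.

End regimes.

Section propagation_speeds.
Context (R : realType).
Variable T0 : R.
Implicit Types c g phi omega theta : R -> R.

Definition Loo_loc g :=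
  measurable_fun (`]0, T0[ : set R) g /\
  forall a b, 0 < a -> b < T0 -> exists K : R,
    {ae lebesgue_measure, forall t : R, t \in `[a, b] -> `|g t| <= K}.

(* Functions of class C^1 with compact support in the open interval (0, T0);
   on intervals this class of test functions gives the same weak derivatives
   as smooth functions (Brezis, Functional Analysis, Chapter 8). *)
Definition test_function phi :=
  [/\ forall t, derivable phi t 1,
      continuous (derive1 phi)
    & exists a b, [/\ 0 < a, b < T0
                    & forall t, t \notin `[a, b] -> phi t = 0]].

Definition weak_derivative c g :=
  forall phi, test_function phi ->
  \int[lebesgue_measure]_(t in `]0, T0[) (c t * derive1 phi t) =
  - \int[lebesgue_measure]_(t in `]0, T0[) (g t * phi t).

(* c is in W^{1,oo}_loc((0, T0)), with weak derivative g. *)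
Definition W1oo_loc c g :=
  [/\ Loo_loc c, Loo_loc g & weak_derivative c g].

(* Only the values of c on [0, T0] matter: PS is a set of functions defined on
   the whole line, and Loo_dist below is a pseudo-distance on it that
   identifies two functions when they agree on [0, T0].  Passing to the
   quotient does not change open, dense and residual sets. *)
Record PS (mu1 mu2 : R) omega theta c : Prop := InPS {
  PS_continuous : {within `[0, T0], continuous c};
  PS_bounds : forall t, t \in `[0, T0] -> mu1 <= c t <= mu2;
  PS_modulus : forall t s, t \in `[0, T0] -> s \in `[0, T0] ->
    `|c t - c s| <= omega `|t - s|;
  PS_derivative : exists2 g, W1oo_loc c g &
    {ae lebesgue_measure,
      forall t : R, t \in `]0, T0[ -> `|g t| <= theta t} }.

Definition Loo_dist c d : \bar R :=
  Lnorm (mrestr lebesgue_measure (measurable_itv `]0, T0[)) +oo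
    (fun t => (c t - d t)%:E).

End propagation_speeds.

Section residual.
Context (R : realType) (E : Type) (X : set E) (dist : E -> E -> \bar R).

Definition open_in (O : set E) :=
  O `<=` X /\
  forall x, O x -> exists2 e : R, 0 < e &
    forall y, X y -> (dist x y < e%:E)%E -> O y.

Definition dense_in (O : set E) :=
  forall x (e : R), X x -> 0 < e ->
    exists y, [/\ X y, O y & (dist x y < e%:E)%E].

Definition residual_in (S : set E) :=
  exists O : (set E)^nat,
    (forall n, open_in (O n) /\ dense_in (O n)) /\ \bigcap_n O n `<=` S.

End residual.

Section operators.
Context (R : realType) (H : completeNormedModType R).
Implicit Types (ip : {dot H for idfun}) (D : set H) (A : H -> H).

Definition compatible_inner_product ip := forall v, ip v v = `|v| ^+ 2.

(* A is an operator with domain D: its values outside D are irrelevant.  The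
   last clause says that A and its adjoint have the same graph. *)
Definition self_adjoint ip D A :=
  [/\ closure D = setT,
      D 0,
      forall (a : R) v w, D v -> D w ->
        D (a *: v + w) /\ A (a *: v + w) = a *: A v + A w
    & forall v w, (forall x, D x -> ip (A x) v = ip x w) <-> D v /\ A v = w].

Definition nonnegative_operator ip D A := forall v, D v -> 0 <= ip (A v) v.

Definition unbounded_operator D A :=
  ~ exists K : R, forall v, D v -> `|A v| <= K * `|v|.

(* The transform U is a unitary identification of H with L^2(mu) that turns A
   into the multiplication by lam ^ 2. *)
Record spectral_representation D A d (M : measurableType d)
    (mu : {measure set M -> \bar R}) (lam : M -> R) (U : H -> M -> R) : Prop :=
  SpectralRepresentation {
  spectral_measurable : measurable_fun [set: M] lam;
  spectral_ge0 : forall xi, 0 <= lam xi;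
  spectral_L2 : forall v, U v \in Lfun mu 2%:E;
  spectral_linear : forall (a : R) v w,
    {ae mu, forall xi, U (a *: v + w) xi = a * U v xi + U w xi};
  spectral_isometry : forall v, Lnorm mu 2%:E (EFin \o U v) = `|v|%:E;
  spectral_onto : forall f, f \in Lfun mu 2%:E ->
    exists v, {ae mu, forall xi, U v xi = f xi};
  spectral_domain : forall v,
    D v <-> (fun xi => lam xi ^+ 2 * U v xi) \in Lfun mu 2%:E;
  spectral_operator : forall v, D v ->
    {ae mu, forall xi, U (A v) xi = lam xi ^+ 2 * U v xi} }.

End operators.

(* From here on, generalized vectors are represented by their transforms. *)
Section derivative_loss.
Context d (M : measurableType d) (R : realType).
Variables (mu : {measure set M -> \bar R}) (lam : M -> R) (T0 : R).
Implicit Types (c : R -> R) (b : R) (w u : M -> R) (y z : R -> M -> R).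

Definition power_domain b w :=
  measurable_fun [set: M] w /\
  (fun xi => (1 + lam xi ^+ 2) `^ b * w xi) \in Lfun mu 2%:E.

Definition phase_space b w0 w1 :=
  power_domain (b + 2^-1) w0 /\ power_domain b w1.

(* z is the time derivative of y.  Continuity up to the end points and the
   equations inside determine the one-sided derivatives at 0 and T0.  Vectors
   have measurable transforms, and mu need not be complete, so measurability
   does not follow from the equation holding almost everywhere. *)
Definition is_solution c u0 u1 y z :=
  (forall t, t \in `[0, T0] ->
     measurable_fun [set: M] (y t) /\ measurable_fun [set: M] (z t)) /\
  {ae mu, forall xi,
    [/\ {within `[0, T0], continuous (fun t => y t xi)},
        {within `[0, T0], continuous (fun t => z t xi)},
        y 0 xi = u0 xi,
        z 0 xi = u1 xi
      & forall t, t \in `]0, T0[ ->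
          is_derive t 1 (fun s => y s xi) (z t xi) /\
          is_derive t 1 (fun s => z s xi) (- (lam xi ^+ 2 * c t * y t xi))]}.

(* P holds for the solution, which is unique up to null sets. *)
Definition the_solution c u0 u1
    (P : (R -> M -> R) -> (R -> M -> R) -> Prop) :=
  (exists y z, is_solution c u0 u1 y z) /\
  forall y z, is_solution c u0 u1 y z -> P y z.

Definition no_loss b c :=
  forall u0 u1, phase_space b u0 u1 ->
    the_solution c u0 u1 (fun y z =>
      forall t, t \in `[0, T0] -> phase_space b (y t) (z t)).

Definition at_most_small_loss b c :=
  forall u0 u1, phase_space b u0 u1 ->
    the_solution c u0 u1 (fun y z =>
      forall t eps, t \in `[0, T0] -> 0 < eps ->
        phase_space (b - eps) (y t) (z t)).

Definition small_loss_happens b c :=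
  exists u0 u1, phase_space b u0 u1 /\
    the_solution c u0 u1 (fun y z =>
      forall t, t \in `]0, T0] -> ~ phase_space b (y t) (z t)).

Definition at_most_finite_loss b c :=
  exists2 delta, 0 < delta &
    forall u0 u1, phase_space b u0 u1 ->
      the_solution c u0 u1 (fun y z =>
        forall t, t \in `[0, T0] -> phase_space (b - delta) (y t) (z t)).

Definition finite_loss_happens b c :=
  exists delta : R -> R, (forall t, t \in `]0, T0] -> 0 < delta t) /\
    exists u0 u1, phase_space b u0 u1 /\
      the_solution c u0 u1 (fun y z =>
        forall t, t \in `]0, T0] -> ~ phase_space (b - delta t) (y t) (z t)).

Definition infinite_loss b c :=
  exists u0 u1, phase_space b u0 u1 /\
    the_solution c u0 u1 (fun y z =>
      forall gamma t, 0 < gamma -> t \in `]0, T0] ->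
        ~ phase_space (- gamma) (y t) (z t)).

End derivative_loss.

(* Main.v *)
(* In the spectral representation the problem becomes, at each frequency l, the
   oscillator y'' + l^2 c(t) y = 0.  Replacing c by its mean over [t, t + 1/l]
   in the energy z^2 + l^2 c y^2 (with z = y') gives a function whose
   logarithmic derivative is at most a constant times
   rho(t) = min (l omega(1/l), theta(t)); since theta is nonincreasing, the
   integral of rho over [0, T0] is m(l).  Each regime bounds
   the resulting growth exp (C m(l)) by a power of 1 + l^2.

   Conversely, near every speed there is, for every large l, one that close to
   t = 0 oscillates at twice the frequency of the solution, with amplitude
   proportional to rho/l on each half period; the
   solution with data (0, 1) is then explicit and grows like exp (k m(l)).
   The spectrum is unbounded, so the speeds that amplify a piece of it beyond a
   given power of l form a dense open set.  For a speed in all these sets, a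
   summable superposition of amplified pieces is a datum with loss. *)

(* The resonant perturbation must stay inside the class, where a given speed may already saturate
   every constraint. Acting only on [0, tau] does not weaken the growth. Since theta is bounded away
   from 0, the part of the integral of rho beyond tau is bounded independently of l, and for the
   same reason the energy gained by time tau survives, up to a constant factor, at every later time.
   The loss is thus visible from tau on, and tau is arbitrarily small. The spectrum may be
   continuous, so there may be no eigenvector to amplify. Amplification is instead required for all
   frequencies in a set of positive finite measure close to l, with a margin e > 0 that survives
   small changes of the speed. The factor required of the n-th open set contains 2 ^ n, whose square
   outweighs the factor 2 ^ (- n - 1) in the superposition. *)
Require Import Defs.
From mathcomp Require Import all_boot all_order all_algebra.
From mathcomp Require Import all_classical all_reals all_analysis.
From mathcomp Require Import measurable_realfun ess_sup_inf ring lra.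
Import Order.TTheory GRing.Theory Num.Theory.
Import numFieldNormedType.Exports.
Local Open Scope classical_set_scope.
Local Open Scope ring_scope.
Set Implicit Arguments.
Unset Strict Implicit.
Unset Printing Implicit Defensive.

(** * Comparison principles, geometric sequences and primitives *)

Section calculus.
Context {R : realType}.
Implicit Types (a b t : R) (f g F G : R -> R).

Lemma derive_le0_le f df a b : a <= b ->
  {within `[a, b], continuous f} ->
  (forall t, t \in `]a, b[ -> is_derive t 1 f (df t)) ->
  (forall t, t \in `]a, b[ -> df t <= 0) -> f b <= f a.
Proof.
rewrite le_eqVlt => /predU1P[->//|ab] cf dfE df0.
have [c cab E] := MVT ab dfE cf.
rewrite -subr_le0 E; apply: mulr_le0_ge0; first exact: df0.
by rewrite subr_ge0 ltW.
Qed.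

(** The product f * exp (- G) is nonincreasing. Stating the bound with a primitive [G] of the
    coefficient, rather than with its integral, keeps measure theory out of the energy estimates. *)
Lemma gronwall f df G g a b : a <= b ->
  {within `[a, b], continuous f} -> {within `[a, b], continuous G} ->
  (forall t, t \in `]a, b[ -> is_derive t 1 f (df t)) ->
  (forall t, t \in `]a, b[ -> is_derive t 1 G (g t)) ->
  (forall t, t \in `]a, b[ -> df t <= g t * f t) ->
  f b <= f a * expR (G b - G a).
Proof.
move=> ab cf cG dfE dGE dfg.
pose F t := f t * expR (- G t).
have Fab : F b <= F a.
  apply: (@derive_le0_le F (fun t => (df t - g t * f t) * expR (- G t))) => //.
  - move=> x; apply: cvgM; first exact: cf.
    by apply: continuous_comp; [apply: cvgN; exact: cG|exact: continuous_expR].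
  - move=> t tab; have := dfE t tab; have := dGE t tab => ? ?.
    apply: is_derive_eq.
    by rewrite /GRing.scale /=; ring.
  - by move=> t tab; rewrite pmulr_lle0 ?expR_gt0// subr_le0 dfg.
rewrite expRD -(ler_pM2r (expR_gt0 (- G b))).
have e1 : expR (G b) * expR (- G b) = 1 by rewrite -expRD subrr expR0.
rewrite (_ : f a * _ * _ = f a * expR (- G a) * (expR (G b) * expR (- G b))).
  by rewrite e1 mulr1.
by ring.
Qed.

Lemma gronwall_ge f df G g a b : a <= b ->
  {within `[a, b], continuous f} -> {within `[a, b], continuous G} ->
  (forall t, t \in `]a, b[ -> is_derive t 1 f (df t)) ->
  (forall t, t \in `]a, b[ -> is_derive t 1 G (g t)) ->
  (forall t, t \in `]a, b[ -> - (g t * f t) <= df t) ->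
  f a * expR (- (G b - G a)) <= f b.
Proof.
move=> ab cf cG dfE dGE dfg.
rewrite -lerN2 -mulNr (opprB (G b)) addrC -[in X in expR X](opprK (G a)).
apply: (@gronwall (\- f) (\- df) (\- G) (\- g)) => //.
- by move=> x; apply: cvgN; exact: cf.
- by move=> x; apply: cvgN; exact: cG.
- by move=> t tab; have ? := dfE t tab; apply: is_deriveN.
- by move=> t tab; have ? := dGE t tab; apply: is_deriveN.
- by move=> t tab /=; rewrite mulrNN lerNl dfg.
Qed.

Lemma derive_dominated f df G g a b : a <= b ->
  {within `[a, b], continuous f} -> {within `[a, b], continuous G} ->
  (forall t, t \in `]a, b[ -> is_derive t 1 f (df t)) ->
  (forall t, t \in `]a, b[ -> is_derive t 1 G (g t)) ->
  (forall t, t \in `]a, b[ -> `|df t| <= g t) ->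
  `|f b - f a| <= G b - G a.
Proof.
move=> ab cf cG dfE dGE dfg.
have h1 : f b - G b <= f a - G a.
  apply: (@derive_le0_le (f \- G) (fun t => df t - g t)) => //.
  - by move=> x; apply: cvgB; [exact: cf|exact: cG].
  - by move=> t tab; have ? := dfE t tab; have ? := dGE t tab; apply: is_deriveB.
  - by move=> t tab; rewrite subr_le0 (le_trans (ler_norm _))// dfg.
have h2 : - f b - G b <= - f a - G a.
  apply: (@derive_le0_le ((\- f) \- G) (fun t => - df t - g t)) => //.
  - by move=> x; apply: cvgB; [apply: cvgN; exact: cf|exact: cG].
  - move=> t tab; have ? := dfE t tab; have ? := dGE t tab.
    by apply: is_deriveB; exact: is_deriveN.
  - by move=> t tab; rewrite subr_le0 (le_trans (ler_norm _))// normrN dfg.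
by rewrite ler_norml; apply/andP; split; lra.
Qed.

Lemma within_continuous_modulus f (w : R -> R) a b :
  w s @[s --> 0^'+] --> (0 : R) ->
  {in `[a, b] &, forall s t, `|f t - f s| <= w `|t - s|} ->
  {within `[a, b], continuous f}.
Proof.
move=> w0 fw; apply/subspace_continuousP => x xab; apply/cvgrPdist_le => /= e e0.
have /cvgrPdist_le/(_ e e0) := w0; rewrite near_withinE.
move=> /nbhs_ballP[d /= d0 dw]. near=> y => /= yab.
have [->|xy] := eqVneq y x; first by rewrite subrr normr0 ltW.
have h0 : `|f x - f y| <= w `|x - y| := fw _ _ yab xab; apply: (le_trans h0).
have := dw `|x - y|; rewrite /ball /= !sub0r !normrN normr_id normr_gt0 subr_eq0 eq_sym.
move=> h; rewrite (le_trans (ler_norm _))// h//.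
Unshelve. all: by end_near. Qed.

(** The intervals of radius 2 A / 2 ^ n around u n are nested, and l is the supremum of their left
    ends. The explicit rate lets the Picard iteration pass to the limit under the primitives. *)
Lemma seq_geometric (u : nat -> R) (A : R) :
  (forall n, `|u n.+1 - u n| <= A * 2^-1 ^+ n) ->
  exists l, forall n, `|u n - l| <= 2 * A * 2^-1 ^+ n.
Proof.
move=> uA.
pose lo n := u n - 2 * A * 2^-1 ^+ n; pose hi n := u n + 2 * A * 2^-1 ^+ n.
have A0 : 0 <= A by have := uA 0%N; rewrite expr0 mulr1; exact: le_trans.
have e0 n : 0 <= 2^-1 ^+ n :> R by rewrite exprn_ge0// invr_ge0.
have loS n : lo n <= lo n.+1.
  by have := uA n; rewrite /lo exprS ler_norml => /andP[? ?]; lra.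
have hiS n : hi n.+1 <= hi n.
  by have := uA n; rewrite /hi exprS ler_norml => /andP[? ?]; lra.
have lohi n m : lo n <= hi m.
  have h1 : lo n <= lo (maxn n m).
    by apply: (@homo_leq _ lo (fun x y => x <= y)) (leq_maxl n m) => //; exact: le_trans.
  have h2 : hi (maxn n m) <= hi m.
    apply: (@homo_leq _ hi (fun x y => y <= x)) (leq_maxr n m) => //.
    by move=> ? ? ? /[swap]; exact: le_trans.
  apply: (le_trans h1); apply: le_trans h2; rewrite /lo /hi.
  by have := mulr_ge0 A0 (e0 (maxn n m)); lra.
exists (sup (range lo)) => n.
have hs : has_sup (range lo).
  by split; [exists (lo 0%N), 0%N|exists (hi 0%N) => _ [m _ <-]].
have h1 : lo n <= sup (range lo) by apply: ub_le_sup; [case: hs|exists n].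
have h2 : sup (range lo) <= hi n.
  by apply: ge_sup; [case: hs|move=> _ [m _ <-]].
by rewrite ler_norml; move: h1 h2; rewrite /lo /hi => ? ?; apply/andP; split; lra.
Qed.

Lemma le_add_geometric (x c B : R) :
  (forall n, x <= c + B * 2^-1 ^+ n) -> x <= c.
Proof.
move=> h; have : (fun n => c + B * 2^-1 ^+ n) @ \oo --> c + B * 0.
  apply: cvgD; first exact: cvg_cst.
  apply: cvgM; first exact: cvg_cst.
  by apply: cvg_expr; rewrite ger0_norm ?invr_ge0// invf_lt1// ltr1n.
by rewrite mulr0 addr0 => /cvgr_to_ge; apply; exact: nearW.
Qed.

Lemma primitive_within f a b : {within `[a, b], continuous f} ->
  exists F, [/\ F a = 0, {within `[a, b], continuous F}
    & forall t, t \in `]a, b[ -> is_derive t 1 F (f t)].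
Proof.
move=> cf.
have intf : lebesgue_measure.-integrable `[a, b] (EFin \o f).
  by apply: continuous_compact_integrable => //; exact: segment_compact.
exists (fun x => \int[lebesgue_measure]_(t in `[a, x]) f t); split.
- by rewrite set_itv1 Rintegral_set1.
- have [ab|ba] := leP a b; first exact: parameterized_integral_continuous.
  by rewrite set_itv_ge ?bnd_simp -?ltNge//; exact: continuous_subspace0.
move=> t tab; move: (tab); rewrite in_itv/= => /andP[at_ tb].
have ft := within_continuous_continuous (lt_trans at_ tb) cf tab.
have [] := @continuous_FTC1_closed R f a t b tb intf at_ ft.
by move=> dF <-; rewrite derive1E; exact/derivableP.
Qed.

End calculus.

(** With k = lam xi ^ 2 * c these are the conditions that [is_solution] imposes at a fixed xi, apart
    from the initial values. *)
Definition solves (R : realType) (a b : R) (k y z : R -> R) :=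
  [/\ {within `[a, b], continuous y}, {within `[a, b], continuous z}
    & forall t, t \in `]a, b[ ->
        is_derive t 1 y (z t) /\ is_derive t 1 z (- (k t * y t))].

(** * The oscillator equation *)

Section oscillator.
Context {R : realType}.
Implicit Types (a b t L : R) (k y z : R -> R).

Lemma solvesS a b a' b' k y z : a <= a' -> b' <= b ->
  solves a b k y z -> solves a' b' k y z.
Proof.
move=> aa bb [cy cz yz]; have sub : `[a', b'] `<=` `[a, b].
  by apply: subset_itv; rewrite bnd_simp.
split; [exact: continuous_subspaceW cy|exact: continuous_subspaceW cz|].
move=> t; rewrite in_itv/= => /andP[at_ tb]; apply: yz.
by rewrite in_itv/= (le_lt_trans aa) ?(lt_le_trans tb).
Qed.

Lemma solvesZ a b k y z (r : R) : solves a b k y z ->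
  solves a b k (fun t => r * y t) (fun t => r * z t).
Proof.
move=> [cy cz yz]; split.
- by move=> x; apply: cvgM; [exact: cvg_cst|exact: cy].
- by move=> x; apply: cvgM; [exact: cvg_cst|exact: cz].
move=> t /yz[dy dz]; split; apply: is_derive_eq => /=;
  rewrite /GRing.scale /=; ring.
Qed.

Lemma solves_eq_coef a b k k' y z : {in `]a, b[, k =1 k'} ->
  solves a b k y z -> solves a b k' y z.
Proof. by move=> kk [cy cz yz]; split=> // t tab; rewrite -kk//; exact: yz. Qed.

(** A crude bound, exponential in the size of k: it serves at bounded frequencies and as an a priori
    bound, whereas high frequencies need [energy_estimate]. *)
Lemma solves_energy_le a b k y z L : a <= b -> 0 <= L ->
  (forall t, t \in `]a, b[ -> `|k t| <= L) -> solves a b k y z ->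
  y b ^+ 2 + z b ^+ 2 <= (y a ^+ 2 + z a ^+ 2) * expR ((1 + L) * (b - a)).
Proof.
move=> ab L0 kL [cy cz yz].
rewrite mulrBr; apply: (@gronwall _ (fun t => y t ^+ 2 + z t ^+ 2)
  (fun t => 2 * y t * z t - 2 * z t * (k t * y t))
  (fun t => (1 + L) * t) (fun=> 1 + L)) => //.
- move=> x; apply: cvgD; apply: cvgM; by [exact: cy|exact: cz].
- by apply: continuous_subspaceT => x; apply: cvgM; [exact: cvg_cst|exact: cvg_id].
- move=> t /yz[dy dz]; apply: is_derive_eq.
  by rewrite /GRing.scale /=; ring.
- by move=> t _; apply: is_derive_eq; rewrite /GRing.scale /=; ring.
- move=> t /kL; rewrite ler_norml => /andP[k1 k2] /=.
  have h1 : 0 <= (y t - z t) ^+ 2 by exact: sqr_ge0.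
  have h2 : 0 <= (y t + z t) ^+ 2 by exact: sqr_ge0.
  have h3 : 0 <= (L - k t) * (y t - z t) ^+ 2 by rewrite mulr_ge0// subr_ge0.
  have h4 : 0 <= (L + k t) * (y t + z t) ^+ 2.
    by rewrite mulr_ge0// -lerBlDl sub0r.
  by lra.
Qed.

Lemma solves_dependence a b k1 k2 y1 z1 y2 z2 L Y (e : R) : a <= b -> 0 <= L ->
  (forall t, t \in `]a, b[ -> `|k1 t| <= L) ->
  (forall t, t \in `]a, b[ -> `|k1 t - k2 t| <= e) ->
  (forall t, t \in `]a, b[ -> y2 t ^+ 2 <= Y) -> 0 <= e -> 0 <= Y ->
  solves a b k1 y1 z1 -> solves a b k2 y2 z2 ->
  y1 a = y2 a -> z1 a = z2 a ->
  (y1 b - y2 b) ^+ 2 + (z1 b - z2 b) ^+ 2 <=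
    e ^+ 2 * Y * expR ((2 + L) * (b - a)).
Proof.
move=> ab L0 kL ke yY e0 Y0 [cy1 cz1 yz1] [cy2 cz2 yz2] ya za.
(* The constant e ^ 2 Y absorbs the forcing term (k1 - k2) y2, so that the inequality for f is
   homogeneous: f' <= (2 + L) f. *)
pose f t := (y1 t - y2 t) ^+ 2 + (z1 t - z2 t) ^+ 2 + e ^+ 2 * Y.
have : f b <= f a * expR ((2 + L) * b - (2 + L) * a).
  apply: (@gronwall _ f
    (fun t => 2 * (y1 t - y2 t) * (z1 t - z2 t) -
              2 * (z1 t - z2 t) * (k1 t * y1 t - k2 t * y2 t))
    (fun t => (2 + L) * t) (fun=> 2 + L)) => //.
  - move=> x; apply: cvgD; last exact: cvg_cst.
    by apply: cvgD; apply: cvgM; apply: cvgB;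
      [exact: cy1|exact: cy2|exact: cy1|exact: cy2
      |exact: cz1|exact: cz2|exact: cz1|exact: cz2].
  - by apply: continuous_subspaceT => x; apply: cvgM; [exact: cvg_cst|exact: cvg_id].
  - move=> t tab; have [dy1 dz1] := yz1 t tab; have [dy2 dz2] := yz2 t tab.
    by apply: is_derive_eq; rewrite /GRing.scale /=; ring.
  - by move=> t _; apply: is_derive_eq; rewrite /GRing.scale /=; ring.
  - move=> t tab; have := kL t tab; rewrite ler_norml => /andP[k1l k1u] /=.
    have yt := yY t tab; have ket := ke t tab.
    rewrite /f; set p := y1 t - y2 t; set q := z1 t - z2 t.
    have -> : k1 t * y1 t - k2 t * y2 t = k1 t * p + (k1 t - k2 t) * y2 t.
      by rewrite /p; ring.
    have h0 : 0 <= p ^+ 2 by exact: sqr_ge0.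
    have h1 : 0 <= (p - q) ^+ 2 by exact: sqr_ge0.
    have h3 : 0 <= (L - k1 t) * (p - q) ^+ 2 by rewrite mulr_ge0 ?sqr_ge0// subr_ge0.
    have h4 : 0 <= (L + k1 t) * (p + q) ^+ 2.
      by rewrite mulr_ge0 ?sqr_ge0// -lerBlDl sub0r.
    have h5 : 0 <= (q + (k1 t - k2 t) * y2 t) ^+ 2 by exact: sqr_ge0.
    have h6 : ((k1 t - k2 t) * y2 t) ^+ 2 <= e ^+ 2 * Y.
      rewrite exprMn ler_pM ?sqr_ge0// -[X in X <= _]real_normK ?num_real//.
      by rewrite lerXn2r ?nnegrE.
    have h7 : 0 <= (1 + L) * (e ^+ 2 * Y).
      by rewrite mulr_ge0 ?addr_ge0// mulr_ge0 ?sqr_ge0.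
    by lra.
rewrite /f ya za !subrr expr0n /= !addr0 !add0r mulrBr; apply: le_trans.
by rewrite lerDl mulr_ge0 ?sqr_ge0.
Qed.

(** Continuous dependence with e = 0, once the second solution has some bound Y. *)
Lemma solves_unique a b k y1 z1 y2 z2 L : a <= b -> 0 <= L ->
  (forall t, t \in `]a, b[ -> `|k t| <= L) ->
  solves a b k y1 z1 -> solves a b k y2 z2 -> y1 a = y2 a -> z1 a = z2 a ->
  forall t, t \in `[a, b] -> y1 t = y2 t /\ z1 t = z2 t.
Proof.
move=> ab L0 kL s1 s2 ya za t; rewrite in_itv/= => /andP[at_ tb].
have sub u : u \in `]a, t[ -> u \in `]a, b[.
  by rewrite !in_itv/= => /andP[-> /lt_le_trans]; apply.
have kL' u : u \in `]a, t[ -> `|k u| <= L by move/sub; exact: kL.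
have s2t := solvesS (lexx a) tb s2; have s1t := solvesS (lexx a) tb s1.
pose Y := (y2 a ^+ 2 + z2 a ^+ 2) * expR ((1 + L) * (t - a)).
have Y0 : 0 <= Y by rewrite mulr_ge0 ?addr_ge0 ?sqr_ge0 ?expR_ge0.
have := @solves_dependence a t k k y1 z1 y2 z2 L Y 0 at_ L0 kL' _ _ (lexx _) Y0
  s1t s2t ya za.
rewrite expr0n /= !mul0r => h.
have {h} : (y1 t - y2 t) ^+ 2 + (z1 t - z2 t) ^+ 2 <= 0.
  apply: h => [u _|u]; first by rewrite subrr normr0.
  rewrite in_itv/= => /andP[au ut].
  have := @solves_energy_le a u k y2 z2 L (ltW au) L0 _ (solvesS (lexx a) (ltW ut) s2t).
  move=> h2; rewrite (le_trans (_ : _ <= y2 u ^+ 2 + z2 u ^+ 2)) ?lerDl ?sqr_ge0//.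
  rewrite (le_trans (h2 _))//.
    move=> v; rewrite in_itv/= => /andP[av vu]; apply: kL'.
    by rewrite in_itv/= av (lt_trans vu).
  rewrite ler_wpM2l ?addr_ge0 ?sqr_ge0// ler_expR ler_wpM2l ?addr_ge0//.
  by rewrite lerD2r ltW.
rewrite le_eqVlt ltNge addr_ge0 ?sqr_ge0//= orbF paddr_eq0 ?sqr_ge0//.
by rewrite !sqrf_eq0 !subr_eq0 => /andP[/eqP-> /eqP->].
Qed.
End oscillator.

Section existence.
Context {R : realType}.
Variables (T L : R) (k : R -> R) (y0 z0 : R).
Hypotheses (L1 : 1 <= L) (ck : {within `[0, T], continuous k})
  (kL : forall t, t \in `[0, T] -> `|k t| <= L).

(** One fixed primitive vanishing at 0 for each continuous f; the default [cst 0] is taken only when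
    there is none. *)
Let prim (f : R -> R) : R -> R :=
  xget (cst 0) [set F : R -> R | [/\ F 0 = 0, {within `[0, T], continuous F}
  & forall t : R, t \in `]0, T[ -> is_derive t 1 F (f t)]].

Let primP f : {within `[0, T], continuous f} ->
  [/\ prim f 0 = 0, {within `[0, T], continuous (prim f)}
    & forall t : R, t \in `]0, T[ -> is_derive t 1 (prim f) (f t)].
Proof.
by move=> /primitive_within[F FP]; rewrite /prim; case: xgetP => [G _ //|/(_ F)[]].
Qed.

Let L0 : 0 < L. Proof. by rewrite (lt_le_trans ltr01). Qed.

(** In the norm weighted by exp (2 L t), taking a primitive gains a factor 1 / (2 L), while the
    right-hand side of the system costs at most L. The Picard map therefore contracts by 1/2 on all
    of [0, T], whatever its length. *)
Let growth_le (F f : R -> R) (C : R) : 0 <= C -> F 0 = 0 ->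
  {within `[0, T], continuous F} ->
  (forall t, t \in `]0, T[ -> is_derive t 1 F (f t)) ->
  (forall t, t \in `[0, T] -> `|f t| <= 2 * L * (C * expR (2 * L * t))) ->
  forall t, t \in `[0, T] -> `|F t| <= C * expR (2 * L * t).
Proof.
move=> C0 F0 cF dF fC t; rewrite in_itv/= => /andP[t0 tT].
have sub : `[0, t] `<=` `[0, T] by apply: subset_itv; rewrite bnd_simp.
have subT u : u \in `]0, t[ -> u \in `]0, T[.
  by rewrite !in_itv/= => /andP[-> /lt_le_trans]; apply.
have cE : {within `[0, t], continuous (fun u => C * expR (2 * L * u))}.
  apply: continuous_subspaceT => x; apply: cvgM; first exact: cvg_cst.
  apply: (@continuous_comp _ _ _ _ expR); last exact: continuous_expR.
  by apply: cvgM; [exact: cvg_cst|exact: cvg_id].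
have dE u : u \in `]0, t[ ->
    is_derive u 1 (fun u => C * expR (2 * L * u)) (2 * L * (C * expR (2 * L * u))).
  by move=> _; apply: is_derive_eq; rewrite /GRing.scale /=; ring.
have dF' u : u \in `]0, t[ -> is_derive u 1 F (f u) by move/subT; exact: dF.
have fC' u : u \in `]0, t[ -> `|f u| <= 2 * L * (C * expR (2 * L * u)).
  by move=> /subT uT; apply: fC; exact: subset_itv_oo_cc.
have := derive_dominated t0 (continuous_subspaceW sub cF) cE dF' dE fC'.
rewrite F0 subr0 mulr0 expR0 mulr1 => /le_trans; apply.
by rewrite gerBl.
Qed.

Let ckM f : {within `[0, T], continuous f} ->
  {within `[0, T], continuous (fun t => k t * f t)}.
Proof. by move=> cf x; apply: cvgM; [exact: ck|exact: cf]. Qed.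

Let picard := fix picard n : (R -> R) * (R -> R) :=
  if n is m.+1 then
    (fun t => y0 + prim (picard m).2 t,
     fun t => z0 - prim (fun s => k s * (picard m).1 s) t)
  else (cst y0, cst z0).

Let picard_cont n : {within `[0, T], continuous (picard n).1} /\
  {within `[0, T], continuous (picard n).2}.
Proof.
elim: n => [|n [c1 c2]] /=; first by split; apply: continuous_subspaceT; exact: cst_continuous.
have [_ p1 _] := primP c2; have [_ p2 _] := primP (ckM c1).
by split=> x; [apply: cvgD|apply: cvgB];
  [exact: cvg_cst|exact: p1|exact: cvg_cst|exact: p2].
Qed.

Let K := L * (`|y0| + `|z0|) .

Let K0 : 0 <= K. Proof. by rewrite mulr_ge0 ?(ltW L0)// addr_ge0. Qed.

Let e0 m : 0 <= 2^-1 ^+ m :> R. Proof. by rewrite exprn_ge0// invr_ge0. Qed.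

Let picard_step n t : t \in `[0, T] ->
  `|(picard n.+1).1 t - (picard n).1 t| <= K * 2^-1 ^+ n * expR (2 * L * t) /\
  `|(picard n.+1).2 t - (picard n).2 t| <= K * 2^-1 ^+ n * expR (2 * L * t).
Proof.
have C0 m : 0 <= K * 2^-1 ^+ m by rewrite mulr_ge0.
elim: n t => [|n IHn] t tT.
  have [c1 c2] := picard_cont 0.
  (* The first differences are bounded by K; as L >= 1 and the weight is at least 1, this is within
     the hypothesis of [growth_le]. *)
  have base (u x : R) : u \in `[0, T] -> x <= K ->
      x <= 2 * L * (K * 2^-1 ^+ 0 * expR (2 * L * u)).
    rewrite in_itv/= => /andP[u0 _]; rewrite expr0 mulr1 => /le_trans; apply.
    have e1 : 1 <= expR (2 * L * u).
      by rewrite -expR0 ler_expR mulr_ge0// mulr_ge0// ltW.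
    have : K * 1 <= K * expR (2 * L * u) by rewrite ler_wpM2l.
    have : 0 <= (L - 1) * (K * expR (2 * L * u)).
      by rewrite mulr_ge0 ?subr_ge0// mulr_ge0// expR_ge0.
    have := mulr_ge0 K0 (expR_ge0 (2 * L * u)).
    by lra.
  rewrite [picard 0]/= [picard 1]/= [(_, _).1]/= [(_, _).2]/= /cst.
  rewrite [y0 + _]addrC addrK [z0 - _]addrC addrK normrN.
  have [p1 p2 p3] := primP c2; have [q1 q2 q3] := primP (ckM c1).
  split.
    apply: (growth_le (C0 0%N) p1 p2 p3 _ tT) => u uT; apply: base => //.
    rewrite /K /= (le_trans (_ : _ <= 1 * (`|y0| + `|z0|)))//.
      by rewrite mul1r lerDr.
    by rewrite ler_wpM2r// addr_ge0.
  apply: (growth_le (C0 0%N) q1 q2 q3 _ tT) => u uT; apply: base => //.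
  rewrite /K /= normrM ler_pM//; first exact: kL.
  by rewrite lerDl.
have [c1 c2] := picard_cont n; have [c1' c2'] := picard_cont n.+1.
have [p1 p2 p3] := primP c2; have [q1 q2 q3] := primP (ckM c1).
have [p1' p2' p3'] := primP c2'; have [q1' q2' q3'] := primP (ckM c1').
have bnd u x : x <= L * (K * 2^-1 ^+ n * expR (2 * L * u)) ->
  x <= 2 * L * (K * 2^-1 ^+ n.+1 * expR (2 * L * u)).
  by rewrite exprS; lra.
have stepE m s : (picard m.+1).1 s = y0 + prim (picard m).2 s by [].
have stepE2 m s : (picard m.+1).2 s = z0 - prim (fun s => k s * (picard m).1 s) s.
  by [].
rewrite (stepE n.+1) (stepE n) (stepE2 n.+1) (stepE2 n).
rewrite opprD addrACA subrr add0r opprD opprK addrACA subrr add0r.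
split.
  apply: (@growth_le (fun s => prim (picard n.+1).2 s - prim (picard n).2 s)
    (fun s => (picard n.+1).2 s - (picard n).2 s)) => //.
  - by rewrite p1 p1' subrr.
  - by move=> x; apply: cvgB; [exact: p2'|exact: p2].
  - by move=> u uT; have ? := p3 u uT; have ? := p3' u uT; apply: is_deriveB.
  - move=> u uT; apply: bnd; have [_ h] := IHn u uT; apply: (le_trans h).
    by rewrite ler_peMl// mulr_ge0 ?expR_ge0// mulr_ge0.
apply: (@growth_le (fun s => - prim (fun s => k s * (picard n.+1).1 s) s
    + prim (fun s => k s * (picard n).1 s) s)
    (fun s => - (k s * (picard n.+1).1 s) + k s * (picard n).1 s)) => //.
- by rewrite q1 q1' oppr0 addr0.
- by move=> x; apply: cvgD; [apply: cvgN; exact: q2'|exact: q2].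
- move=> u uT; have ? := q3 u uT; have ? := q3' u uT.
  by apply: is_deriveD; exact: is_deriveN.
- move=> u uT; apply: bnd; have [h _] := IHn u uT.
  rewrite addrC -opprB normrN -mulrBr normrM ler_pM//; exact: kL.
Qed.

Lemma solves_exists : exists y z,
  [/\ solves 0 T k y z, y 0 = y0 & z 0 = z0].
Proof.
pose A := K * expR (2 * L * T).
have A0 : 0 <= A by rewrite mulr_ge0// expR_ge0.
have step n t : t \in `[0, T] ->
    `|(picard n.+1).1 t - (picard n).1 t| <= A * 2^-1 ^+ n /\
    `|(picard n.+1).2 t - (picard n).2 t| <= A * 2^-1 ^+ n.
  move=> tT; have [h1 h2] := picard_step n tT.
  have hA : K * 2^-1 ^+ n * expR (2 * L * t) <= A * 2^-1 ^+ n.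
    rewrite /A mulrAC ler_wpM2r// ler_wpM2l// ler_expR ler_wpM2l//; first by rewrite mulr_ge0// ltW.
    by move: tT; rewrite in_itv/= => /andP[].
  by split; [exact: le_trans hA|exact: le_trans hA].
have /choice[y yP] : forall t, exists l, t \in `[0, T] ->
    forall n, `|(picard n).1 t - l| <= 2 * A * 2^-1 ^+ n.
  move=> t; have [tT|tT] := boolP (t \in `[0, T]); last by exists 0.
  have [l lP] := @seq_geometric R (fun n => (picard n).1 t) A (fun n => (step n t tT).1).
  by exists l.
have /choice[z zP] : forall t, exists l, t \in `[0, T] ->
    forall n, `|(picard n).2 t - l| <= 2 * A * 2^-1 ^+ n.
  move=> t; have [tT|tT] := boolP (t \in `[0, T]); last by exists 0.
  have [l lP] := @seq_geometric R (fun n => (picard n).2 t) A (fun n => (step n t tT).2).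
  by exists l.
have unif_cont (f : R -> R) (g : nat -> R -> R) :
    (forall n, {within `[0, T], continuous (g n)}) ->
    (forall t, t \in `[0, T] -> forall n, `|g n t - f t| <= 2 * A * 2^-1 ^+ n) ->
    {within `[0, T], continuous f}.
  move=> cg gf; apply/subspace_continuousP => x xT; apply/cvgrPdist_le => /= e e0'.
  have [n nP] : exists n, 2 * A * 2^-1 ^+ n <= e / 3.
    have : (fun n => 2 * A * 2^-1 ^+ n) @ \oo --> 2 * A * 0.
      apply: cvgM; first exact: cvg_cst.
      by apply: cvg_expr; rewrite ger0_norm ?invr_ge0// invf_lt1// ltr1n.
    rewrite mulr0 => /cvgrPdist_le/(_ (e / 3))[]; first by rewrite divr_gt0.
    move=> n _ /(_ n (leqnn n)) /=; rewrite sub0r normrN => h; exists n.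
    exact: le_trans (ler_norm _) h.
  have /subspace_continuousP/(_ x xT)/cvgrPdist_le/(_ (e / 3)) := cg n.
  rewrite divr_gt0// => /(_ isT); rewrite !near_withinE => H; near=> u => /= uT.
  have hu' : `|g n x - g n u| <= e / 3 by move: uT; near: u; exact: H.
  change (`|f x - f u| <= e).
  move: hu' (gf x xT n) (gf u uT n).
  rewrite !ler_norml => /andP[? ?] /andP[? ?] /andP[? ?].
  by apply/andP; split; lra.
have cy : {within `[0, T], continuous y}.
  exact: unif_cont (fun n => (picard_cont n).1) yP.
have cz : {within `[0, T], continuous z}.
  exact: unif_cont (fun n => (picard_cont n).2) zP.
have [p1 p2 p3] := primP cz; have [q1 q2 q3] := primP (ckM cy).
have prim_lim (f : R -> R) (g : nat -> R -> R) (C : R) : 0 <= C ->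
    {within `[0, T], continuous f} ->
    (forall n, {within `[0, T], continuous (g n)}) ->
    (forall t, t \in `[0, T] -> forall n, `|g n t - f t| <= C * 2^-1 ^+ n) ->
    forall t, t \in `[0, T] -> forall n,
      `|prim (g n) t - prim f t| <= C * expR (2 * L * T) * 2^-1 ^+ n.
  move=> C0 cf cg gf t tT n.
  have [f1 f2 f3] := primP cf; have [g1 g2 g3] := primP (cg n).
  rewrite (le_trans (@growth_le (fun s => prim (g n) s - prim f s)
    (fun s => g n s - f s) (C * 2^-1 ^+ n) _ _ _ _ _ t tT))//.
  - by rewrite mulr_ge0.
  - by rewrite f1 g1 subrr.
  - by move=> x; apply: cvgB; [exact: g2|exact: f2].
  - by move=> u uT; have ? := f3 u uT; have ? := g3 u uT; apply: is_deriveB.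
  - move=> u uT; apply: (le_trans (gf u uT n)).
    rewrite in_itv/= in uT; case/andP: uT => u0 _.
    have e1 : 1 <= expR (2 * L * u).
      by rewrite -expR0 ler_expR mulr_ge0// mulr_ge0// ltW.
    have C1 : 0 <= C * 2^-1 ^+ n by rewrite mulr_ge0.
    have h1 : C * 2^-1 ^+ n * 1 <= C * 2^-1 ^+ n * expR (2 * L * u) by rewrite ler_wpM2l.
    have h2 : 0 <= (L - 1) * (C * 2^-1 ^+ n * expR (2 * L * u)).
      by rewrite mulr_ge0 ?subr_ge0// mulr_ge0// expR_ge0.
    have := mulr_ge0 C1 (expR_ge0 (2 * L * u)).
    by lra.
  - rewrite mulrAC ler_wpM2r// ler_wpM2l// ler_expR ler_wpM2l//; first by rewrite mulr_ge0// ltW.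
    by move: tT; rewrite in_itv/= => /andP[].
(* The integral expressions, rather than the limits y and z, are the witnesses: their derivatives
   are immediate, and they agree with the limits on [0, T]. *)
pose yy t := y0 + prim z t; pose zz t := z0 - prim (fun s => k s * y s) t.
have eq_lim (x u v : R) (B : R) : (forall n, `|x - u| <= 0 + B * 2^-1 ^+ n) -> x = u.
  by move=> /le_add_geometric; rewrite normr_le0 subr_eq0 => /eqP.
have yE t : t \in `[0, T] -> y t = yy t.
  move=> tT; apply: (@eq_lim _ _ 0 (2 * A + 2 * A * expR (2 * L * T))) => n.
  have h1 := yP t tT n.+1.
  have h2 := prim_lim z (fun n => (picard n).2) (2 * A) (mulr_ge0 (ler0n _ 2) A0) cz
    (fun n => (picard_cont n).2) zP t tT n.
  have h3 : 2 * A * 2^-1 ^+ n.+1 <= 2 * A * 2^-1 ^+ n.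
    by have := mulr_ge0 A0 (e0 n); rewrite exprS; lra.
  move: h1 h2; rewrite /yy /= !ler_norml => /andP[? ?] /andP[? ?].
  by apply/andP; split; lra.
have zE t : t \in `[0, T] -> z t = zz t.
  move=> tT; apply: (@eq_lim _ _ 0 (2 * A + L * (2 * A) * expR (2 * L * T))) => n.
  have h1 := zP t tT n.+1.
  have h2 := prim_lim (fun s => k s * y s) (fun n => fun s => k s * (picard n).1 s)
    (L * (2 * A)) _ (ckM cy)
    (fun n => ckM (picard_cont n).1) _ t tT n.
  have {}h2 := h2 (mulr_ge0 (ltW L0) (mulr_ge0 (ler0n _ 2) A0)).
  have {}h2 := h2 ltac:(move=> u uT m; rewrite -mulrBr normrM -mulrA ler_pM//;
     [exact: kL|exact: yP]).
  have h3 : 2 * A * 2^-1 ^+ n.+1 <= 2 * A * 2^-1 ^+ n.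
    by have := mulr_ge0 A0 (e0 n); rewrite exprS; lra.
  move: h1 h2; rewrite /zz /= !ler_norml => /andP[? ?] /andP[? ?].
  by apply/andP; split; lra.
exists yy, zz; split; last 2 first.
- by rewrite /yy p1 addr0.
- by rewrite /zz q1 subr0.
split.
- by move=> x; apply: cvgD; [exact: cvg_cst|exact: p2].
- by move=> x; apply: cvgB; [exact: cvg_cst|exact: q2].
move=> t tT; have tT' : t \in `[0, T] by exact: subset_itv_oo_cc.
have dp := p3 t tT; have dq := q3 t tT.
rewrite -(zE _ tT') -(yE _ tT') /yy /zz; split.
  by rewrite -[X in is_derive _ _ _ X]add0r; apply: is_deriveD.
by rewrite -[X in is_derive _ _ _ X]sub0r; apply: is_deriveB.
Unshelve. all: by end_near. Qed.

End existence.

Section fundamental.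
Context {R : realType}.
Implicit Types (a b t L T : R) (k y z c : R -> R).

(** C depends on [k1] and [k2] only through their common bound L, so the same estimate serves
    changes of the frequency and of the speed. *)
Lemma solves_lipschitz (T L y0 z0 : R) : 0 <= L ->
  exists2 C : R, 0 <= C & forall k1 k2 (e : R) y1 z1 y2 z2, 0 <= e ->
    (forall t, t \in `]0, T[ -> `|k1 t| <= L) ->
    (forall t, t \in `]0, T[ -> `|k2 t| <= L) ->
    (forall t, t \in `]0, T[ -> `|k1 t - k2 t| <= e) ->
    solves 0 T k1 y1 z1 -> solves 0 T k2 y2 z2 ->
    y1 0 = y0 -> z1 0 = z0 -> y2 0 = y0 -> z2 0 = z0 ->
    forall t, t \in `[0, T] -> `|y1 t - y2 t| <= C * e /\ `|z1 t - z2 t| <= C * e.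
Proof.
move=> L0; pose E0 := y0 ^+ 2 + z0 ^+ 2.
have E0_ge0 : 0 <= E0 by rewrite addr_ge0 ?sqr_ge0.
pose Y := E0 * expR ((1 + L) * T); pose M := Y * expR ((2 + L) * T).
have Y0 : 0 <= Y by rewrite mulr_ge0 ?expR_ge0.
have M0 : 0 <= M by rewrite mulr_ge0 ?expR_ge0.
(* 1 + M bounds the square root of M. *)
exists (1 + M); first by rewrite addr_ge0.
move=> k1 k2 e y1 z1 y2 z2 e0 k1L k2L ke s1 s2 y10 z10 y20 z20 t.
rewrite in_itv/= => /andP[t0 tT].
have sub u : u \in `]0, t[ -> u \in `]0, T[.
  by rewrite !in_itv/= => /andP[-> /lt_le_trans]; apply.
have : (y1 t - y2 t) ^+ 2 + (z1 t - z2 t) ^+ 2 <= (e * (1 + M)) ^+ 2.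
  apply: (le_trans (@solves_dependence _ 0 t k1 k2 y1 z1 y2 z2 L Y e t0 L0
    _ _ _ e0 Y0 _ _ _ _)).
  - by move=> u /sub; exact: k1L.
  - by move=> u /sub; exact: ke.
  - move=> u /sub; rewrite in_itv/= => /andP[u0 uT].
    have s2u := solvesS (lexx 0) (ltW uT) s2.
    have := @solves_energy_le _ 0 u k2 y2 z2 L (ltW u0) L0 _ s2u.
    rewrite y20 z20 subr0 => h.
    apply: (@le_trans _ _ (y2 u ^+ 2 + z2 u ^+ 2)); first by rewrite lerDl sqr_ge0.
    apply: (le_trans (h _)).
      move=> v; rewrite in_itv/= => /andP[v0 vu]; apply: k2L.
      by rewrite in_itv/= v0 (lt_trans vu).
    by rewrite ler_wpM2l// ler_expR ler_wpM2l ?addr_ge0// ltW.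
  - exact: solvesS tT s1.
  - exact: solvesS tT s2.
  - by rewrite y10.
  - by rewrite z10.
  rewrite exprMn -mulrA ler_wpM2l ?sqr_ge0//.
  have : Y * expR ((2 + L) * (t - 0)) <= M.
    by rewrite /M ler_wpM2l// ler_expR ler_wpM2l ?addr_ge0// subr0.
  by move/le_trans; apply; have := sqr_ge0 M; lra.
have CE : 0 <= (1 + M) * e by rewrite mulr_ge0// addr_ge0.
rewrite [e * _]mulrC => h; split; rewrite -[X in _ <= X]ger0_norm// -ler_sqr ?nnegrE//.
  by rewrite !real_normK ?num_real// (le_trans _ h)// lerDl sqr_ge0.
by rewrite !real_normK ?num_real// (le_trans _ h)// lerDr sqr_ge0.
Qed.

Lemma oscillator_exists T c (m y0 z0 l : R) :
  {within `[0, T], continuous c} -> (forall t, t \in `[0, T] -> `|c t| <= m) ->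
  exists y z,
    [/\ solves 0 T (fun t => l ^+ 2 * c t) y z, y 0 = y0 & z 0 = z0].
Proof.
move=> cc cm; have L1 : 1 <= 1 + l ^+ 2 * `|m| by rewrite lerDl mulr_ge0 ?sqr_ge0.
apply: (@solves_exists R T _ (fun t => l ^+ 2 * c t) y0 z0 L1).
  by move=> x; apply: cvgM; [exact: cvg_cst|exact: cc].
move=> t tT; rewrite normrM ger0_norm ?sqr_ge0//.
rewrite (le_trans (_ : _ <= l ^+ 2 * `|m|)) ?lerDr// ler_wpM2l ?sqr_ge0//.
by rewrite (le_trans (cm _ tT))// ler_norm.
Qed.

(** Continuity in the frequency makes the transform of a solution measurable in xi. The dependence
    is locally Lipschitz, because the coefficients at l and l' differ by at most (2 |l| + 1) |l -
    l'| m when |l - l'| <= 1. *)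
Lemma oscillator_continuous T c (m y0 z0 : R) (Y Z : R -> R -> R) : 0 <= T ->
  (forall t, t \in `[0, T] -> `|c t| <= m) ->
  (forall l, [/\ solves 0 T (fun t => l ^+ 2 * c t) (Y l) (Z l), Y l 0 = y0
     & Z l 0 = z0]) ->
  forall t, t \in `[0, T] -> continuous (Y ^~ t) /\ continuous (Z ^~ t).
Proof.
move=> T0 cm sol t tT.
have m0 : 0 <= m.
  by apply: le_trans (cm 0 _) => //; rewrite in_itv/= lexx.
suff H l : exists2 C, 0 <= C & forall l', `|l - l'| <= 1 ->
    `|Y l t - Y l' t| <= C * `|l - l'| /\ `|Z l t - Z l' t| <= C * `|l - l'|.
  have cvg_lip (f : R -> R) (l C : R) : 0 <= C ->
      (forall l', `|l - l'| <= 1 -> `|f l - f l'| <= C * `|l - l'|) ->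
      {for l, continuous f}.
    move=> C0 fC; have idc : x @[x --> l] --> l by exact: cvg_id.
    move/cvgrPdist_le : idc => idc; apply/cvgrPdist_le => e e0.
    have C1 : 0 < C + 1 by rewrite ltr_wpDl.
    have eC : 0 < e / (C + 1) by rewrite divr_gt0.
    apply: filterS2 (idc 1 ltr01) (idc _ eC) => u h1 h2.
    rewrite (le_trans (fC _ h1))// (le_trans (_ : _ <= (C + 1) * (e / (C + 1))))//.
      by rewrite ler_pM ?lerDl.
    by rewrite mulrC divfK// gt_eqF.
  by split=> l; have [C C0 HC] := H l; apply: (cvg_lip _ l C) => // l' /HC[].
pose L := (`|l| + 1) ^+ 2 * m.
have L0 : 0 <= L by rewrite mulr_ge0 ?sqr_ge0.
have [C C0 HC] := @solves_lipschitz T L y0 z0 L0.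
exists (C * ((2 * `|l| + 1) * m)); first by rewrite !mulr_ge0// addr_ge0// mulr_ge0.
move=> l' ll'; have [s1 a1 b1] := sol l; have [s2 a2 b2] := sol l'.
have ll2 : `|l'| <= `|l| + 1.
  by rewrite -lerBlDl (le_trans (lerB_dist _ _))// distrC.
have itvoc u : u \in `]0, T[ -> u \in `[0, T] by exact: subset_itv_oo_cc.
rewrite -mulrA; apply: (HC _ _ _ _ _ _ _ _ _ _ _ s1 s2) => //.
- by rewrite !mulr_ge0// addr_ge0// mulr_ge0.
- move=> u /itvoc uT; rewrite normrM ler_pM//; last exact: cm.
  by rewrite normrX lerXn2r ?nnegrE// ?addr_ge0// lerDl.
- move=> u /itvoc uT; rewrite normrM ler_pM//; last exact: cm.
  by rewrite normrX lerXn2r ?nnegrE// ?addr_ge0.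
- move=> u /itvoc uT; rewrite -mulrBl normrM mulrAC ler_pM//; last exact: cm.
  rewrite subr_sqr normrM mulrC ler_pM// (le_trans (ler_normD _ _))//.
  by rewrite mulr_natl mulr2n -addrA lerD2l.
Qed.

End fundamental.

(** * Absolutely continuous functions through integration by parts *)

Section smooth_step.
Context {R : realType}.
Implicit Types (x h : R).

(** Serves to differentiate the square of [pos_part] by inequalities alone, its kink included. *)
Lemma is_derive_quadratic_remainder (f : R -> R) x (l C : R) :
  (forall h, `|f (x + h) - f x - h * l| <= C * h ^+ 2) -> is_derive x 1 f l.
Proof.
move=> fC.
have C0 : 0 <= C by have := fC 1; rewrite expr1n mulr1; apply: le_trans.
have cf : h^-1 *: (f (h *: 1 + x) - f x) @[h --> 0^'] --> l.
  apply/cvgrPdist_le => e e0.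
  have eC : 0 < e / (C + 1) by rewrite divr_gt0// ltr_wpDl.
  near=> h.
  have h0 : h != 0 by near: h; exact: nbhs_dnbhs_neq.
  have hC : `|h| <= e / (C + 1).
    near: h; apply: dnbhs0_le; exact: eC.
  have := fC h; rewrite /GRing.scale /= mulr1 (addrC h) => H.
  rewrite -(ler_pM2l (_ : 0 < `|h|)) ?normr_gt0// -normrM mulrBr mulrA divff// mul1r.
  rewrite distrC (le_trans H)// -[X in X ^+ 2]/h -real_normK ?num_real// expr2 mulrA.
  rewrite mulrC ler_wpM2l// (le_trans (_ : _ <= (C + 1) * (e / (C + 1))))//.
    by rewrite ler_pM// lerDl.
  by rewrite mulrC divfK// gt_eqF// ltr_wpDl.
apply: DeriveDef; last exact/cvg_lim.
by apply/cvg_ex; exists l.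
Unshelve. all: by end_near. Qed.

Definition pos_part x := Num.max x 0.

Lemma is_derive_pos_part_sqr x :
  is_derive x 1 (fun x => pos_part x ^+ 2) (2 * pos_part x).
Proof.
apply: (@is_derive_quadratic_remainder _ _ _ 1) => h; rewrite mul1r /pos_part.
have [x0|x0] := leP x 0; have [xh0|xh0] := leP (x + h) 0;
  rewrite ?expr0n /= ?subrr ?mulr0 ?subr0 ?sub0r; rewrite ler_norml; apply/andP; split; nra.
Qed.

Lemma continuous_pos_part : continuous pos_part.
Proof.
by move=> x; apply: (@continuous_max _ _ id (cst 0)); [exact: cvg_id|exact: cvg_cst].
Qed.

(** A quadratic spline rising from 0 to 1 on [0, 1]: 2 x ^ 2 up to 1/2, then 1 - 2 (1 - x) ^ 2. Its
    derivative is a tent of integral 1, and class C^1 is the regularity that [test_function]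
    asks. *)
Definition step x :=
  2 * pos_part x ^+ 2 - 4 * pos_part (x - 2^-1) ^+ 2 + 2 * pos_part (x - 1) ^+ 2.

Definition dstep x :=
  4 * pos_part x - 8 * pos_part (x - 2^-1) + 4 * pos_part (x - 1).

Lemma is_derive_step x : is_derive x 1 step (dstep x).
Proof.
have := is_derive_pos_part_sqr => H.
have H1 (a : R) : is_derive x 1 (fun x => pos_part (x - a) ^+ 2) (2 * pos_part (x - a)).
  have h1 : is_derive x 1 (fun x => x - a) 1 by apply: is_derive_eq; rewrite subr0.
  have := @is_derive1_comp _ (fun x => pos_part x ^+ 2) (fun x => x - a) x _ _
    (H _) h1.
  by rewrite mulr1.
rewrite /step; apply: is_derive_eq; rewrite /GRing.scale /= /dstep; ring.
Qed.

Lemma continuous_dstep : continuous dstep.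
Proof.
move=> x; apply: cvgD; first apply: cvgB.
- by apply: cvgM; [exact: cvg_cst|exact: continuous_pos_part].
- apply: cvgM; first exact: cvg_cst.
  apply: (@continuous_comp _ _ _ (fun x => x - 2^-1)); last exact: continuous_pos_part.
  by apply: cvgB; [exact: cvg_id|exact: cvg_cst].
- apply: cvgM; first exact: cvg_cst.
  apply: (@continuous_comp _ _ _ (fun x => x - 1)); last exact: continuous_pos_part.
  by apply: cvgB; [exact: cvg_id|exact: cvg_cst].
Qed.

Let posE x : (0 <= x -> pos_part x = x) * (x <= 0 -> pos_part x = 0).
Proof. by split => h; rewrite /pos_part; [exact: max_idPl|exact: max_idPr]. Qed.

Lemma step_le0 x : x <= 0 -> step x = 0.
Proof. by move=> x0; rewrite /step !(posE _).2 ?expr0n/=; lra. Qed.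

Lemma step_ge1 x : 1 <= x -> step x = 1.
Proof. by move=> x0; rewrite /step !(posE _).1; lra. Qed.

Lemma dstep_le0 x : x <= 0 -> dstep x = 0.
Proof. by move=> x0; rewrite /dstep !(posE _).2; lra. Qed.

Lemma dstep_ge1 x : 1 <= x -> dstep x = 0.
Proof. by move=> x0; rewrite /dstep !(posE _).1; lra. Qed.

Lemma dstep_ge0 x : 0 <= dstep x.
Proof.
rewrite /dstep /pos_part.
have [x0|x0] := leP x 0; have [x1|x1] := leP (x - 2^-1) 0;
  have [x2|x2] := leP (x - 1) 0; lra.
Qed.

Lemma step_ge0_le1 x : 0 <= step x <= 1.
Proof.
rewrite /step /pos_part.
have [x0|x0] := leP x 0; have [x1|x1] := leP (x - 2^-1) 0;
  have [x2|x2] := leP (x - 1) 0; rewrite ?expr0n/=; apply/andP; split; nra.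
Qed.

End smooth_step.

Section abs_cont.
Context {R : realType}.
Notation mu := (@lebesgue_measure R).
Implicit Types (a b p q s t h T : R) (c g f : R -> R).

Lemma integrableDr A f g : measurable A -> mu.-integrable A (EFin \o f) ->
  mu.-integrable A (EFin \o g) -> mu.-integrable A (EFin \o (fun t => f t + g t)).
Proof.
by move=> mA fi gi; have := integrableD mA fi gi; apply: eq_integrable.
Qed.

Lemma integrableBr A f g : measurable A -> mu.-integrable A (EFin \o f) ->
  mu.-integrable A (EFin \o g) -> mu.-integrable A (EFin \o (fun t => f t - g t)).
Proof.
by move=> mA fi gi; have := integrableB mA fi gi; apply: eq_integrable.
Qed.

Lemma within_bounded f a b : {within `[a, b], continuous f} ->
  exists2 M, 0 <= M & forall t, t \in `[a, b] -> `|f t| <= M.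
Proof.
move=> cf; have := continuous_compact cf (@segment_compact _ a b).
move=> /compact_bounded[M [_ MP]]; exists (`|M| + 1); first by rewrite addr_ge0.
move=> t tab; apply: (MP (`|M| + 1)); last by exists t.
by rewrite ltr_pwDr// ler_norm.
Qed.

Lemma within_integrable f a b : {within `[a, b], continuous f} ->
  mu.-integrable `[a, b] (EFin \o f).
Proof. by apply: continuous_compact_integrable; exact: segment_compact. Qed.

Lemma within_continuous_eps f a b v (e : R) : {within `[a, b], continuous f} ->
  v \in `[a, b] -> 0 < e -> exists2 d, 0 < d &
    forall t, t \in `[a, b] -> `|t - v| < d -> `|f t - f v| <= e.
Proof.
move=> /subspace_continuousP cf vab e0.
have /cvgrPdist_le/(_ e e0) := cf v vab; rewrite near_withinE.
move=> /nbhs_ballP[d /= d0 dP]; exists d => // t tab tv.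
by rewrite distrC; apply: dP => //; rewrite /ball /= distrC.
Qed.

Lemma Rintegral_itv_oo f a b : measurable_fun `]a, b[ f ->
  \int[mu]_(t in `[a, b]) f t = \int[mu]_(t in `]a, b[) f t.
Proof.
by move=> mf; rewrite /Rintegral integral_itv_bndoo//; exact/measurable_EFinP.
Qed.

Lemma integrable_mul_within f g a b : {within `[a, b], continuous f} ->
  mu.-integrable `[a, b] (EFin \o g) ->
  mu.-integrable `[a, b] (EFin \o (fun t => g t * f t)).
Proof.
move=> cf ig; apply: (integrableMl _ ig) => //.
  by have /measurable_EFinP := measurable_int mu (within_integrable cf).
have [M M0 Mf] := within_bounded cf.
exists M; split; first exact: num_real.
by move=> x /ltW Mx t tab; exact: le_trans (Mf _ tab) Mx.
Qed.

Lemma Rintegral_FTC2 F f a b : a <= b -> continuous f ->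
  (forall t, is_derive t 1 F (f t)) ->
  \int[mu]_(t in `[a, b]) f t = F b - F a.
Proof.
rewrite le_eqVlt => /predU1P[->|ab] cf dF.
  by rewrite subrr set_itv1 Rintegral_set1.
have cF t : {for t, continuous F}.
  by apply: differentiable_continuous; apply/derivable1_diffP; case: (dF t).
rewrite /Rintegral (@continuous_FTC2 _ f F)//.
- exact: continuous_subspaceT.
- split => //.
  + by apply: cvg_at_right_filter; exact: cF.
  + by apply: cvg_at_left_filter; exact: cF.
- by move=> t _; rewrite derive1E; exact: derive_val.
Qed.

Lemma Rintegral_widen (A B : set R) f : A `<=` B ->
  (forall t, B t -> ~ A t -> f t = 0) ->
  \int[mu]_(t in B) f t = \int[mu]_(t in A) f t.
Proof.
move=> AB f0; rewrite Rintegral_mkcond [RHS]Rintegral_mkcond.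
congr (Rintegral _ _ _); apply/funext => t; rewrite /patch.
have [/set_mem At|/negP At] := boolP (t \in A).
  by rewrite ifT//; apply/mem_set/AB.
case: ifPn => // /set_mem Bt; apply: f0 => // At'.
by apply: At; exact/mem_set.
Qed.

(** The derivative of the step of width h that starts at s. For h > 0 it is nonnegative, has
    integral 1 and vanishes outside [s, s + h], so integrating against it averages the values on
    that interval. *)
Let kern s h t := h^-1 * dstep ((t - s) / h).

Let is_derive_kern s h t :
  is_derive t 1 (fun t => step ((t - s) / h)) (kern s h t).
Proof.
have h1 : is_derive t 1 (fun t => (t - s) / h) h^-1.
  by apply: is_derive_eq; rewrite /GRing.scale /=; ring.
have := @is_derive1_comp _ step (fun t => (t - s) / h) t _ _ (is_derive_step _) h1.
by rewrite /kern mulrC.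
Qed.

Let continuous_kern s h : continuous (kern s h).
Proof.
move=> t; apply: cvgM; first exact: cvg_cst.
apply: (@continuous_comp _ _ _ (fun t => (t - s) / h)); last exact: continuous_dstep.
apply: cvgM; last exact: cvg_cst.
by apply: cvgB; [exact: cvg_id|exact: cvg_cst].
Qed.

Let kern_approx f p q s h (v e : R) : 0 < h -> p <= s -> s + h <= q ->
  {within `[p, q], continuous f} ->
  (forall t, t \in `[s, s + h] -> `|f t - v| <= e) ->
  `|\int[mu]_(t in `[p, q]) (f t * kern s h t) - v| <= e.
Proof.
move=> h0 ps shq cf fe.
have pq : p <= q by lra.
have ck : {within `[p, q], continuous (kern s h)} by exact: continuous_subspaceT.
have kern_ge0 t : 0 <= kern s h t by rewrite mulr_ge0 ?dstep_ge0// invr_ge0 ltW.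
have k1 : \int[mu]_(t in `[p, q]) kern s h t = 1.
  rewrite (Rintegral_FTC2 pq (@continuous_kern s h) (@is_derive_kern s h)).
  rewrite step_ge1; last by rewrite ler_pdivlMr// mul1r; lra.
  by rewrite step_le0 ?subr0// pmulr_lle0 ?invr_gt0// subr_le0.
have ik := within_integrable ck.
have ifk : mu.-integrable `[p, q] (EFin \o (fun t => f t * kern s h t)).
  by apply: within_integrable => x; apply: cvgM; [exact: cf|exact: ck].
have ivk (u : R) : mu.-integrable `[p, q] (EFin \o (fun t => u * kern s h t)).
  by apply: within_integrable => x; apply: cvgM; [exact: cvg_cst|exact: ck].
rewrite [X in `|X| <= _](_ : _ =
    \int[mu]_(t in `[p, q]) (f t * kern s h t - v * kern s h t)); last first.
  by rewrite RintegralB// RintegralZl// k1 mulr1.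
have id_ : mu.-integrable `[p, q] (EFin \o (fun t => f t * kern s h t - v * kern s h t)).
  by apply: within_integrable => x; apply: cvgB; apply: cvgM;
    [exact: cf|exact: ck|exact: cvg_cst|exact: ck].
rewrite (le_trans (le_normr_Rintegral _ _))//.
rewrite [X in _ <= X](_ : _ = \int[mu]_(t in `[p, q]) (e * kern s h t)); last first.
  by rewrite RintegralZl// k1 mulr1.
apply: le_Rintegral => //.
  by apply: within_integrable => x; apply: cvg_norm; apply: cvgB; apply: cvgM;
    [exact: cf|exact: ck|exact: cvg_cst|exact: ck].
move=> t tpq; rewrite -mulrBl normrM (ger0_norm (kern_ge0 t)).
have [ts|ts] := leP t s.
  by rewrite /kern dstep_le0 ?mulr0// pmulr_lle0 ?invr_gt0// subr_le0.
have [ths|ths] := leP (s + h) t.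
  by rewrite /kern dstep_ge1 ?mulr0// ler_pdivlMr// mul1r; lra.
by rewrite ler_wpM2r// fe// in_itv/= !ltW.
Qed.

(* [c] is absolutely continuous on [a, b] with derivative [g].  In this form,
   gluing two intervals only requires adding two boundary terms. *)
Definition abs_cont c g a b :=
  [/\ {within `[a, b], continuous c}, mu.-integrable `[a, b] (EFin \o g)
    & forall psi dpsi, (forall t, is_derive t 1 psi (dpsi t)) ->
      continuous dpsi ->
      \int[mu]_(t in `[a, b]) (c t * dpsi t + g t * psi t) =
      c b * psi b - c a * psi a].

Lemma derive_continuous f df : (forall t, is_derive t 1 f (df t)) -> continuous f.
Proof.
move=> dF t; apply: differentiable_continuous; apply/derivable1_diffP.
by case: (dF t).
Qed.

Lemma Loo_loc_integrable T g a b : 0 < a -> b < T -> Loo_loc T g ->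
  mu.-integrable `[a, b] (EFin \o g).
Proof.
move=> a0 bT [mg gK]; have [K {}gK] := gK a b a0 bT.
have sub : `[a, b] `<=` `]0, T[.
  move=> t /=; rewrite !in_itv/= => /andP[at_ tb].
  by rewrite (lt_le_trans a0)// (le_lt_trans tb).
have mgab : measurable_fun `[a, b] g by exact: measurable_funS mg.
apply/integrableP; split; first exact/measurable_EFinP.
apply: le_lt_trans.
  apply: (integral_le_bound `|K|%:E) => //; first exact/measurable_EFinP.
  apply: filterS gK; first exact: (ae_filter_ringOfSetsType mu).
  by move=> t tK tab /=; rewrite lee_fin (le_trans (tK tab))// ler_norm.
by rewrite lte_mul_pinfty//= lebesgue_measure_itv/=; case: ifP => // _; rewrite -EFinB ltry.
Qed.

(* The weak derivative is tested against psi times the difference of two smooth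
   steps of width h at the end points, and h tends to 0. *)
Lemma W1oo_loc_abs_cont T c g a b : 0 < a -> a <= b -> b < T ->
  {within `[0, T], continuous c} -> W1oo_loc T c g -> abs_cont c g a b.
Proof.
move=> a0; rewrite le_eqVlt => /predU1P[<-|ab] bT cc [_ gloc wd].
  have sub1 : `[a, a] `<=` `[0, T].
    by apply: subset_itv; rewrite bnd_simp ltW.
  split; first exact: continuous_subspaceW cc.
    exact: Loo_loc_integrable gloc.
  by move=> psi dpsi _ _; rewrite set_itv1 Rintegral_set1 subrr.
have subT : `[a, b] `<=` `[0, T] by apply: subset_itv; rewrite bnd_simp ltW.
have subo : `[a, b] `<=` `]0, T[.
  move=> t /=; rewrite !in_itv/= => /andP[at_ tb].
  by rewrite (lt_le_trans a0)// (le_lt_trans tb).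
have cab : {within `[a, b], continuous c} := continuous_subspaceW subT cc.
have ig := Loo_loc_integrable a0 bT gloc.
split=> // psi dpsi dP cd.
have cP := derive_continuous dP.
(* As [harmonic n] is 1 / (n + 1), the width never exceeds b - a and both steps stay inside
   [a, b]. *)
pose h n := (b - a) * harmonic n.
have h_gt0 n : 0 < h n by rewrite mulr_gt0 ?subr_gt0// harmonic_gt0.
have h_le n : h n <= b - a.
  by rewrite /h ger_pMr ?subr_gt0// invf_le1// ler1n.
have h0 : h n @[n --> \oo] --> 0.
  rewrite -(mulr0 (b - a)); apply: cvgM; first exact: cvg_cst.
  exact: cvg_harmonic.
pose chi n t := step ((t - a) / h n) - step ((t - (b - h n)) / h n).
pose dchi n t := kern a (h n) t - kern (b - h n) (h n) t.
have dchiE n t : is_derive t 1 (chi n) (dchi n t).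
  have ? := @is_derive_kern a (h n) t; have ? := @is_derive_kern (b - h n) (h n) t.
  exact: is_deriveB.
have cdchi n : continuous (dchi n).
  by move=> t; apply: cvgB; exact: continuous_kern.
have cchi n : continuous (chi n) := derive_continuous (dchiE n).
have chi01 n t : `|chi n t| <= 1.
  have /andP[? ?] := step_ge0_le1 ((t - a) / h n).
  have /andP[? ?] := step_ge0_le1 ((t - (b - h n)) / h n).
  by rewrite ler_norml /chi; apply/andP; split; lra.
have chi_out n t : t \notin `[a, b] -> chi n t = 0.
  rewrite in_itv/= negb_and -!ltNge => /orP[ta|bt]; rewrite /chi.
    rewrite !step_le0 ?subrr// pmulr_lle0 ?invr_gt0//; last lra.
    by have := h_le n; lra.
  by rewrite !step_ge1 ?subrr// ler_pdivlMr// mul1r; have := h_le n; lra.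
have dchi_out n t : t \notin `[a, b] -> dchi n t = 0.
  rewrite in_itv/= negb_and -!ltNge => /orP[ta|bt]; rewrite /dchi /kern.
    rewrite !dstep_le0 ?mulr0 ?subrr// pmulr_lle0 ?invr_gt0//; last lra.
    by have := h_le n; lra.
  by rewrite !dstep_ge1 ?mulr0 ?subrr// ler_pdivlMr// mul1r; have := h_le n; lra.
pose F t := c t * dpsi t + g t * psi t.
have icd : mu.-integrable `[a, b] (EFin \o (fun t => c t * dpsi t)).
  apply: within_integrable => x; apply: cvgM; first exact: cab.
  exact: (continuous_subspaceT cd).
have iF : mu.-integrable `[a, b] (EFin \o F).
  have igp : mu.-integrable `[a, b] (EFin \o (fun t => g t * psi t)).
    by apply: integrable_mul_within => //; exact: continuous_subspaceT.
  exact: integrableDr.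
have cf : {within `[a, b], continuous (fun t => c t * psi t)}.
  by move=> x; apply: cvgM; [exact: cab|exact: (continuous_subspaceT cP)].
(* The weak derivative tested with psi * chi n: the derivative of chi n produces the two averages
   that become the boundary terms. *)
have key n : \int[mu]_(t in `[a, b]) (F t * chi n t) =
    \int[mu]_(t in `[a, b]) (c t * psi t * kern (b - h n) (h n) t) -
    \int[mu]_(t in `[a, b]) (c t * psi t * kern a (h n) t).
  have dphi t : is_derive t 1 (fun t => psi t * chi n t)
      (dpsi t * chi n t + psi t * dchi n t).
    by apply: is_derive_eq; rewrite /GRing.scale /=; ring.
  have tf : test_function T (fun t => psi t * chi n t).
    split.
    - by move=> t; case: (dphi t).
    - have -> : derive1 (fun t => psi t * chi n t) =
          (fun t => dpsi t * chi n t + psi t * dchi n t).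
        by apply/funext => t; rewrite derive1E; exact: derive_val.
      move=> t; apply: cvgD; apply: cvgM.
      + exact: cd.
      + exact: cchi.
      + exact: cP.
      + exact: cdchi.
    - exists a, b; split => // t tab; by rewrite chi_out ?mulr0.
  have := wd _ tf.
  rewrite (@Rintegral_widen `[a, b]%classic)//; last first.
    move=> t _ /negP tab; rewrite derive1E derive_val chi_out// dchi_out//.
    by rewrite !mulr0 addr0 mulr0.
  rewrite [in RHS](@Rintegral_widen `[a, b]%classic)//; last first.
    by move=> t _ /negP tab; rewrite chi_out// !mulr0.
  move=> key.
  have i1 : mu.-integrable `[a, b] (EFin \o (fun t => g t * (psi t * chi n t))).
    apply: integrable_mul_within => //; apply: continuous_subspaceT => t.
    by apply: cvgM; [exact: cP|exact: cchi].
  have i2 : mu.-integrable `[a, b] (EFin \o (fun t => c t * (dpsi t * chi n t))).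
    apply: within_integrable => x; apply: cvgM; first exact: cab.
    apply: (@continuous_subspaceT _ _ _ (fun t => dpsi t * chi n t)) => t.
    by apply: cvgM; [exact: cd|exact: cchi].
  have ik s : mu.-integrable `[a, b] (EFin \o (fun t => c t * psi t * kern s (h n) t)).
    apply: within_integrable => x; apply: cvgM; first exact: cf.
    exact: (continuous_subspaceT (@continuous_kern s (h n))).
  have i3 : mu.-integrable `[a, b] (EFin \o
     (fun t => c t * psi t * kern (b - h n) (h n) t - c t * psi t * kern a (h n) t)).
    exact: integrableBr.
  have E1 : \int[mu]_(t in `[a, b]) (F t * chi n t) =
    \int[mu]_(t in `[a, b]) (c t * (dpsi t * chi n t)) +
    \int[mu]_(t in `[a, b]) (g t * (psi t * chi n t)).
    rewrite -RintegralD//; apply: eq_Rintegral => t _; rewrite /F; ring.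
  have E2 : \int[mu]_(x in `[a, b]) (c x * ((fun t => psi t * chi n t)^`())%classic x) =
    \int[mu]_(t in `[a, b]) (c t * (dpsi t * chi n t)) +
    (\int[mu]_(t in `[a, b]) (c t * psi t * kern a (h n) t)
     - \int[mu]_(t in `[a, b]) (c t * psi t * kern (b - h n) (h n) t)).
    rewrite -RintegralB// -RintegralD//; last exact: integrableBr.
    apply: eq_Rintegral => t _; rewrite derive1E derive_val /dchi; ring.
  rewrite E1; move: key; rewrite E2 => /(canRL (addrK _))->.
  by rewrite opprB addrC addrA subrr add0r.
have mF : measurable_fun `[a, b] F.
  by have /measurable_EFinP := measurable_int mu iF.
have suboc : `]a, b[ `<=` `[a, b] by exact: subset_itv_oo_cc.
have mFo : measurable_fun `]a, b[ F by exact: measurable_funS mF.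
have mchi n (A : set R) : measurable A -> measurable_fun A (chi n).
  by move=> mA; apply: measurable_funTS; exact: continuous_measurable_fun.
(* chi n vanishes at a and b for every n, so it tends to 1 only on the open interval, to which the
   integrals are moved for dominated convergence. *)
have lim1 : \int[mu]_(t in `[a, b]) (F t * chi n t) @[n --> \oo] -->
    \int[mu]_(t in `[a, b]) F t.
  have h1 n : measurable_fun `]a, b[ (fun t => (F t * chi n t)%:E).
    by apply/measurable_EFinP; apply: measurable_funM => //; exact: mchi.
  have h2 : measurable_fun `]a, b[ (fun t => (F t)%:E) by exact/measurable_EFinP.
  have h3 : {ae mu, forall t, `]a, b[%classic t ->
      (F t * chi n t)%:E @[n --> \oo] --> (F t)%:E}.
    apply: aeW => t /=; rewrite in_itv/= => /andP[at_ tb].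
    have d0 : 0 < Num.min (t - a) (b - t) by rewrite lt_min !subr_gt0 at_.
    apply: cvg_near_cst; near=> n.
    have : h n < Num.min (t - a) (b - t) by near: n; exact: (cvgr_lt _ h0).
    rewrite lt_min => /andP[hta htb]; rewrite /chi.
    rewrite step_ge1 ?ler_pdivlMr ?mul1r ?(ltW hta)//.
    by rewrite step_le0 ?subr0 ?mulr1// pmulr_lle0 ?invr_gt0// subr_le0 lerBrDr -lerBrDl ltW.
  have h4 : mu.-integrable `]a, b[ (fun t => `|F t|%:E).
    by apply: integrable_norm; apply: integrableS iF.
  have h5 : {ae mu, forall t n, `]a, b[%classic t ->
      (`|(F t * chi n t)%:E| <= `|F t|%:E)%E}.
    by apply: aeW => t n _ /=; rewrite lee_fin normrM ler_piMr.
  have [_ _ dc] := @dominated_convergence _ _ R mu `]a, b[%classic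
    (measurable_itv _) (fun n t => (F t * chi n t)%:E) (fun t => (F t)%:E)
    (fun t => `|F t|%:E) h1 h2 h3 h4 h5.
  rewrite Rintegral_itv_oo//.
  have -> : (fun n => \int[mu]_(t in `[a, b]) (F t * chi n t)) =
      (fun n => \int[mu]_(t in `]a, b[) (F t * chi n t)).
    apply/funext => n; apply: Rintegral_itv_oo.
    by apply: measurable_funM => //; exact: mchi.
  apply: fine_cvg.
  rewrite fineK; first exact: dc.
  have iFo : mu.-integrable `]a, b[ (EFin \o F) by apply: integrableS iF.
  exact: (integrable_fin_num _ iFo).
have lim2 (f : R -> R) (u : nat -> R) (v : R) :
    (forall n, a <= u n) -> (forall n, u n + h n <= b) ->
    {within `[a, b], continuous f} ->
    (forall e, 0 < e -> \forall n \near \oo, forall t, t \in `[u n, u n + h n] ->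
      `|f t - v| <= e) ->
    \int[mu]_(t in `[a, b]) (f t * kern (u n) (h n) t) @[n --> \oo] --> v.
  move=> au ub cf' fv; apply/cvgrPdist_le => e e0; have fve := fv e e0.
  by near=> n; rewrite distrC; apply: kern_approx => //; near: n; exact: fve.
have near_f v (u : nat -> R) e : v \in `[a, b] -> 0 < e ->
    (forall n, a <= u n) -> (forall n, u n + h n <= b) ->
    (forall n t, t \in `[u n, u n + h n] -> `|t - v| <= h n) ->
    \forall n \near \oo, forall t, t \in `[u n, u n + h n] ->
      `|c t * psi t - c v * psi v| <= e.
  move=> vab e0 au ub uv; have [d0 d0_gt0 d0P] := within_continuous_eps cf vab e0.
  near=> n => t tu; have hd : h n < d0 by near: n; exact: (cvgr_lt _ h0).
  apply: d0P; last by rewrite (le_lt_trans (uv n t tu)).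
  move: tu; rewrite !in_itv/= => /andP[ut tu].
  by rewrite (le_trans (au n))// (le_trans tu).
have lima : \int[mu]_(t in `[a, b]) (c t * psi t * kern a (h n) t) @[n --> \oo] -->
    c a * psi a.
  have ub n : a + h n <= b by rewrite -lerBrDl.
  apply: (lim2 _ (fun=> a)) => // e e0; apply: near_f => //.
    by rewrite in_itv/= lexx ltW.
  move=> n t; rewrite in_itv/= => /andP[at_ tb].
  by rewrite ger0_norm ?subr_ge0// lerBlDl.
have limb : \int[mu]_(t in `[a, b]) (c t * psi t * kern (b - h n) (h n) t)
    @[n --> \oo] --> c b * psi b.
  have ub n : b - h n + h n <= b by rewrite subrK.
  have au n : a <= b - h n by rewrite lerBrDr -lerBrDl.
  apply: (lim2 _ (fun n => b - h n)) => // e e0; apply: near_f => //.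
    by rewrite in_itv/= lexx ltW.
  move=> n t; rewrite subrK in_itv/= => /andP[at_ tb].
  by rewrite ler0_norm ?subr_le0// opprB lerBlDr -lerBlDl.
have limF : \int[mu]_(t in `[a, b]) (F t * chi n t) @[n --> \oo] -->
    c b * psi b - c a * psi a.
  have -> : (fun n => \int[mu]_(t in `[a, b]) (F t * chi n t)) = (fun n =>
      \int[mu]_(t in `[a, b]) (c t * psi t * kern (b - h n) (h n) t) -
      \int[mu]_(t in `[a, b]) (c t * psi t * kern a (h n) t)).
    by apply/funext.
  exact: cvgB.
exact: (cvg_unique _ lim1 limF).
Unshelve. all: by end_near. Qed.
End abs_cont.

Section abs_cont_theory.
Context {R : realType}.
Notation mu := (@lebesgue_measure R).
Implicit Types (a b p q s t h T : R) (c g f : R -> R).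

Lemma integrable_itv_cc f a b : mu.-integrable `]a, b[ (EFin \o f) ->
  mu.-integrable `[a, b] (EFin \o f).
Proof.
move=> /integrableP[/measurable_EFinP mf fi]; apply/integrableP; split.
  by apply/measurable_EFinP; exact: (measurable_fun_itv_cc mf).
rewrite integral_itv_bndoo//.
by apply: measurableT_comp => //; exact/measurable_EFinP.
Qed.

Lemma integrable_itv_cat f a b p : a <= b -> b <= p ->
  mu.-integrable `[a, b] (EFin \o f) -> mu.-integrable `[b, p] (EFin \o f) ->
  mu.-integrable `[a, p] (EFin \o f).
Proof.
move=> ab bp i1 i2'.
have i2 : mu.-integrable `]b, p] (EFin \o f).
  by apply: integrableS i2' => //; apply: subset_itv; rewrite bnd_simp.
have E : `[a, p]%classic = `[a, b] `|` `]b, p].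
  apply/seteqP; split => t /=; rewrite !in_itv/=.
    by move=> /andP[at_ tp]; have [tb|tb] := leP t b; [left|right]; apply/andP.
  by case=> /andP[? ?]; apply/andP; split => //;
    [exact: le_trans bp|apply: le_trans ab _; exact: ltW].
have /measurable_EFinP m1 := measurable_int mu i1.
have /measurable_EFinP m2 := measurable_int mu i2.
have mE : measurable_fun (`[a, b] `|` `]b, p]) f by apply/measurable_funU.
have disj : [disjoint `[a, b]%classic & `]b, p]%classic].
  apply/disj_setPS => t [] /=; rewrite !in_itv/= => /andP[_ tb] /andP[bt _].
  by have := lt_le_trans bt tb; rewrite ltxx.
rewrite E; apply/integrableP; split; first exact/measurable_EFinP.
rewrite ge0_integral_setU//.
  by rewrite lte_add_pinfty//; [case/integrableP: i1|case/integrableP: i2].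
by apply: measurableT_comp => //; exact/measurable_EFinP.
Qed.

(** Testing with psi = 1 gives c b - c a as the integral of g. *)
Lemma abs_cont_lip c g a b (K : R) : a <= b -> abs_cont c g a b -> 0 <= K ->
  {ae mu, forall t, t \in `]a, b[ -> `|g t| <= K} -> `|c b - c a| <= K * (b - a).
Proof.
move=> ab [_ ig h] K0 gK.
have := h (cst 1) (cst 0) (fun t => is_derive_cst _ _ _) (@cst_continuous _ _ _).
rewrite /= !mulr1 => <-.
under eq_Rintegral do rewrite mulr0 add0r mulr1.
have mg : measurable_fun `]a, b[ g.
  have /measurable_EFinP := measurable_int mu ig.
  by apply: measurable_funS => //; exact: subset_itv_oo_cc.
rewrite Rintegral_itv_oo// -lee_fin EFin_normr_Rintegral//; last first.
  by apply: integrableS ig => //; exact: subset_itv_oo_cc.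
have K0' : (0 <= K%:E)%E by rewrite lee_fin.
apply: le_trans (le_abse_integral _ _ _) _ => //; first exact/measurable_EFinP.
apply: le_trans.
  apply: (integral_le_bound K%:E) => //; first exact/measurable_EFinP.
by rewrite /= lebesgue_measure_itv/=; case: ifPn => [_|_]; rewrite ?mule0 ?lee_fin ?mulr_ge0 ?subr_ge0// -EFinB -EFinM.
Qed.

Lemma abs_cont_cat c g a b p : a <= b -> b <= p ->
  {within `[a, p], continuous c} ->
  abs_cont c g a b -> abs_cont c g b p -> abs_cont c g a p.
Proof.
move=> ab bp cc [_ i1 h1] [_ i2 h2].
have ig := integrable_itv_cat ab bp i1 i2; split => // psi dpsi dP cd.
rewrite -[RHS](subrKA (c b * psi b)) -(h1 _ _ dP cd) -(h2 _ _ dP cd).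
have cP := derive_continuous dP.
have iF : mu.-integrable `[a, p] (EFin \o (fun t => c t * dpsi t + g t * psi t)).
  apply: integrableDr => //; last first.
    by apply: integrable_mul_within => //; exact: continuous_subspaceT.
  apply: within_integrable => x; apply: cvgM; first exact: cc.
  exact: (continuous_subspaceT cd).
have := @Rintegral_itvB _ _ (BLeft a) (BRight p) b iF; rewrite !bnd_simp => /(_ ab bp).
rewrite Rintegral_itv_obnd_cbnd; last first.
  apply: integrableS iF => //; apply: subset_itv; rewrite bnd_simp//.
by move=> <-; rewrite subrK.
Qed.

(** The values of g at the two end points do not affect the integrals, so pieces whose derivatives
    jump at a junction can be glued; c must agree there because of the boundary terms. *)
Lemma abs_cont_eq c c' g g' a b : a <= b -> {in `[a, b], c =1 c'} -> {in `]a, b[, g =1 g'} ->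
  abs_cont c g a b -> abs_cont c' g' a b.
Proof.
move=> ab cc gg [cab ig h].
have igo : mu.-integrable `]a, b[ (EFin \o g).
  by apply: integrableS ig => //; exact: subset_itv_oo_cc.
have cab' : {within `[a, b], continuous c'}.
  by apply: subspace_eq_continuous cab => x /set_mem; exact: cc.
have ig' : mu.-integrable `[a, b] (EFin \o g').
  apply: integrable_itv_cc; apply: eq_integrable igo => // t /set_mem tab /=.
  by rewrite gg.
split => // psi dpsi dP cd.
have cP := derive_continuous dP.
have mF (k l : R -> R) : {within `[a, b], continuous k} ->
   mu.-integrable `[a, b] (EFin \o l) ->
   measurable_fun `]a, b[ (fun t => k t * dpsi t + l t * psi t).
  move=> ck il; have /measurable_EFinP ml := measurable_int mu il.
  have /measurable_EFinP mk := measurable_int mu (within_integrable ck).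
  apply: (@measurable_funS _ _ _ _ `[a, b]%classic) => //; first exact: subset_itv_oo_cc.
  apply: measurable_funD; apply: measurable_funM => //;
    by apply: measurable_funTS; exact: continuous_measurable_fun.
rewrite -!cc ?in_itv/= ?lexx ?ab// -(h _ _ dP cd).
rewrite !Rintegral_itv_oo; [|exact: mF..].
apply: eq_Rintegral => t /set_mem tab; rewrite gg// cc//.
exact: subset_itv_oo_cc.
Qed.

Lemma abs_cont_smooth c g a b : a <= b -> (forall t, is_derive t 1 c (g t)) ->
  continuous g -> abs_cont c g a b.
Proof.
move=> ab dc cg; have cc := derive_continuous dc; split.
- exact: continuous_subspaceT.
- by apply: within_integrable; exact: continuous_subspaceT.
move=> psi dpsi dP cd; have cP := derive_continuous dP.
apply: (@Rintegral_FTC2 _ (fun t => c t * psi t)) => //.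
- by move=> t; apply: cvgD; apply: cvgM; [exact: cc|exact: cd|exact: cg|exact: cP].
- by move=> t; apply: is_derive_eq; rewrite /GRing.scale /=; ring.
Qed.

Lemma abs_cont_affine c g a b (r s : R) : a <= b -> abs_cont c g a b ->
  abs_cont (fun t => r * c t + s) (fun t => r * g t) a b.
Proof.
move=> ab [cc ig h]; split.
- by move=> x; apply: cvgD; [apply: cvgM; [exact: cvg_cst|exact: cc]|exact: cvg_cst].
- by have := @integrableZl _ _ _ mu `[a, b] (measurable_itv _) r _ ig.
move=> psi dpsi dP cd; have cP := derive_continuous dP.
have iF : mu.-integrable `[a, b] (EFin \o (fun t => c t * dpsi t + g t * psi t)).
  apply: integrableDr => //; last first.
    by apply: integrable_mul_within => //; exact: continuous_subspaceT.
  apply: within_integrable => x; apply: cvgM; first exact: cc.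
  exact: (continuous_subspaceT cd).
have id_ : mu.-integrable `[a, b] (EFin \o dpsi).
  by apply: within_integrable; exact: continuous_subspaceT.
transitivity (\int[mu]_(t in `[a, b]) (r * (c t * dpsi t + g t * psi t) + s * dpsi t)).
  by apply: eq_Rintegral => t _; ring.
rewrite RintegralD//; last 2 first.
- by have := @integrableZl _ _ _ mu `[a, b] (measurable_itv _) r _ iF.
- by have := @integrableZl _ _ _ mu `[a, b] (measurable_itv _) s _ id_.
rewrite !RintegralZl// (h _ _ dP cd) (Rintegral_FTC2 ab cd dP); ring.
Qed.

(** The support of a test function lies in [a, b] with 0 < a and b < T, so both boundary terms on
    [0, b'] vanish as soon as b' > b. *)
Lemma abs_cont_weak_derivative T T' c g : 0 < T' -> T' < T ->
  (forall b, T' <= b -> b < T -> abs_cont c g 0 b) -> weak_derivative T c g.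
Proof.
move=> T'0 T'T ac phi [dphi cphi [a [b [a0 bT phi0]]]].
pose b' := Num.max T' ((b + T) / 2).
have T'b' : T' <= b' by rewrite le_max lexx.
have b'0 : 0 < b' by exact: lt_le_trans T'b'.
have b'T : b' < T by rewrite gt_max T'T/=; lra.
have bb' : b < b' by rewrite lt_max; apply/orP; right; lra.
have dphi' t : is_derive t 1 phi (derive1 phi t).
  by rewrite derive1E; exact/derivableP.
have phi_out t : t \notin `[a, b] -> derive1 phi t = 0.
  move=> tab; have h : is_derive t 1 phi 0.
    have hcst : is_derive t 1 (cst 0 : R -> R) 0 by exact: is_derive_cst.
    apply: near_eq_is_derive hcst.
    move: tab; rewrite in_itv/= negb_and -!ltNge => /orP[ta|bt].
    - near=> u; rewrite phi0// in_itv/= negb_and -!ltNge; apply/orP; left.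
      by near: u; exact: lt_nbhsl.
    - near=> u; rewrite phi0// in_itv/= negb_and -!ltNge; apply/orP; right.
      by near: u; exact: lt_nbhsr.
  by rewrite derive1E; exact: derive_val.
have [cc ig h] := ac b' T'b' b'T; have := h _ _ dphi' cphi.
have phib' : phi b' = 0 by rewrite phi0// in_itv/= negb_and -!ltNge bb' orbT.
have phi00 : phi 0 = 0 by rewrite phi0// in_itv/= negb_and -!ltNge a0.
rewrite phib' phi00 !mulr0 subrr.
have cP := derive_continuous dphi'.
have i1 : mu.-integrable `[0, b'] (EFin \o (fun t => c t * derive1 phi t)).
  apply: within_integrable => x; apply: cvgM; first exact: cc.
  exact: (continuous_subspaceT cphi).
have i2 : mu.-integrable `[0, b'] (EFin \o (fun t => g t * phi t)).
  by apply: integrable_mul_within => //; exact: continuous_subspaceT.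
rewrite RintegralD// => /eqP; rewrite addr_eq0 => /eqP.
have sub : `]0, b'[ `<=` `[0, b'] by exact: subset_itv_oo_cc.
have msub (f : R -> R) : mu.-integrable `[0, b'] (EFin \o f) -> measurable_fun `]0, b'[ f.
  by move=> i; have /measurable_EFinP := measurable_int mu i; exact: measurable_funS.
rewrite !Rintegral_itv_oo; [|exact: msub..] => E.
have subT : `]0, b'[ `<=` `]0, T[ by apply: subset_itv; rewrite bnd_simp// ltW.
have out t : `]0, T[%classic t -> ~ `]0, b'[%classic t -> t \notin `[a, b].
  move=> /=; rewrite !in_itv/= => /andP[t0 _] /negP; rewrite t0/= -leNgt => b't.
  by rewrite negb_and -!ltNge (lt_le_trans bb')// orbT.
rewrite (Rintegral_widen subT)// => [|t tT /(out t tT)/phi_out->]; last by rewrite mulr0.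
by rewrite (Rintegral_widen subT)// => t tT /(out t tT)/phi0->; rewrite mulr0.
Unshelve. all: by end_near. Qed.

End abs_cont_theory.

Section speed.
Context {R : realType}.
Notation mu := (@lebesgue_measure R).
Variables (T0 mu1 mu2 : R) (omega theta : R -> R).
Hypotheses (T0_gt0 : 0 < T0) (mu1_gt0 : 0 < mu1) (mu12 : mu1 < mu2)
  (om : is_modulus omega) (theta_gt0 : {in `]0, T0[, forall t, 0 < theta t})
  (theta_nd : {in `]0, T0[ &, forall s t, s <= t -> theta t <= theta s}).

(** On [s, t] the largest value of theta is theta s. [abs_cont] is available only up to times below
    T0, so t = T0 is reached by continuity of c. *)
Lemma PS_lip c s t : PS T0 mu1 mu2 omega theta c -> 0 < s -> s < T0 -> s <= t ->
  t <= T0 -> `|c t - c s| <= theta s * (t - s).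
Proof.
move=> [cc _ _ [g W gth]] s0 sT st tT.
have sT' : s \in `]0, T0[ by rewrite in_itv/= s0.
have th0 : 0 <= theta s by rewrite ltW// theta_gt0.
have H u : s <= u -> u < T0 -> `|c u - c s| <= theta s * (u - s).
  move=> su uT; apply: (abs_cont_lip su (W1oo_loc_abs_cont s0 su uT cc W)) => //.
  apply: filterS gth; first exact: (ae_filter_ringOfSetsType mu).
  move=> v gv; rewrite in_itv/= => /andP[sv vu].
  have vT : v \in `]0, T0[ by rewrite in_itv/= (lt_trans s0)// (lt_trans vu).
  by rewrite (le_trans (gv vT))// theta_nd// ltW.
move: tT; rewrite le_eqVlt => /predU1P[->|]; last exact: H.
apply/ler_addgt0Pr => e e0.
have T0T : T0 \in `[0, T0] by rewrite in_itv/= lexx ltW.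
have [d d0 dP] := within_continuous_eps cc T0T e0.
pose u := Num.max s (T0 - d / 2).
have uT : u < T0 by rewrite gt_max sT /= gtrBl divr_gt0.
have su : s <= u by rewrite le_max lexx.
have uT0 : u \in `[0, T0] by rewrite in_itv/= (ltW uT) (le_trans _ su)// ltW.
have hu : `|u - T0| < d.
  rewrite distrC ger0_norm ?subr_ge0 ?(ltW uT)// ltrBlDr -ltrBlDl lt_max.
  by apply/orP; right; lra.
have h1 := H u su uT; have h2 := dP u uT0 hu.
have h3 : theta s * (u - s) <= theta s * (T0 - s).
  by rewrite ler_wpM2l// lerD2r ltW.
rewrite (_ : c T0 - c s = (c u - c s) - (c u - c T0)); last by ring.
by rewrite (le_trans (ler_normB _ _))// lerD// (le_trans h1).
Qed.

(** Composing c with this projection extends it by constants, so that its mean over [t, t + 1/l]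
    makes sense up to t = T0. *)
Definition clamp (t : R) := Num.max 0 (Num.min t T0).

Lemma clamp_itv t : clamp t \in `[0, T0].
Proof.
by rewrite in_itv/= le_max lexx/= ge_max (ltW T0_gt0)/= ge_min lexx orbT.
Qed.

Lemma clampE t : t \in `[0, T0] -> clamp t = t.
Proof. by rewrite in_itv/= => /andP[t0 tT]; rewrite /clamp min_l// max_r. Qed.

Lemma clamp_le (s t : R) : s \in `[0, T0] -> s <= t -> s <= clamp t /\ clamp t <= t.
Proof.
rewrite in_itv/= => /andP[s0 sT] st; rewrite /clamp le_max le_min st sT orbT.
by rewrite ge_max (le_trans s0 st) ge_min lexx.
Qed.

Lemma continuous_clamp (c : R -> R) : {within `[0, T0], continuous c} ->
  continuous (c \o clamp).
Proof.
move=> cc t; apply/cvgrPdist_le => e e0.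
have [d d0 dP] := within_continuous_eps cc (clamp_itv t) e0.
have cl : clamp u @[u --> t] --> clamp t.
  apply: (@continuous_max _ _ (cst 0) (fun u => Num.min u T0)); first exact: cvg_cst.
  by apply: (@continuous_min _ _ id (cst T0)); [exact: cvg_id|exact: cvg_cst].
near=> u; rewrite distrC; apply: dP; first exact: clamp_itv.
by rewrite distrC; near: u; move/cvgrPdist_lt : cl; exact.
Unshelve. all: by end_near. Qed.

End speed.

(** * Growth of the energy *)

Section energy.
Context {R : realType}.
Notation mu := (@lebesgue_measure R).
Variables (T0 mu1 mu2 : R) (omega theta : R -> R).
Hypotheses (T0_gt0 : 0 < T0) (mu1_gt0 : 0 < mu1) (mu12 : mu1 < mu2)
  (om : is_modulus omega) (theta_gt0 : {in `]0, T0[, forall t, 0 < theta t})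
  (theta_nd : {in `]0, T0[ &, forall s t, s <= t -> theta t <= theta s}).

Definition rate (l t : R) := Num.min (l * omega l^-1) (theta t).

(** On a window of length 1 / l after t the speed varies by at most omega (1 / l), by its modulus,
    and by theta t / l, by its slope; the smaller of the two is rate l t / l. *)
Let clampD c l t u : PS T0 mu1 mu2 omega theta c -> 0 < l ->
  t \in `]0, T0[ -> t <= u -> u <= t + l^-1 ->
  `|c (clamp T0 u) - c t| <= rate l t / l.
Proof.
move=> cPS l0 tT tu ul.
have tT' : t \in `[0, T0] by exact: subset_itv_oo_cc.
have [h1 h2] := clamp_le tT' tu; have uT := clamp_itv T0_gt0 u.
set v := clamp T0 u in h1 h2 uT *.
have vt : v - t <= l^-1 by rewrite lerBlDl (le_trans h2).
rewrite ler_pdivlMr// /rate le_min; apply/andP; split.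
  rewrite mulrC ler_pM2l//.
  apply: (le_trans (PS_modulus cPS uT tT')).
  by rewrite ger0_norm ?subr_ge0// (modulus_nd om)// subr_ge0.
move: (tT); rewrite in_itv/= => /andP[t0 tT1].
have vT : v <= T0 by move: uT; rewrite in_itv/= => /andP[].
rewrite -ler_pdivlMr// (le_trans (PS_lip T0_gt0 theta_gt0 theta_nd cPS t0 tT1 h1 vT))//.
by rewrite ler_wpM2l// ltW// theta_gt0.
Qed.

(** The estimate runs both ways in time: the first inequality limits the growth, the second prevents
    energy present at s from being lost at t. N is the cost of passing between E and the averaged
    energy at the two ends. *)
Lemma energy_estimate c l G y z : PS T0 mu1 mu2 omega theta c -> 0 < l ->
  {within `[0, T0], continuous G} ->
  (forall t, t \in `]0, T0[ -> is_derive t 1 G (rate l t)) ->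
  solves 0 T0 (fun t => l ^+ 2 * c t) y z ->
  forall s t, 0 <= s -> s <= t -> t <= T0 ->
    let E u := z u ^+ 2 + l ^+ 2 * y u ^+ 2 in
    let N := (1 + mu2) * (1 + mu1^-1) in
    let C := 1 + 2 * mu1^-1 in
    E t <= N * E s * expR (C * (G t - G s)) /\
    E s <= N * E t * expR (C * (G t - G s)).
Proof.
move=> cPS l0 cG dG [cy cz yz] s t s0 st tT E N C.
have cc := PS_continuous cPS; have ccl := continuous_clamp T0_gt0 cc.
have li0 : 0 < l^-1 by rewrite invr_gt0.
have m20 : 0 < mu2 by exact: lt_trans mu12.
have mi0 : 0 < mu1^-1 by rewrite invr_gt0.
(* The interval exceeds [0, T0 + 1/l] on both sides, so that F has a two-sided derivative at its
   ends too. *)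
have [F [_ _ dF]] := @primitive_within R (c \o clamp T0) (-1) (T0 + l^-1 + 1)
  (continuous_subspaceT ccl).
have dF' u : 0 <= u -> u <= T0 + l^-1 -> is_derive u 1 F (c (clamp T0 u)).
  move=> u0 uT; apply: dF; rewrite in_itv/=; apply/andP; split; lra.
(* [ce] is the mean of [c], extended by constants, over [u, u + 1/l]. *)
pose ce u := l * (F (u + l^-1) - F u).
have dce u : u \in `[0, T0] ->
    is_derive u 1 ce (l * (c (clamp T0 (u + l^-1)) - c (clamp T0 u))).
  rewrite in_itv/= => /andP[u0 uT].
  have d1 : is_derive u 1 F (c (clamp T0 u)) by apply: dF' => //; lra.
  have d2 : is_derive (u + l^-1) 1 F (c (clamp T0 (u + l^-1))) by apply: dF'; lra.
  have sh : is_derive u 1 (fun u => u + l^-1) 1.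
    by apply: is_derive_eq; rewrite addr0.
  have d3 := @is_derive1_comp _ F (fun u => u + l^-1) u _ _ d2 sh.
  have d4 := is_deriveB d3 d1.
  have := is_deriveZ l d4; rewrite /GRing.scale /= mulr1.
  by apply.
have ceE u : u \in `[0, T0] -> exists2 x, x \in `[u, u + l^-1] & ce u = c (clamp T0 x).
  rewrite in_itv/= => /andP[u0 uT].
  have uu : u <= u + l^-1 by rewrite lerDl ltW.
  have dv v : v \in `[u, u + l^-1] -> is_derive v 1 F (c (clamp T0 v)).
    by rewrite in_itv/= => /andP[? ?]; apply: dF'; lra.
  have cF : {within `[u, u + l^-1], continuous F}.
    apply: derivable_within_continuous => v /dv dv'; exact: ex_derive.
  have dvo v : v \in `]u, u + l^-1[ -> is_derive v 1 F (c (clamp T0 v)).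
    by move=> /subset_itv_oo_cc; exact: dv.
  have [x xu FE] := @MVT_segment R F (fun v => c (clamp T0 v)) u (u + l^-1) uu dvo cF.
  exists x => //; rewrite /ce FE addrC addKr mulrCA divff ?mulr1// gt_eqF//.
have ce_bounds u : u \in `[0, T0] -> mu1 <= ce u <= mu2.
  by move=> /ceE[x _ ->]; apply: (PS_bounds cPS); exact: clamp_itv.
have cce : {within `[0, T0], continuous ce}.
  by apply: derivable_within_continuous => v /dce dv; exact: ex_derive.
pose Ee u := z u ^+ 2 + l ^+ 2 * (ce u * y u ^+ 2).
have sub : `[s, t] `<=` `[0, T0] by apply: subset_itv; rewrite bnd_simp.
have subo u : u \in `]s, t[ -> u \in `]0, T0[.
  rewrite !in_itv/= => /andP[su ut].
  by rewrite (le_lt_trans s0)// (lt_le_trans ut).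
(* The slope of [ce] is at most rate l u, and the gap between [ce] and c at most rate l u / l. The
   factor l lost in the gap term comes back from 2 l |y z| <= l ^ 2 y ^ 2 + z ^ 2, so each term is
   at most a constant times rate l u times the energy. *)
pose D u := l ^+ 2 * (l * (c (clamp T0 (u + l^-1)) - c (clamp T0 u))) * y u ^+ 2
  + 2 * l ^+ 2 * (ce u - c u) * (y u * z u).
have dE u : u \in `]s, t[ -> is_derive u 1 Ee (D u).
  move=> /subo uT; have [dy dz] := yz u uT.
  have dcu := dce u (subset_itv_oo_cc uT).
  by apply: is_derive_eq; rewrite /GRing.scale /D /=; ring.
have DE u : u \in `]s, t[ -> `|D u| <= C * rate l u * Ee u.
  move=> /subo uT; have uT' := subset_itv_oo_cc uT.
  have r1 : `|l * (c (clamp T0 (u + l^-1)) - c (clamp T0 u))| <= rate l u.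
    rewrite normrM gtr0_norm// mulrC -ler_pdivlMr// (clampE uT').
    by apply: clampD => //; rewrite lerDl ltW.
  have [x xu xE] := ceE u uT'.
  have r2 : `|ce u - c u| <= rate l u / l.
    by rewrite xE; move: xu; rewrite in_itv/= => /andP[? ?]; exact: clampD.
  have /andP[b1 b2] := ce_bounds u uT'.
  have r0 : 0 <= rate l u by apply: le_trans r1.
  have h1 : `|D u| <= l ^+ 2 * rate l u * y u ^+ 2 +
      2 * l ^+ 2 * (rate l u / l) * (`|y u| * `|z u|).
    rewrite (le_trans (ler_normD _ _))// lerD//.
      rewrite normrM [X in _ * X]ger0_norm ?sqr_ge0// ler_wpM2r ?sqr_ge0//.
      by rewrite normrM ger0_norm ?sqr_ge0// ler_wpM2l ?sqr_ge0.
    rewrite normrM [`|y u * z u|]normrM ler_wpM2r ?mulr_ge0//.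
    have l2 : 0 <= 2 * l ^+ 2 by rewrite mulr_ge0 ?sqr_ge0.
    by rewrite normrM (ger0_norm l2); apply: ler_wpM2l.
  apply: (le_trans h1).
  have -> : 2 * l ^+ 2 * (rate l u / l) = 2 * l * rate l u.
    by rewrite expr2; field; rewrite gt_eqF.
  have h2 : 2 * l * (`|y u| * `|z u|) <= l ^+ 2 * y u ^+ 2 + z u ^+ 2.
    have := sqr_ge0 (l * `|y u| - `|z u|).
    rewrite -[y u ^+ 2]real_normK ?num_real// -[z u ^+ 2]real_normK ?num_real//; lra.
  have h3 : l ^+ 2 * y u ^+ 2 <= mu1^-1 * (l ^+ 2 * (ce u * y u ^+ 2)).
    rewrite [leRHS]mulrCA ler_wpM2l ?sqr_ge0// mulrA ler_peMl ?sqr_ge0//.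
    by rewrite mulrC ler_pdivlMr// mul1r.
  have h4 : 0 <= mu1^-1 * z u ^+ 2.
    by rewrite mulr_ge0 ?sqr_ge0 ?ltW.
  have h5 : 0 <= l ^+ 2 * (ce u * y u ^+ 2).
    have ce0 : 0 <= ce u by exact: le_trans (ltW mu1_gt0) b1.
    by rewrite mulr_ge0 ?sqr_ge0// mulr_ge0 ?sqr_ge0.
  rewrite [leLHS](_ : _ = rate l u * (l ^+ 2 * y u ^+ 2 + 2 * l * (`|y u| * `|z u|)));
    last by ring.
  rewrite [leRHS](_ : _ = rate l u * (C * Ee u)); last by ring.
  by rewrite ler_wpM2l// /C /Ee; lra.
have cEe : {within `[s, t], continuous Ee}.
  apply: (continuous_subspaceW sub) => x; apply: cvgD.
    by apply: cvgM; exact: cz.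
  apply: cvgM; first exact: cvg_cst.
  by apply: cvgM; [exact: cce|apply: cvgM; exact: cy].
have cCG : {within `[s, t], continuous (fun u => C * G u)}.
  by apply: (continuous_subspaceW sub) => x; apply: cvgM; [exact: cvg_cst|exact: cG].
have dCG u : u \in `]s, t[ -> is_derive u 1 (fun u => C * G u) (C * rate l u).
  move=> /subo uT; have := dG u uT => ?.
  by apply: is_derive_eq; rewrite /GRing.scale /=; ring.
have up : Ee t <= Ee s * expR (C * G t - C * G s).
  apply: (@gronwall R Ee D _ (fun u => C * rate l u) s t) => // u ust.
  by rewrite (le_trans (ler_norm _))// DE.
have lo : Ee s * expR (- (C * G t - C * G s)) <= Ee t.
  apply: (@gronwall_ge R Ee D _ (fun u => C * rate l u) s t) => // u ust.
  by rewrite lerNl (le_trans (ler_norm _))// normrN DE.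
have {}lo : Ee s <= Ee t * expR (C * G t - C * G s).
  move: lo; rewrite expRN ler_pdivrMr ?expR_gt0//.
have EeE u : u \in `[0, T0] -> Ee u <= (1 + mu2) * E u /\ E u <= (1 + mu1^-1) * Ee u.
  move=> uT; have /andP[b1 b2] := ce_bounds u uT; rewrite /E /Ee.
  have q1 : 0 <= l ^+ 2 * y u ^+ 2 by rewrite mulr_ge0 ?sqr_ge0.
  have q2 : 0 <= z u ^+ 2 by exact: sqr_ge0.
  have q3 : l ^+ 2 * (ce u * y u ^+ 2) = ce u * (l ^+ 2 * y u ^+ 2) by ring.
  have q4 : 0 <= mu2 * z u ^+ 2 by rewrite mulr_ge0// ltW.
  have q5 : 0 <= mu1^-1 * z u ^+ 2 by rewrite mulr_ge0// ltW.
  have q6 : 0 <= ce u * (l ^+ 2 * y u ^+ 2) by rewrite mulr_ge0// (le_trans (ltW mu1_gt0)).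
  have q7 : ce u * (l ^+ 2 * y u ^+ 2) <= mu2 * (l ^+ 2 * y u ^+ 2) by rewrite ler_wpM2r.
  have q8 : l ^+ 2 * y u ^+ 2 <= mu1^-1 * (ce u * (l ^+ 2 * y u ^+ 2)).
    by rewrite [leRHS]mulrA ler_peMl// mulrC ler_pdivlMr// mul1r.
  by rewrite q3; split; lra.
have sT : s \in `[0, T0] by rewrite in_itv/= s0 (le_trans st).
have tT' : t \in `[0, T0] by rewrite in_itv/= tT (le_trans s0).
have [e1 e2] := EeE s sT; have [e3 e4] := EeE t tT'.
have key (a b a' b' X : R) : 0 <= X -> a <= (1 + mu1^-1) * a' -> a' <= b' * X ->
    b' <= (1 + mu2) * b -> a <= N * b * X.
  move=> X0 ha ha' hb; apply: (le_trans ha); rewrite /N.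
  rewrite [leRHS](_ : _ = (1 + mu1^-1) * ((1 + mu2) * b * X)); last by ring.
  rewrite ler_wpM2l ?addr_ge0 ?(ltW mi0)// (le_trans ha')//.
  by rewrite ler_wpM2r.
by rewrite mulrBr; split; apply: key; eauto using expR_ge0.
Qed.

End energy.

(** * The loss as the integral of the rate *)

Section loss_formula.
Context {R : realType}.
Notation mu := (@lebesgue_measure R).
Variables (T0 : R) (omega theta : R -> R).
Hypotheses (T0_gt0 : 0 < T0)
  (om : is_modulus omega) (theta_gt0 : {in `]0, T0[, forall t, 0 < theta t})
  (theta_cont : {in `]0, T0[, continuous theta})
  (theta_nd : {in `]0, T0[ &, forall s t, s <= t -> theta t <= theta s}).

Variable l : R.
Hypothesis l_gt0 : 0 < l.

Let K := l * omega l^-1.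
Let rho := rate omega theta l.

Let K_gt0 : 0 < K.
Proof. by rewrite mulr_gt0// (modulus_gt0 om)// invr_gt0. Qed.

Lemma rate_gt0 t : t \in `]0, T0[ -> 0 < rate omega theta l t.
Proof. by move=> tT; rewrite /rate lt_min K_gt0 theta_gt0. Qed.

Lemma rate_continuous t : t \in `]0, T0[ -> {for t, continuous (rate omega theta l)}.
Proof.
move=> tT; apply: (@continuous_min _ _ (cst K) theta); first exact: cvg_cst.
exact: theta_cont.
Qed.

Let mtheta : measurable_fun `]0, T0[ theta.
Proof.
apply: open_continuous_measurable_fun; first exact: interval_open.
by move=> t /set_mem; exact: theta_cont.
Qed.

Let mrho : measurable_fun `]0, T0[ rho.
Proof.
apply: open_continuous_measurable_fun; first exact: interval_open.
by move=> t /set_mem; exact: rate_continuous.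
Qed.

Let irho : mu.-integrable `[0, T0] (EFin \o rho).
Proof.
apply: integrable_itv_cc; apply: measurable_bounded_integrable => //.
  by rewrite /= lebesgue_measure_itv/=; case: ifP => // _; rewrite -EFinB ltry.
exists K; split; first exact: num_real.
move=> x Kx t tT; have r0 := rate_gt0 tT.
by rewrite /= gtr0_norm// (le_trans _ (ltW Kx))// /rho /rate ge_min lexx.
Qed.

Let subK s : 0 <= s -> s < T0 -> `]0, T0[%classic = `]0, s] `|` `]s, T0[.
Proof.
move=> s0 sT; apply/seteqP; split => t /=; rewrite !in_itv/=.
  by move=> /andP[t0 tT]; have [ts|ts] := leP t s; [left|right]; apply/andP.
case=> /andP[? ?]; apply/andP; split => //.
  exact: le_lt_trans sT.
exact: le_lt_trans s0 _.
Qed.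

Lemma disjoint_itv_oc_oo (s : R) : [disjoint `]0, s]%classic & `]s, T0[%classic].
Proof.
apply/disj_setPS => t [] /=; rewrite !in_itv/= => /andP[_ ts] /andP[st _].
by have := lt_le_trans st ts; rewrite ltxx.
Qed.

Let meas_ocE s : 0 <= s -> mu `]0, s] = s%:E.
Proof.
by move=> s0; rewrite lebesgue_measure_itv/= lte_fin; case: ltP => [_|s0'];
  rewrite ?oppr0 ?adde0 //; congr (_%:E); apply/eqP; rewrite eq_le s0 s0'.
Qed.

Let rho_ge0 t : t \in `]0, T0[ -> (0 <= (rho t)%:E)%E.
Proof. by move=> /rate_gt0/ltW; rewrite lee_fin. Qed.

Let sub_oc s : s < T0 -> `]0, s] `<=` `]0, T0[.
Proof. by move=> sT; apply: subset_itv; rewrite bnd_simp. Qed.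

Let sub_oo s : 0 <= s -> `]s, T0[ `<=` `]0, T0[.
Proof. by move=> sT; apply: subset_itv; rewrite bnd_simp. Qed.

Let rho_split s : 0 <= s -> s < T0 -> (\int[mu]_(t in `]0%R, T0[) (rho t)%:E =
  \int[mu]_(t in `]0%R, s]) (rho t)%:E + \int[mu]_(t in `]s, T0[) (rho t)%:E)%E.
Proof.
move=> s0 sT; rewrite (subK s0 sT) ge0_integral_setU// -?subK//.
- exact/measurable_EFinP.
- exact: disjoint_itv_oc_oo.
Qed.

Let le_cost s : s \in `[0, T0] ->
  (\int[mu]_(t in `]0%R, T0[) (rho t)%:E <= loss_cost T0 omega theta l s)%E.
Proof.
rewrite in_itv/= => /andP[s0]; rewrite le_eqVlt => /predU1P[->|sT].
  rewrite /loss_cost set_itvoo0 integral_set0 adde0 -/K.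
  apply: (@le_trans _ _ (\int[mu]_(t in `]0%R, T0[) K%:E)%E).
    apply: ge0_le_integral => //; first exact/measurable_EFinP.
    by move=> t _; rewrite lee_fin /rho /rate ge_min lexx.
  by rewrite integral_cst//= lebesgue_measure_itv/= lte_fin T0_gt0 oppr0 adde0 EFinM.
rewrite (rho_split s0 sT) /loss_cost leeD//.
  apply: (@le_trans _ _ (\int[mu]_(t in `]0%R, s]) K%:E)%E).
    apply: ge0_le_integral => //.
    - by move=> t /(sub_oc sT); exact: rho_ge0.
    - by apply/measurable_EFinP; apply: measurable_funS mrho => //; exact: sub_oc.
    - by move=> t _; rewrite lee_fin /rho /rate ge_min lexx.
  by rewrite integral_cst//= [X in (_ * X)%E](meas_ocE s0) EFinM.
apply: ge0_le_integral => //.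
- by move=> t /(sub_oo s0); exact: rho_ge0.
- by apply/measurable_EFinP; apply: measurable_funS mrho => //; exact: sub_oo.
- by apply/measurable_EFinP; apply: measurable_funS mtheta => //; exact: sub_oo.
- by move=> t _; rewrite lee_fin /rho /rate ge_min lexx orbT.
Qed.

(** The optimal s is the time at which theta crosses the level K: rho equals K before it and theta
    after it. *)
Let ge_cost : exists2 s, s \in `[0, T0] &
  (loss_cost T0 omega theta l s <= \int[mu]_(t in `]0%R, T0[) (rho t)%:E)%E.
Proof.
(* The point 0 keeps the set nonempty when theta stays below K. *)
pose S : set R := fun t => t = 0 \/ [/\ 0 < t, t < T0 & K <= theta t].
have S0 : S 0 by left.
have ubS : ubound S T0.
  by move=> t [->|[_ /ltW]]; first exact: ltW.
have hS : has_sup S by split; [exists 0|exists T0].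
pose s := sup S.
have s0 : 0 <= s by apply: ub_le_sup => //; case: hS.
have sT : s <= T0 by apply: ge_sup => //; exists 0.
have below t : t \in `]0, s[ -> rho t = K.
  rewrite in_itv/= => /andP[t0 ts].
  have st : 0 < s - t by rewrite subr_gt0.
  have [u Su] := sup_adherent st hS; rewrite -/s opprB addrCA subrr addr0 => tu.
  case: Su => [u0|[u0 uT Ku]]; first by move: tu; rewrite u0 ltNge (ltW t0).
  rewrite /rho /rate min_l// (le_trans Ku)//; apply: theta_nd; last exact: ltW.
    by rewrite in_itv/= t0 (lt_le_trans ts).
  by rewrite in_itv/= u0.
have above t : t \in `]s, T0[ -> rho t = theta t.
  rewrite in_itv/= => /andP[st tT]; rewrite /rho /rate min_r//.
  rewrite leNgt; apply/negP => /ltW Kt.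
  have : t <= s.
    apply: ub_le_sup; first by case: hS.
    by right; split => //; exact: le_lt_trans st.
  by rewrite leNgt st.
exists s; first by rewrite in_itv/= s0.
have Kint : ((K * s)%:E <= \int[mu]_(t in `]0%R, s[) (rho t)%:E)%E.
  rewrite (@eq_integral _ _ _ mu `]0, s[ (cst K%:E)); last first.
    by move=> t /set_mem /below ->.
  rewrite integral_cst//= lebesgue_measure_itv/= lte_fin.
  case: ltP => [_|s0']; rewrite ?oppr0 ?adde0 ?EFinM//.
  have s00 : s = 0 by apply/le_anti/andP; split.
  by rewrite mule0 s00 mule0.
move: sT; rewrite le_eqVlt => /predU1P[sT|sT].
  by rewrite /loss_cost sT set_itvoo0 integral_set0 adde0 -/K -sT.
rewrite (rho_split s0 sT) /loss_cost -/K leeD//.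
  apply: (le_trans Kint); apply: ge0_subset_integral => //.
  - by apply/measurable_EFinP; apply: measurable_funS mrho => //; exact: sub_oc.
  - by move=> t /(sub_oc sT); exact: rho_ge0.
  - by apply: subset_itv; rewrite bnd_simp.
rewrite le_eqVlt; apply/orP; left; apply/eqP.
by apply: eq_integral => t /set_mem /above ->.
Qed.

Lemma loss_rate_integral : exists G, [/\ {within `[0, T0], continuous G},
  forall t, t \in `]0, T0[ -> is_derive t 1 G (rate omega theta l t)
  & G T0 - G 0 = loss T0 omega theta l].
Proof.
exists (fun x => \int[mu]_(t in `[0, x]) rho t); split.
- by apply: parameterized_integral_continuous => //; exact: ltW.
- move=> t tT; move: (tT); rewrite in_itv/= => /andP[t0 tT1].
  have [] := @continuous_FTC1_closed R rho 0 t T0 tT1 irho t0 (rate_continuous tT).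
  by move=> dF E; rewrite -[rate _ _ _ _]E derive1E; exact/derivableP.
rewrite set_itv1 Rintegral_set1 subr0 Rintegral_itv_oo//; congr fine.
have [s sT sle] := ge_cost.
apply/eqP; rewrite eq_le; apply/andP; split.
  by apply: le_ereal_inf_tmp => _ [u uT <-]; exact: le_cost.
by apply: ereal_inf_le; exists (loss_cost T0 omega theta l s) => //; exists s.
Qed.

End loss_formula.

(** * Upper bounds for the loss *)

Section square_integrable.
Context d (M : measurableType d) (R : realType) (mu : {measure set M -> \bar R}).
Implicit Types (f g : M -> R).

Lemma Lfun2P f : f \in Lfun mu 2%:E <->
  measurable_fun [set: M] f /\ (\int[mu]_x ((f x) ^+ 2)%:E < +oo)%E.
Proof.
have E : (\int[mu]_x (`|(f x)%:E| `^ 2) = \int[mu]_x ((f x) ^+ 2)%:E)%E.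
  apply: eq_integral => x _; rewrite /=.
  by rewrite powR_mulrn// real_normK// num_real.
split.
  rewrite inE => /andP[]; rewrite !inE/= => mf; rewrite /finite_norm unlock /= E.
  move=> h; split=> //; move: h.
  have : (0 <= \int[mu]_x ((f x) ^+ 2)%:E)%E.
    by apply: integral_ge0 => x _; rewrite lee_fin sqr_ge0.
  case: (integral _ _ _) => [r _ _|_|//]; first exact: ltry.
  by rewrite /= invr_eq0 pnatr_eq0.
move=> [mf fi]; rewrite inE; apply/andP; split; rewrite inE/=; first exact: mf.
rewrite /finite_norm unlock /= E poweR_lty//.
Qed.

(** The multiplier of [power_domain] squared, as it enters squared L^2 norms. *)
Definition weight (b l : R) := ((1 + l ^+ 2) `^ b) ^+ 2.

Lemma weight_base_gt0 (l : R) : 0 < 1 + l ^+ 2.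
Proof. by rewrite ltr_wpDr ?sqr_ge0. Qed.

Lemma weight_gt0 b l : 0 < weight b l.
Proof. by rewrite exprn_gt0// powR_gt0// weight_base_gt0. Qed.

Lemma weightD b b' l : weight (b + b') l = weight b l * weight b' l.
Proof.
rewrite /weight powRD ?exprMn//.
by apply/implyP => _; rewrite gt_eqF ?weight_base_gt0.
Qed.

Lemma weight_half l : weight 2^-1 l = 1 + l ^+ 2.
Proof. by rewrite /weight powR12_sqrt ?sqr_sqrtr ?ltW ?weight_base_gt0. Qed.

Lemma weight_ge1 b l : 0 <= b -> 1 <= weight b l.
Proof.
move=> b0; rewrite exprn_ege1//.
by rewrite -[leLHS](powRr0 (1 + l ^+ 2)) ler_powR// lerDl sqr_ge0.
Qed.

Lemma weight_le b b' l : b <= b' -> weight b l <= weight b' l.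
Proof.
move=> bb; have -> : b' = b + (b' - b) by rewrite addrC subrK.
by rewrite weightD ler_peMr ?(ltW (weight_gt0 _ _))// weight_ge1// subr_ge0.
Qed.

Variable lam : M -> R.
Hypothesis mlam : measurable_fun [set: M] lam.

Lemma measurable_base b : measurable_fun [set: M] (fun xi => (1 + lam xi ^+ 2) `^ b).
Proof.
apply: (measurableT_comp (measurable_powR b)).
by apply: measurable_funD => //; exact: measurable_funX.
Qed.

Lemma measurable_weight b : measurable_fun [set: M] (fun xi => weight b (lam xi)).
Proof. by apply: measurable_funX; exact: measurable_base. Qed.

Lemma power_domainP b f : power_domain mu lam b f <->
  measurable_fun [set: M] f /\
  (\int[mu]_x (weight b (lam x) * f x ^+ 2)%:E < +oo)%E.
Proof.
have E : (\int[mu]_x (((1 + lam x ^+ 2) `^ b * f x) ^+ 2)%:E =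
  \int[mu]_x (weight b (lam x) * f x ^+ 2)%:E)%E.
  by apply: eq_integral => x _; rewrite exprMn.
split=> -[mf fi]; split=> //.
  by move/Lfun2P : fi => [_]; rewrite E.
apply/Lfun2P; split; last by rewrite E.
by apply: measurable_funM => //; exact: measurable_base.
Qed.

(** Since [weight] at b + 1/2 is 1 + l ^ 2 times [weight] at b, both components of the phase space
    enter one integral, whose density is an energy at the frequency lam x. *)
Definition phase_energy b w0 w1 : \bar R :=
  (\int[mu]_x (weight b (lam x) * ((1 + lam x ^+ 2) * w0 x ^+ 2 + w1 x ^+ 2))%:E)%E.

Lemma phase_spaceP b w0 w1 : phase_space mu lam b w0 w1 <->
  [/\ measurable_fun [set: M] w0, measurable_fun [set: M] w1
    & (phase_energy b w0 w1 < +oo)%E].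
Proof.
have Q0 c x : 0 <= weight c (lam x) by rewrite ltW// weight_gt0.
have E : measurable_fun [set: M] w0 -> measurable_fun [set: M] w1 ->
    (phase_energy b w0 w1 = \int[mu]_x (weight (b + 2^-1) (lam x) * w0 x ^+ 2)%:E +
    \int[mu]_x (weight b (lam x) * w1 x ^+ 2)%:E)%E.
  move=> m0 m1; rewrite -ge0_integralD//=.
  - apply: eq_integral => x _; rewrite -EFinD; congr (_%:E).
    by rewrite weightD weight_half mulrDr mulrA.
  - by move=> x _; rewrite lee_fin mulr_ge0 ?sqr_ge0.
  - apply/measurable_EFinP; apply: measurable_funM; first exact: measurable_weight.
    exact: measurable_funX.
  - by move=> x _; rewrite lee_fin mulr_ge0 ?sqr_ge0.
  - apply/measurable_EFinP; apply: measurable_funM; first exact: measurable_weight.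
    exact: measurable_funX.
split.
  move=> [/power_domainP[m0 i0] /power_domainP[m1 i1]]; split => //.
  by rewrite E// lte_add_pinfty.
move=> [m0 m1]; rewrite E// => h; split; apply/power_domainP; split => //.
  apply: le_lt_trans h; rewrite leeDl// integral_ge0// => x _.
  by rewrite lee_fin mulr_ge0 ?sqr_ge0.
apply: le_lt_trans h; rewrite leeDr// integral_ge0// => x _.
by rewrite lee_fin mulr_ge0 ?sqr_ge0.
Qed.

Lemma measurable_phase_density b (w0 w1 : M -> R) : measurable_fun [set: M] w0 ->
  measurable_fun [set: M] w1 -> measurable_fun [set: M]
  (fun x => (weight b (lam x) * ((1 + lam x ^+ 2) * w0 x ^+ 2 + w1 x ^+ 2))%:E).
Proof.
move=> m0 m1; apply/measurable_EFinP; apply: measurable_funM; first exact: measurable_weight.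
apply: measurable_funD; last exact: measurable_funX.
apply: measurable_funM; last exact: measurable_funX.
by apply: measurable_funD => //; exact: measurable_funX.
Qed.

(** By linearity the solution combines, with coefficients u0 and u1, the two solutions with data (1,
    0) and (0, 1); these are continuous in the frequency, hence measurable when composed with
    lam. *)
Lemma is_solution_exists (T0 : R) (c : R -> R) (m : R) (u0 u1 : M -> R) : 0 <= T0 ->
  {within `[0, T0], continuous c} -> (forall t, t \in `[0, T0] -> `|c t| <= m) ->
  measurable_fun [set: M] u0 -> measurable_fun [set: M] u1 ->
  exists y z, is_solution mu lam T0 c u0 u1 y z.
Proof.
move=> T0_ge0 cc cm mu0 mu1.
have /choice[Y1 /choice[Z1 S1]] := fun l => oscillator_exists 1 0 l cc cm.
have /choice[Y2 /choice[Z2 S2]] := fun l => oscillator_exists 0 1 l cc cm.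
have C1 := oscillator_continuous T0_ge0 cm S1.
have C2 := oscillator_continuous T0_ge0 cm S2.
have mc (Y : R -> R) : continuous Y -> measurable_fun [set: M] (Y \o lam).
  by move=> cY; apply: measurableT_comp => //; exact: continuous_measurable_fun.
exists (fun t xi => u0 xi * Y1 (lam xi) t + u1 xi * Y2 (lam xi) t).
exists (fun t xi => u0 xi * Z1 (lam xi) t + u1 xi * Z2 (lam xi) t).
split.
  move=> t tT; have [a1 a2] := C1 t tT; have [a3 a4] := C2 t tT.
  split; apply: measurable_funD; apply: measurable_funM => //.
  - exact: (mc _ a1).
  - exact: (mc _ a3).
  - exact: (mc _ a2).
  - exact: (mc _ a4).
apply: aeW => /= xi; have [[cy1 cz1 d1] y10 z10] := S1 (lam xi).
have [[cy2 cz2 d2] y20 z20] := S2 (lam xi); split.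
- by move=> x; exact: (cvgD (cvgM (cvg_cst (u0 xi)) (cy1 x)) (cvgM (cvg_cst (u1 xi)) (cy2 x))).
- by move=> x; exact: (cvgD (cvgM (cvg_cst (u0 xi)) (cz1 x)) (cvgM (cvg_cst (u1 xi)) (cz2 x))).
- by rewrite y10 y20; ring.
- by rewrite z10 z20; ring.
move=> t tT; have [dy1 dz1] := d1 t tT; have [dy2 dz2] := d2 t tT.
by split; apply: is_derive_eq; rewrite /GRing.scale /=; ring.
Qed.

End square_integrable.

Section well_posedness.
Context {R : realType}.
Variables (T0 mu1 mu2 : R) (omega theta : R -> R).
Hypotheses (T0_gt0 : 0 < T0) (mu1_gt0 : 0 < mu1) (mu12 : mu1 < mu2)
  (om : is_modulus omega) (theta_gt0 : {in `]0, T0[, forall t, 0 < theta t})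
  (theta_cont : {in `]0, T0[, continuous theta})
  (theta_nd : {in `]0, T0[ &, forall s t, s <= t -> theta t <= theta s}).

Definition growth_exponent := 1 + 2 * mu1^-1.

Lemma PS_norm_le c t : PS T0 mu1 mu2 omega theta c -> t \in `[0, T0] -> `|c t| <= mu2.
Proof.
move=> cPS tT; have /andP[h1 h2] := PS_bounds cPS tT.
by rewrite ger0_norm// (le_trans (ltW mu1_gt0)).
Qed.

Let mu2_gt0 : 0 < mu2. Proof. exact: lt_trans mu12. Qed.

Lemma primitive_rate_mono (l : R) (G : R -> R) (s t : R) : 0 < l -> {within `[0, T0], continuous G} ->
  (forall t, t \in `]0, T0[ -> is_derive t 1 G (rate omega theta l t)) ->
  0 <= s -> s <= t -> t <= T0 -> G s <= G t.
Proof.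
move=> l0 cG dG s0 st tT; rewrite -lerN2.
have sub u : u \in `]s, t[ -> u \in `]0, T0[.
  rewrite !in_itv/= => /andP[su ut].
  by rewrite (le_lt_trans s0)// (lt_le_trans ut).
have h1 : {within `[s, t], continuous (fun u => - G u)}.
  move=> x; apply: cvgN; apply: (continuous_subspaceW _ cG).
  by apply: subset_itv; rewrite bnd_simp.
have h2 u : u \in `]s, t[ -> is_derive u 1 (fun u => - G u) (- rate omega theta l u).
  by move=> /sub uT; have dGu := dG u uT; exact: (is_deriveN dGu).
have h3 u : u \in `]s, t[ -> - rate omega theta l u <= 0.
  by move=> /sub uT; rewrite oppr_le0; apply/ltW/(rate_gt0 om theta_gt0 l0).
exact: (derive_le0_le st h1 h2 h3).
Qed.

(** High frequencies use [energy_estimate]. Below L that energy is not enough, since l ^ 2 y ^ 2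
    says little about y near l = 0, and the crude bound of [solves_energy_le] is uniform there. *)
Lemma phase_growth c (gam K L0 : R) : PS T0 mu1 mu2 omega theta c -> 0 <= gam ->
  (forall l, L0 <= l ->
    expR (growth_exponent * loss T0 omega theta l) <= K * weight gam l) ->
  exists2 B, 0 <= B & forall l y z, 0 <= l ->
    solves 0 T0 (fun t => l ^+ 2 * c t) y z -> forall t, t \in `[0, T0] ->
    (1 + l ^+ 2) * y t ^+ 2 + z t ^+ 2 <=
    B * weight gam l * ((1 + l ^+ 2) * y 0 ^+ 2 + z 0 ^+ 2).
Proof.
move=> cPS gam0 mK.
(* For l >= 1 the energy z ^ 2 + l ^ 2 y ^ 2 is at least half of (1 + l ^ 2) y ^ 2 + z ^ 2. *)
pose L := Num.max 1 L0.
pose N := (1 + mu2) * (1 + mu1^-1).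
have N0 : 0 <= N by rewrite mulr_ge0 ?addr_ge0// ?ltW// invr_gt0.
pose B1 := 2 * N * `|K|.
pose B2 := (1 + L ^+ 2) * expR ((1 + L ^+ 2 * mu2) * T0).
have B10 : 0 <= B1 by rewrite mulr_ge0// mulr_ge0.
have L2 : 0 <= L ^+ 2 by exact: sqr_ge0.
have B20 : 0 <= B2 by rewrite mulr_ge0 ?expR_ge0// addr_ge0.
exists (B1 + B2); first by rewrite addr_ge0.
move=> l y z l0 sol t tT; have w1 := weight_ge1 l gam0.
have w0 : 0 <= weight gam l by exact: le_trans w1.
move: (tT); rewrite in_itv/= => /andP[t0 tT0].
pose E0 := (1 + l ^+ 2) * y 0 ^+ 2 + z 0 ^+ 2.
have l2 : 0 <= l ^+ 2 by exact: sqr_ge0.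
have y02 : 0 <= y 0 ^+ 2 by exact: sqr_ge0.
have z02 : 0 <= z 0 ^+ 2 by exact: sqr_ge0.
have yt2 : 0 <= y t ^+ 2 by exact: sqr_ge0.
have zt2 : 0 <= z t ^+ 2 by exact: sqr_ge0.
have ly0 : 0 <= l ^+ 2 * y 0 ^+ 2 by exact: mulr_ge0.
have E0_ge0 : 0 <= E0 by rewrite /E0; lra.
rewrite -/E0; have [Ll|lL] := leP L l.
  have l1 : 1 <= l by rewrite (le_trans _ Ll)// le_max lexx.
  have l_gt0 : 0 < l by exact: lt_le_trans l1.
  have [G [cG dG GE]] := loss_rate_integral T0_gt0 om theta_gt0 theta_cont theta_nd l_gt0.
  have [h _] := energy_estimate T0_gt0 mu1_gt0 mu12 om theta_gt0 theta_nd cPS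
    l_gt0 cG dG sol (lexx 0) t0 tT0.
  have eK : expR (growth_exponent * (G t - G 0)) <= `|K| * weight gam l.
    apply: (@le_trans _ _ (K * weight gam l)); last by rewrite ler_wpM2r// ler_norm.
    apply: le_trans (mK _ _); last by rewrite (le_trans _ Ll)// le_max lexx orbT.
    rewrite ler_expR ler_wpM2l//.
      by rewrite /growth_exponent addr_ge0// mulr_ge0// invr_ge0 ltW.
    by rewrite -GE lerD2r (primitive_rate_mono l_gt0 cG dG).
  have h1 : (1 + l ^+ 2) * y t ^+ 2 + z t ^+ 2 <= 2 * (z t ^+ 2 + l ^+ 2 * y t ^+ 2).
    have : y t ^+ 2 <= l ^+ 2 * y t ^+ 2 by rewrite ler_peMl// exprn_ege1.
    lra.
  have h2 : z 0 ^+ 2 + l ^+ 2 * y 0 ^+ 2 <= E0 by rewrite /E0; lra.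
  have h3 : N * (z 0 ^+ 2 + l ^+ 2 * y 0 ^+ 2) *
      expR (growth_exponent * (G t - G 0)) <= N * E0 * (`|K| * weight gam l).
    by rewrite ler_pM ?expR_ge0 ?ler_wpM2l// mulr_ge0// addr_ge0.
  apply: (le_trans h1); apply: (@le_trans _ _ (B1 * weight gam l * E0)).
    rewrite [leRHS](_ : _ = 2 * (N * E0 * (`|K| * weight gam l))); last by rewrite /B1; ring.
    by rewrite ler_wpM2l// (le_trans h).
  by rewrite ler_wpM2r// ler_wpM2r// lerDl.
have lL2 : l ^+ 2 <= L ^+ 2 by rewrite lerXn2r ?nnegrE ?(ltW lL)// (ltW (le_lt_trans l0 lL)).
have kL u : u \in `]0, t[ -> `|l ^+ 2 * c u| <= L ^+ 2 * mu2.
  rewrite in_itv/= => /andP[u0 ut]; rewrite normrM ger0_norm// ler_pM//.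
  by apply: (PS_norm_le cPS); rewrite in_itv/= (ltW u0) (le_trans _ tT0)// ltW.
have L2m : 0 <= L ^+ 2 * mu2 by rewrite mulr_ge0// ltW.
have h := solves_energy_le t0 L2m kL (solvesS (lexx 0) tT0 sol).
have e1 : expR ((1 + L ^+ 2 * mu2) * (t - 0)) <= expR ((1 + L ^+ 2 * mu2) * T0).
  by rewrite ler_expR ler_wpM2l ?subr0// addr_ge0.
have h2 : y 0 ^+ 2 + z 0 ^+ 2 <= E0 by rewrite /E0; lra.
have h3 : y t ^+ 2 + z t ^+ 2 <= E0 * expR ((1 + L ^+ 2 * mu2) * T0).
  by rewrite (le_trans h)// ler_pM ?expR_ge0// addr_ge0.
have h4 : (1 + l ^+ 2) * y t ^+ 2 + z t ^+ 2 <= (1 + L ^+ 2) * (y t ^+ 2 + z t ^+ 2).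
  have q1 : l ^+ 2 * y t ^+ 2 <= L ^+ 2 * y t ^+ 2 by rewrite ler_wpM2r.
  have q2 : 0 <= L ^+ 2 * z t ^+ 2 by rewrite mulr_ge0.
  lra.
apply: (le_trans h4); apply: (@le_trans _ _ (B2 * E0)).
  by rewrite /B2 -mulrA [expR _ * _]mulrC ler_wpM2l// addr_ge0.
rewrite ler_wpM2r// (@le_trans _ _ (B2 * weight gam l))//.
  by rewrite ler_peMr.
by rewrite ler_wpM2r// lerDr.
Qed.

Context d (M : measurableType d) (mu : {measure set M -> \bar R}) (lam : M -> R).
Hypotheses (mlam : measurable_fun [set: M] lam) (lam_ge0 : forall xi, 0 <= lam xi).

Lemma PS_solution_exists c u0 u1 : PS T0 mu1 mu2 omega theta c ->
  measurable_fun [set: M] u0 -> measurable_fun [set: M] u1 ->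
  exists y z, is_solution mu lam T0 c u0 u1 y z.
Proof.
move=> cPS m0 m1; apply: (@is_solution_exists _ _ _ mu _ mlam T0 c mu2) => //.
- exact: ltW.
- exact: PS_continuous cPS.
- by move=> t; exact: PS_norm_le.
Qed.

Lemma well_posed c (gam K L0 b : R) : PS T0 mu1 mu2 omega theta c -> 0 <= gam ->
  (forall l, L0 <= l ->
    expR (growth_exponent * loss T0 omega theta l) <= K * weight gam l) ->
  forall u0 u1, phase_space mu lam b u0 u1 ->
    the_solution mu lam T0 c u0 u1 (fun y z =>
      forall t, t \in `[0, T0] -> phase_space mu lam (b - gam) (y t) (z t)).
Proof.
move=> cPS gam0 mK u0 u1 /(phase_spaceP mu mlam)[m0 m1 fin].
split; first exact: PS_solution_exists cPS m0 m1.
move=> y z [myz sol] t tT; have [my mz] := myz t tT.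
apply/(phase_spaceP mu mlam); split => //.
have [B B0 HB] := phase_growth cPS gam0 mK.
apply: (@le_lt_trans _ _ (B%:E * phase_energy mu lam b u0 u1)%E); last first.
  by rewrite lte_mul_pinfty// lee_fin.
have pos w0 w1 bb x : (0 <=
   (weight bb (lam x) * ((1 + lam x ^+ 2) * w0 x ^+ 2 + w1 x ^+ 2))%:E)%E.
  rewrite lee_fin mulr_ge0 ?(ltW (weight_gt0 _ _))// addr_ge0 ?sqr_ge0//.
  by rewrite mulr_ge0 ?sqr_ge0// (ltW (weight_base_gt0 _)).
rewrite /phase_energy -ge0_integralZl//; last first.
  exact: measurable_phase_density.
apply: ae_ge0_le_integral => //.
- exact: measurable_phase_density.
- by move=> x _; rewrite mule_ge0.
- by apply: measurable_funeM; exact: measurable_phase_density.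
apply: filterS sol => xi [cy cz y0 z0 dyz] _.
have sxi : solves 0 T0 (fun t => lam xi ^+ 2 * c t) (y ^~ xi) (z ^~ xi) by [].
have := HB _ _ _ (lam_ge0 xi) sxi t tT; rewrite y0 z0 => h.
rewrite -EFinM lee_fin.
rewrite (_ : weight b (lam xi) = weight (b - gam) (lam xi) * weight gam (lam xi)); last first.
  by rewrite -weightD subrK.
rewrite [leRHS](_ : _ = weight (b - gam) (lam xi) * (B * weight gam (lam xi) *
  ((1 + lam xi ^+ 2) * u0 xi ^+ 2 + u1 xi ^+ 2))); last by ring.
by rewrite ler_wpM2l// ltW// weight_gt0.
Qed.

End well_posedness.

(** * Comparing the regimes of the loss with powers of the frequency *)

Section regimes.
Context {R : realType}.
Implicit Types (m : R -> R) (C b l : R).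

Lemma weightE b l : weight b l = expR (2 * b * ln (1 + l ^+ 2)).
Proof.
rewrite /weight /powR gt_eqF ?weight_base_gt0// expr2 -expRD; congr expR; ring.
Qed.

Lemma weight_ge b l : 0 <= b -> 1 <= l -> expR (4 * b * ln l) <= weight b l.
Proof.
move=> b0 l1; have l0 : 0 < l by exact: lt_le_trans l1.
rewrite weightE ler_expR (_ : 4 * b * ln l = 2 * b * ln (l ^+ 2)); last first.
  by rewrite lnXn// -mulr_natl; ring.
by rewrite ler_wpM2l ?mulr_ge0// ler_ln ?posrE ?weight_base_gt0 ?exprn_gt0// lerDr.
Qed.

(** For l >= 2 one has 1 + l ^ 2 <= l ^ 3, which keeps the comparison free of multiplicative
    constants. *)
Lemma weight_le_expR b l : 0 <= b -> 2 <= l -> weight b l <= expR (6 * b * ln l).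
Proof.
move=> b0 l2; have l0 : 0 < l by exact: lt_le_trans l2.
rewrite weightE ler_expR (_ : 6 * b * ln l = 2 * b * ln (l ^+ 3)); last first.
  by rewrite lnXn// -mulr_natl; ring.
rewrite ler_wpM2l ?mulr_ge0// ler_ln ?posrE ?weight_base_gt0 ?exprn_gt0//; nra.
Qed.

Lemma bounded_regime_expR m C : 0 <= C -> bounded_regime m ->
  exists K L0, forall l, L0 <= l -> expR (C * m l) <= K * weight 0 l.
Proof.
move=> C0 [M [_ /(_ (M + 1))]]; rewrite ltrDl => /(_ ltr01) [L [_ LP]].
exists (expR (C * (M + 1))), (L + 1) => l Ll.
rewrite /weight powRr0 expr1n mulr1 ler_expR ler_wpM2l//.
rewrite (le_trans (ler_norm _))//; apply: LP; by rewrite (lt_le_trans _ Ll)// ltrDl.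
Qed.

Lemma log_bound_expR m C b Q L : 0 <= b -> 0 <= C -> C * Q <= 4 * b ->
  (forall l, L < l -> m l / ln l <= Q) ->
  exists K L0, forall l, L0 <= l -> expR (C * m l) <= K * weight b l.
Proof.
move=> b0 C0 CQ mQ; exists 1, (Num.max 2 (L + 1)) => l; rewrite ge_max => /andP[l2 Ll].
have l1 : 1 < l by rewrite (lt_le_trans _ l2)// ltr1n.
have ln0 : 0 < ln l by rewrite ln_gt0.
have Ll' : L < l by rewrite (lt_le_trans _ Ll)// ltrDl.
have := mQ l Ll'; rewrite ler_pdivrMr// => h.
rewrite mul1r (le_trans _ (weight_ge b0 (ltW l1)))// ler_expR.
apply: (@le_trans _ _ (C * (Q * ln l))); first by rewrite ler_wpM2l.
by rewrite mulrA ler_wpM2r// ltW.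
Qed.

Lemma sublog_regime_expR m C b : 0 < b -> 0 < C -> sublog_regime m ->
  exists K L0, forall l, L0 <= l -> expR (C * m l) <= K * weight b l.
Proof.
move=> b0 C0 [_ /cvgrPdist_le/(_ (4 * b / C))].
rewrite divr_gt0 ?mulr_gt0// => /(_ isT) [L [_ LP]].
apply: (@log_bound_expR m C b (4 * b / C) L); [exact: ltW|exact: ltW| |].
  by rewrite mulrC divfK// gt_eqF.
move=> l /LP; rewrite sub0r normrN; apply: le_trans; exact: ler_norm.
Qed.

Lemma log_regime_upper m : log_regime m ->
  exists Q L, 0 < Q /\ forall l, L < l -> m l / ln l <= Q.
Proof.
move=> [_ _]; rewrite limf_esupE => /ereal_inf_lt[_ [V [L [_ LV]] <-]] h.
have [Q [Q0 hQ]] : exists Q : R, 0 < Q /\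
    (ereal_sup [set (m l / ln l)%:E | l in V] <= Q%:E)%E.
  case: (ereal_sup _) h => [r _|//|_]; last by exists 1; split; rewrite ?leNye.
  exists (Num.max r 1); split; first by rewrite lt_max ltr01 orbT.
  by rewrite lee_fin le_max lexx.
exists Q, L; split=> // l /LV Vl; rewrite -lee_fin (le_trans _ hQ)//.
by apply: ereal_sup_ubound; exists l.
Qed.

Lemma log_regime_expR m C : 0 < C -> log_regime m ->
  exists b K L0, 0 < b /\ forall l, L0 <= l -> expR (C * m l) <= K * weight b l.
Proof.
move=> C0 /log_regime_upper[Q [L [Q0 QL]]]; exists (C * Q).
have CQ0 : 0 < C * Q by rewrite mulr_gt0.
have [|||K [L0 H]] := @log_bound_expR m C (C * Q) Q L _ _ _ QL.
- exact: ltW.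
- exact: ltW.
- by lra.
by exists K, L0.
Qed.

(** The surplus power of l, with exponent C Q - 6 b, eventually exceeds any constant. In the density
    argument A absorbs all the factors that do not depend on l. *)
Lemma log_lower_expR m C b Q L : 0 <= b -> 0 < C -> 6 * b < C * Q ->
  (forall l, L < l -> Q <= m l / ln l) ->
  forall A, exists L0, forall l, L0 <= l -> A * weight b l <= expR (C * m l).
Proof.
move=> b0 C0 CQ mQ A.
pose e := C * Q - 6 * b; have e0 : 0 < e by rewrite subr_gt0.
pose L1 := expR (ln (`|A| + 1) / e).
exists (Num.max 2 (Num.max (L + 1) L1)) => l; rewrite !ge_max => /and3P[l2 Ll L1l].
have l1 : 1 < l by rewrite (lt_le_trans _ l2)// ltr1n.
have l0 : 0 < l by exact: lt_trans l1.
have ln0 : 0 < ln l by rewrite ln_gt0.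
have Ll' : L < l by rewrite (lt_le_trans _ Ll)// ltrDl.
have := mQ l Ll'; rewrite ler_pdivlMr// => h.
have A1 : 0 < `|A| + 1 by rewrite ltr_wpDl.
have h1 : `|A| + 1 <= expR (e * ln l).
  rewrite -[leLHS]lnK ?posrE// ler_expR mulrC -ler_pdivrMr//.
  by rewrite -[leLHS]expRK ler_ln ?posrE ?expR_gt0.
apply: (@le_trans _ _ (expR (e * ln l) * expR (6 * b * ln l))).
  apply: (@le_trans _ _ (`|A| * weight b l)).
    by rewrite ler_wpM2r ?ler_norm// ltW// weight_gt0.
  rewrite ler_pM//; first by rewrite ltW// weight_gt0.
    by rewrite (le_trans _ h1)// lerDl.
  exact: weight_le_expR.
rewrite -expRD ler_expR -mulrDl /e subrK -mulrA.
by rewrite ler_wpM2l// ltW.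
Qed.

Lemma sublog_regime_lower m C : 0 < C -> sublog_regime m ->
  forall A, exists L0, forall l, L0 <= l -> A * weight 0 l <= expR (C * m l).
Proof.
move=> C0 [/cvgryPge my _] A.
have [L [_ LP]] := my (ln (`|A| + 1) / C).
exists (L + 1) => l Ll; rewrite /weight powRr0 expr1n mulr1.
have A1 : 0 < `|A| + 1 by rewrite ltr_wpDl.
apply: (@le_trans _ _ (`|A| + 1)); first by rewrite (le_trans (ler_norm _))// lerDl.
rewrite -[leLHS]lnK ?posrE// ler_expR mulrC -ler_pdivrMr//.
by apply: LP; rewrite (lt_le_trans _ Ll)// ltrDl.
Qed.

Lemma log_regime_lower m C : 0 < C -> log_regime m ->
  exists2 b, 0 < b & forall A, exists L0, forall l, L0 <= l ->
    A * weight b l <= expR (C * m l).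
Proof.
move=> C0 [+ _ _]; rewrite limf_einfE => /ereal_sup_gt[_ [V [L [_ LV]] <-]] h.
have [Q [Q0 hQ]] : exists Q : R, 0 < Q /\
    (Q%:E <= ereal_inf [set (m l / ln l)%:E | l in V])%E.
  case: (ereal_inf _) h => [r r0|_|//]; last by exists 1; split => //; rewrite leey.
  by exists r; split.
(* With this b, 6 b is half of C Q, hence strictly below it. *)
exists (C * Q / 12); first by rewrite divr_gt0// mulr_gt0.
apply: (@log_lower_expR m C (C * Q / 12) Q L) => //.
- by rewrite divr_ge0// ltW// mulr_gt0.
- by have := mulr_gt0 C0 Q0; lra.
move=> l /LV Vl; rewrite -lee_fin (le_trans hQ)//.
by apply: ereal_inf_lbound; exists l.
Qed.

Lemma superlog_regime_lower m C : 0 < C -> superlog_regime m ->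
  forall b, 0 <= b -> forall A, exists L0, forall l, L0 <= l ->
    A * weight b l <= expR (C * m l).
Proof.
move=> C0 /cvgryPge mly b b0; have [L [_ LP]] := mly ((6 * b + 1) / C).
apply: (@log_lower_expR m C b ((6 * b + 1) / C) L) => //.
by rewrite [ltRHS]mulrC divfK ?ltrDl// gt_eqF.
Qed.

End regimes.

(** * Resonant speeds *)

Section profile.
Context {R : realType}.
Implicit Types (e x t : R).

(* [alpha e] is what makes [resonant e] a solution of w'' + alpha w = 0, as in
   the counterexample of Colombini, De Giorgi and Spagnolo: w is multiplied by
   - exp (e pi) over each half period. *)
Definition alpha e x := 1 - 8 * e * (sin x * cos x) - 4 * e ^+ 2 * sin x ^+ 4.

Definition dalpha e x :=
  - 8 * e * (cos x ^+ 2 - sin x ^+ 2) - 16 * e ^+ 2 * (sin x ^+ 3 * cos x).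

Definition resonant e x := sin x * expR (e * (x - sin x * cos x)).

Definition dresonant e x :=
  (cos x + 2 * e * sin x ^+ 3) * expR (e * (x - sin x * cos x)).

Lemma is_derive_alpha e x : is_derive x 1 (alpha e) (dalpha e x).
Proof.
rewrite /alpha; apply: is_derive_eq; rewrite /GRing.scale /dalpha /=; ring.
Qed.

Let cos2E x : cos x ^+ 2 = 1 - sin x ^+ 2.
Proof. by rewrite -(cos2Dsin2 x) addrK. Qed.

Let is_derive_phase e x :
  is_derive x 1 (fun x => expR (e * (x - sin x * cos x)))
    (2 * e * sin x ^+ 2 * expR (e * (x - sin x * cos x))).
Proof.
apply: is_derive_eq; rewrite /GRing.scale /=.
rewrite (_ : sin x * - sin x = - sin x ^+ 2); last by ring.
rewrite (_ : cos x * cos x = cos x ^+ 2); last by ring.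
rewrite cos2E; ring.
Qed.

Lemma is_derive_resonant e x : is_derive x 1 (resonant e) (dresonant e x).
Proof.
have h := is_derive_phase e x; rewrite /resonant; apply: is_derive_eq.
rewrite /GRing.scale /dresonant /=; ring.
Qed.

Lemma is_derive_dresonant e x :
  is_derive x 1 (dresonant e) (- (alpha e x * resonant e x)).
Proof.
have h := is_derive_phase e x; rewrite /dresonant; apply: is_derive_eq.
rewrite /GRing.scale /alpha /resonant /=; ring.
Qed.

Let sc_le x : `|sin x * cos x| <= 1.
Proof. by rewrite normrM mulr_ile1// ler_norml ?sin_geN1 ?cos_geN1 ?sin_le1 ?cos_le1. Qed.

Let sX_le x n : `|sin x ^+ n| <= 1.
Proof. by rewrite normrX exprn_ile1// ler_norml sin_geN1 sin_le1. Qed.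

Lemma alpha_bound e x : 0 <= e -> e <= 1 -> `|alpha e x - 1| <= 12 * e.
Proof.
move=> e0 e1; rewrite /alpha.
rewrite (_ : _ - 1 = - (8 * e * (sin x * cos x) + 4 * e ^+ 2 * sin x ^+ 4)); last by ring.
have h1 : `|8 * e * (sin x * cos x)| <= 8 * e.
  by rewrite normrM ger0_norm ?mulr_ge0// ler_piMr// mulr_ge0.
have h2 : `|4 * e ^+ 2 * sin x ^+ 4| <= 4 * e ^+ 2.
  by rewrite normrM ger0_norm ?mulr_ge0 ?sqr_ge0// ler_piMr// mulr_ge0 ?sqr_ge0.
have h3 : e ^+ 2 <= e by rewrite expr2 ler_piMr.
by rewrite normrN (le_trans (ler_normD _ _))//; lra.
Qed.

Lemma dalpha_bound e x : 0 <= e -> e <= 1 -> `|dalpha e x| <= 24 * e.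
Proof.
move=> e0 e1; rewrite /dalpha.
have s2 : 0 <= sin x ^+ 2 by exact: sqr_ge0.
have k2 : 0 <= cos x ^+ 2 by exact: sqr_ge0.
have sk := cos2Dsin2 x.
have h0 : `|cos x ^+ 2 - sin x ^+ 2| <= 1 by rewrite ler_norml; apply/andP; split; lra.
have h3 : e ^+ 2 <= e by rewrite expr2 ler_piMr.
have h4 : `|sin x ^+ 3 * cos x| <= 1.
  by rewrite normrM mulr_ile1// ler_norml ?cos_geN1 ?cos_le1.
have h1 : `|- 8 * e * (cos x ^+ 2 - sin x ^+ 2)| <= 8 * e.
  by rewrite !mulNr normrN normrM ger0_norm ?mulr_ge0// ler_piMr// mulr_ge0.
have h2 : `|16 * e ^+ 2 * (sin x ^+ 3 * cos x)| <= 16 * e ^+ 2.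
  by rewrite normrM ger0_norm ?mulr_ge0 ?sqr_ge0// ler_piMr// mulr_ge0 ?sqr_ge0.
by rewrite (le_trans (ler_normB _ _))//; lra.
Qed.

Lemma alpha_lipschitz e x x' : 0 <= e -> e <= 1 ->
  `|alpha e x - alpha e x'| <= 24 * e * `|x - x'|.
Proof.
move=> e0 e1; wlog xx : x x' / x' <= x.
  move=> H; have [xx|/ltW xx] := leP x' x; first exact: H.
  by rewrite distrC [`|x - _|]distrC; exact: H.
have cA : continuous (alpha e) := derive_continuous (is_derive_alpha e).
have [c _ ->] := @MVT_segment R (alpha e) (dalpha e) x' x xx
  (fun c _ => is_derive_alpha e c) (continuous_subspaceT cA).
by rewrite normrM ler_wpM2r// dalpha_bound.
Qed.

Lemma alpha0 e : alpha e 0 = 1.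
Proof. by rewrite /alpha sin0 !mul0r expr0n /= !mulr0 !subr0. Qed.

Lemma alphapi e : alpha e pi = 1.
Proof. by rewrite /alpha sinpi !mul0r expr0n /= !mulr0 !subr0. Qed.

Lemma resonant0 e : resonant e 0 = 0.
Proof. by rewrite /resonant sin0 mul0r. Qed.

Lemma resonantpi e : resonant e pi = 0.
Proof. by rewrite /resonant sinpi mul0r. Qed.

Lemma dresonant0 e : dresonant e 0 = 1.
Proof. by rewrite /dresonant sin0 cos0 !mul0r expr0n /= subr0 !mulr0 addr0 expR0 mulr1. Qed.

Lemma dresonantpi e : dresonant e pi = - expR (e * pi).
Proof. by rewrite /dresonant sinpi cospi !mul0r expr0n /= subr0 mulr0 addr0 mulN1r. Qed.

Lemma continuous_dalpha e : continuous (dalpha e).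
Proof.
have cs : continuous (@sin R) := @continuous_sin R.
have cc : continuous (@cos R) := @continuous_cos R.
have cX (f : R -> R) n : continuous f -> continuous (fun x => f x ^+ n).
  move=> cf; elim: n => [|n IHn] x.
    by under eq_fun do rewrite expr0; exact: cvg_cst.
  by under eq_fun do rewrite exprS; apply: cvgM; [exact: cf|exact: IHn].
move=> x; apply: cvgB; apply: cvgM.
- exact: cvg_cst.
- by apply: cvgB; exact: cX.
- exact: cvg_cst.
- by apply: cvgM; [exact: cX|exact: cc].
Qed.

(** The profile in the variable x = om (t - s) over one half period; om ^ 2 = cb l ^ 2 accounts for
    the factor cb in front of alpha. A is the velocity at time s. *)
Lemma solves_resonant (cb l e s A : R) : 0 < cb -> 0 < l ->
  let om := Num.sqrt cb * l in
  solves s (s + pi / om) (fun t => l ^+ 2 * (cb * alpha e (om * (t - s))))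
    (fun t => A / om * resonant e (om * (t - s)))
    (fun t => A * dresonant e (om * (t - s))).
Proof.
move=> cb0 l0 om.
have om0 : 0 < om by rewrite mulr_gt0// sqrtr_gt0.
have om2 : om ^+ 2 = cb * l ^+ 2 by rewrite exprMn sqr_sqrtr// ltW.
have sh t : is_derive t 1 (fun t => om * (t - s)) om.
  by apply: is_derive_eq; rewrite /GRing.scale /=; ring.
have d1 t : is_derive t 1 (fun t => resonant e (om * (t - s)))
    (dresonant e (om * (t - s)) * om).
  exact: (@is_derive1_comp _ (resonant e) (fun t => om * (t - s)) t _ _
    (is_derive_resonant _ _) (sh t)).
have d2 t : is_derive t 1 (fun t => dresonant e (om * (t - s)))
    (- (alpha e (om * (t - s)) * resonant e (om * (t - s))) * om).
  exact: (@is_derive1_comp _ (dresonant e) (fun t => om * (t - s)) t _ _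
    (is_derive_dresonant _ _) (sh t)).
have d3 t : is_derive t 1 (fun t => A / om * resonant e (om * (t - s)))
    (A * dresonant e (om * (t - s))).
  have ? := d1 t; apply: is_derive_eq; rewrite /GRing.scale /=; field.
  by rewrite gt_eqF.
have d4 t : is_derive t 1 (fun t => A * dresonant e (om * (t - s)))
    (- (l ^+ 2 * (cb * alpha e (om * (t - s))) *
      (A / om * resonant e (om * (t - s))))).
  have ? := d2 t; apply: is_derive_eq; rewrite /GRing.scale /=.
  set a := alpha _ _; set r := resonant _ _.
  rewrite (_ : l ^+ 2 * (cb * a) = cb * l ^+ 2 * a); last by ring.
  by rewrite -om2; field; rewrite gt_eqF.
split=> //.
- exact: (continuous_subspaceT (derive_continuous d3)).
- exact: (continuous_subspaceT (derive_continuous d4)).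
Qed.

End profile.

Section base_speed.
Context {R : realType}.
Notation mu := (@lebesgue_measure R).
Variables (T0 mu1 mu2 : R) (omega theta : R -> R).
Hypotheses (T0_gt0 : 0 < T0) (mu1_gt0 : 0 < mu1) (mu12 : mu1 < mu2)
  (om : is_modulus omega)
  (theta_nd : {in `]0, T0[ &, forall s t, s <= t -> theta t <= theta s}).

(** T' is the time by which all the pieces of a glued speed have been joined; absolute continuity is
    asked only on intervals that contain them all. *)
Lemma PS_intro T' c g : 0 < T' -> T' < T0 ->
  (forall t, t \in `[0, T0] -> mu1 <= c t <= mu2) ->
  (forall t s, t \in `[0, T0] -> s \in `[0, T0] -> `|c t - c s| <= omega `|t - s|) ->
  (forall b, T' <= b -> b < T0 -> abs_cont c g 0 b) ->
  measurable_fun `]0, T0[ g ->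
  {ae mu, forall t, t \in `]0, T0[ -> `|g t| <= theta t} ->
  PS T0 mu1 mu2 omega theta c.
Proof.
move=> T'0 T'T cb cm ac mg gth.
have cc : {within `[0, T0], continuous c}.
  apply: (within_continuous_modulus (modulus_cvg0 om)).
  by move=> s t sT tT; exact: cm.
have sub : `]0, T0[ `<=` `[0, T0] by exact: subset_itv_oo_cc.
split => //; exists g => //; split.
- split.
    have /measurable_EFinP mc := measurable_int mu (within_integrable cc).
    exact: measurable_funS mc.
  move=> a b a0 bT; exists mu2; apply: aeW => t; rewrite in_itv/= => /andP[at_ tb].
  have /cb/andP[c1 c2] : t \in `[0, T0].
    by rewrite in_itv/= (le_trans (ltW a0))// (le_trans tb)// ltW.
  by rewrite ger0_norm// (le_trans (ltW mu1_gt0)).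
- split=> // a b a0 bT; exists (theta a).
  apply: filterS gth; first exact: (ae_filter_ringOfSetsType mu).
  move=> t gt; rewrite in_itv/= => /andP[at_ tb].
  have tT : t < T0 by exact: le_lt_trans bT.
  have tT0 : t \in `]0, T0[ by rewrite in_itv/= (lt_le_trans a0).
  rewrite (le_trans (gt tT0))// theta_nd//.
  by rewrite in_itv/= a0 (le_lt_trans at_).
- exact: abs_cont_weak_derivative T'0 T'T ac.
Qed.

Variables (c : R -> R) (eta sig : R).
Hypotheses (cPS : PS T0 mu1 mu2 omega theta c) (eta0 : 0 < eta) (eta1 : eta < 1)
  (sig0 : 0 < sig) (sigT : sig < T0).

(** The margins left for a perturbation are eta (mu2 - mu1) / 2 in the bounds, the fraction eta of
    omega, and all of theta before sig, where the speed is frozen. *)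
Definition base_speed t := (1 - eta) * c (Num.max t sig) + eta * ((mu1 + mu2) / 2).

Let max_itv t : t \in `[0, T0] -> Num.max t sig \in `[0, T0].
Proof.
rewrite !in_itv/= => /andP[t0 tT].
by rewrite le_max t0/= ge_max tT (ltW sigT).
Qed.

Lemma base_speed_modulus t s : t \in `[0, T0] -> s \in `[0, T0] ->
  `|base_speed t - base_speed s| <= (1 - eta) * omega `|t - s|.
Proof.
move=> tT sT; rewrite /base_speed.
rewrite [X in `|X|](_ : _ = (1 - eta) * (c (Num.max t sig) - c (Num.max s sig))); last by ring.
have e1 : 0 <= 1 - eta by rewrite subr_ge0 ltW.
rewrite normrM ger0_norm// ler_wpM2l//.
rewrite (le_trans (PS_modulus cPS (max_itv tT) (max_itv sT)))// (modulus_nd om)//.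
have [t1|t1] := leP t sig; have [s1|s1] := leP s sig.
- by rewrite subrr normr0.
- by rewrite !ler0_norm; lra.
- by rewrite !ger0_norm; lra.
- by [].
Qed.

Lemma base_speed_bounds t : t \in `[0, T0] ->
  mu1 + eta * ((mu2 - mu1) / 2) <= base_speed t <= mu2 - eta * ((mu2 - mu1) / 2).
Proof.
move=> tT; have /andP[c1 c2] := PS_bounds cPS (max_itv tT); rewrite /base_speed.
have e1 : 0 <= 1 - eta by rewrite subr_ge0 ltW.
have h1 : (1 - eta) * mu1 <= (1 - eta) * c (Num.max t sig) by rewrite ler_wpM2l.
have h2 : (1 - eta) * c (Num.max t sig) <= (1 - eta) * mu2 by rewrite ler_wpM2l.
by apply/andP; split; lra.
Qed.

Lemma base_speed_close t : t \in `[0, T0] ->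
  `|base_speed t - c t| <= eta * (mu2 - mu1) + omega sig.
Proof.
move=> tT; have /andP[c1 c2] := PS_bounds cPS (max_itv tT).
have h1 : `|c (Num.max t sig) - c t| <= omega sig.
  rewrite (le_trans (PS_modulus cPS (max_itv tT) tT))// (modulus_nd om)//.
  move: tT; rewrite in_itv/= => /andP[t0 _].
  have [t1|t1] := leP t sig; last by rewrite subrr normr0 ltW.
  by rewrite ger0_norm ?subr_ge0// gerBl.
rewrite /base_speed; set u := c (Num.max _ _) in c1 c2 h1 *.
rewrite (_ : _ - c t = eta * ((mu1 + mu2) / 2 - u) + (u - c t)); last by ring.
rewrite (le_trans (ler_normD _ _))// lerD// normrM gtr0_norm// ler_wpM2l ?(ltW eta0)//.
by rewrite ler_norml; apply/andP; split; lra.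
Qed.

Lemma base_speed_const t : t <= sig -> base_speed t = base_speed 0.
Proof. by move=> ts; rewrite /base_speed !max_r// ltW. Qed.

Lemma base_speed_abs_cont g b : W1oo_loc T0 c g -> sig <= b -> b < T0 ->
  abs_cont base_speed (fun t => (1 - eta) * g t) sig b.
Proof.
move=> W sb bT.
apply: (abs_cont_eq sb _ _ (abs_cont_affine (1 - eta) (eta * ((mu1 + mu2) / 2)) sb
  (W1oo_loc_abs_cont sig0 sb bT (PS_continuous cPS) W))) => //.
by move=> t; rewrite in_itv/= => /andP[st _]; rewrite /base_speed max_l.
Qed.

End base_speed.

Section resonant_speed.
Context {R : realType}.
Notation mu := (@lebesgue_measure R).
Variables (T0 mu1 mu2 : R) (omega theta : R -> R).
Hypotheses (T0_gt0 : 0 < T0) (mu1_gt0 : 0 < mu1) (mu12 : mu1 < mu2)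
  (om : is_modulus omega) (theta_gt0 : {in `]0, T0[, forall t, 0 < theta t})
  (theta_nd : {in `]0, T0[ &, forall s t, s <= t -> theta t <= theta s}).
Variables (c : R -> R) (eta tau l : R).
Hypotheses (cPS : PS T0 mu1 mu2 omega theta c) (eta0 : 0 < eta) (eta1 : eta < 1)
  (tau0 : 0 < tau) (tauT : 2 * tau < T0) (l_gt0 : 0 < l).

(** Small enough for 12 cb k0 <= 1/4 and 24 cb (sqrt cb) k0 <= 1/2 ([k0_cb]), where 12 and 24 come
    from [alpha_bound] and [dalpha_bound] and cb is at most mu2. *)
Definition resonance_strength := (48 * (1 + mu2) ^+ 2)^-1.

Let k0 := resonance_strength.
Let base := base_speed mu1 mu2 c eta (2 * tau).
Let cb := base 0.
Definition pulsation := Num.sqrt cb * l.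
Definition half_period := pi / pulsation.
Let h := half_period.
Definition cell_count := Num.truncn (tau / h).
Let N := cell_count.
Definition amplitude (k : nat) := k0 * (rate omega theta l (k.+1%:R * h) / l).
Let cell (k : nat) t := cb * alpha (amplitude k) (pulsation * (t - k%:R * h)).
Let dcell (k : nat) t :=
  cb * (dalpha (amplitude k) (pulsation * (t - k%:R * h)) * pulsation).
Let idx t := Num.truncn (t / h).

(* The speed is constant on [0, 2 tau], except for the resonant cells, which
   fill [0, tau] and last a half period each.  The amplitude is constant in
   each cell and uses the value of theta at the right end of the cell, so that
   the slope stays below both l omega(1/l) and theta. *)
Definition resonant_speed t := if t < N%:R * h then cell (idx t) t else base t.

(** All four say that l is large. [om1] keeps the amplitudes below 1; the perturbation has size at
    most omega (1/l) / 4, which [om_eta] and [om_tau] fit into the margins of the base speed;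
    [h_tau] makes the cells reach beyond tau / 2 and one further cell end before 2 tau. *)
Hypotheses (h_tau : h <= tau / 2) (om1 : omega l^-1 <= 1)
  (om_eta : omega l^-1 / 4 <= eta * ((mu2 - mu1) / 2))
  (om_tau : omega l^-1 / 4 <= eta * omega tau).

Let sig0 : 0 < 2 * tau. Proof. by rewrite mulr_gt0. Qed.

Let z_itv : 0 \in `[0, T0]. Proof. by rewrite in_itv/= lexx ltW. Qed.

Lemma base_speed0_itv : mu1 <= cb <= mu2.
Proof.
have /andP[h1 h2] := base_speed_bounds cPS eta1 tauT z_itv.
have e : 0 <= eta * ((mu2 - mu1) / 2) by rewrite mulr_ge0 ?(ltW eta0)// divr_ge0// subr_ge0 ltW.
by rewrite /cb /base; apply/andP; split; lra.
Qed.

Let cb_gt0 : 0 < cb.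
Proof. by have /andP[h1 _] := base_speed0_itv; exact: lt_le_trans h1. Qed.

Lemma pulsation_gt0 : 0 < pulsation.
Proof. by rewrite mulr_gt0// sqrtr_gt0. Qed.

Lemma half_period_gt0 : 0 < half_period.
Proof. by rewrite divr_gt0 ?pi_gt0 ?pulsation_gt0. Qed.

Let h0 := half_period_gt0.

Lemma cell_count_itv : N%:R * h <= tau /\ tau < N.+1%:R * h.
Proof.
have /andP[h1 h2] : N%:R <= tau / h < N.+1%:R by apply: truncn_itv; rewrite ltW// divr_gt0.
by split; [rewrite -ler_pdivlMr|rewrite -ltr_pdivrMr].
Qed.

Let idxP t : 0 <= t -> (idx t)%:R * h <= t /\ t < (idx t).+1%:R * h.
Proof.
move=> t0; have /andP[h1 h2] : (idx t)%:R <= t / h < (idx t).+1%:R.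
  by apply: truncn_itv; rewrite divr_ge0// ltW.
by split; [rewrite -ler_pdivlMr|rewrite -ltr_pdivrMr].
Qed.

Let idx_def (k : nat) t : k%:R * h <= t -> t < k.+1%:R * h -> idx t = k.
Proof.
move=> h1 h2; apply: truncn_def.
by rewrite ler_pdivlMr// ltr_pdivrMr// h1.
Qed.

Let ler_h (i j : nat) : (i <= j)%N -> i%:R * h <= j%:R * h.
Proof. by move=> ij; rewrite ler_wpM2r ?(ltW h0)// ler_nat. Qed.

Let Ntau : N%:R * h <= tau := cell_count_itv.1.

Let tau2 : tau <= 2 * tau. Proof. by move: tau0; lra. Qed.

Let cell_time (k : nat) : (k < N)%N -> k.+1%:R * h \in `]0, T0[.
Proof.
move=> kN; rewrite in_itv/=; apply/andP; split; first by rewrite mulr_gt0.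
by rewrite (le_lt_trans (ler_h kN))// (le_lt_trans Ntau)//; move: tau0 tauT; lra.
Qed.

Let k0_gt0 : 0 < k0.
Proof. by rewrite invr_gt0 mulr_gt0// exprn_gt0// addr_gt0// (lt_trans mu1_gt0). Qed.

Let K0 : 0 <= l * omega l^-1.
Proof. by rewrite mulr_ge0 ?(ltW l_gt0)// (modulus_ge0 om)// invr_ge0 ltW. Qed.

Lemma amplitude_ge0 (k : nat) : (k < N)%N -> 0 <= amplitude k.
Proof.
move=> kN; rewrite mulr_ge0 ?(ltW k0_gt0)// divr_ge0 ?(ltW l_gt0)// ltW//.
exact: (rate_gt0 om theta_gt0 l_gt0 (cell_time kN)).
Qed.

Let amplitude_le (k : nat) : (k < N)%N -> amplitude k <= k0 * omega l^-1.
Proof.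
move=> kN; rewrite ler_wpM2l ?(ltW k0_gt0)// ler_pdivrMr// [leRHS]mulrC.
by rewrite /rate ge_min lexx.
Qed.

Let mu2_gt0 : 0 < mu2. Proof. exact: lt_trans mu12. Qed.

Let k0_cb : 12 * cb * k0 <= 4^-1 /\ 24 * (cb * Num.sqrt cb) * k0 <= 2^-1.
Proof.
have /andP[c1 c2] := base_speed0_itv.
have m0 : 0 < (1 + mu2) ^+ 2 by rewrite exprn_gt0// addr_gt0.
have s0 : 0 <= Num.sqrt cb by exact: sqrtr_ge0.
have s2 : Num.sqrt cb <= 1 + mu2.
  have := sqr_sqrtr (ltW cb_gt0); nra.
have p1 : cb * Num.sqrt cb <= (1 + mu2) ^+ 2.
  rewrite expr2 ler_pM ?(ltW cb_gt0)//; lra.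
have p2 : cb <= (1 + mu2) ^+ 2 by have := mulr_gt0 mu2_gt0 mu2_gt0; nra.
have D0 : 0 < 48 * (1 + mu2) ^+ 2 by rewrite mulr_gt0.
rewrite /k0 /resonance_strength; split; rewrite (ler_pdivrMr _ _ D0).
  by move: p2; set X := (1 + mu2) ^+ 2; lra.
by move: p1; set X := (1 + mu2) ^+ 2; set Y := cb * _; lra.
Qed.

Let amplitude_le1 (k : nat) : (k < N)%N -> amplitude k <= 1.
Proof.
move=> kN; rewrite (le_trans (amplitude_le kN))// mulr_ile1//.
- exact: ltW.
- by rewrite (modulus_ge0 om)// invr_ge0 ltW.
- rewrite invf_le1 ?mulr_gt0 ?exprn_gt0 ?addr_gt0//; have := sqr_ge0 mu2.
  by move: mu2_gt0 => m0; nra.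
Qed.

Let base_cb t : t <= 2 * tau -> base t = cb.
Proof. by move=> t2; exact: base_speed_const. Qed.

Let phase_end (k : nat) : pulsation * (k.+1%:R * h - k%:R * h) = pi.
Proof.
rewrite -mulrBl -natrB// subSnn mul1r /h /half_period mulrCA mulfV ?mulr1// gt_eqF//.
exact: pulsation_gt0.
Qed.

Let cell_start (k : nat) : cell k (k%:R * h) = cb.
Proof. by rewrite /cell subrr mulr0 alpha0 mulr1. Qed.

Let cell_end (k : nat) : cell k (k.+1%:R * h) = cb.
Proof. by rewrite /cell phase_end alphapi mulr1. Qed.

Lemma resonant_speed_cell (k : nat) t : (k < N)%N -> k%:R * h <= t ->
  t <= k.+1%:R * h -> resonant_speed t = cell k t.
Proof.
move=> kN kt; rewrite le_eqVlt => /predU1P[->|tk]; last first.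
  by rewrite /resonant_speed (lt_le_trans tk (ler_h kN)) (idx_def kt tk).
(* At the right end of the cell the defining formula is already that of the next cell, or that of
   [base]; the value is cb in each case. *)
rewrite /resonant_speed cell_end ltr_pM2r// ltr_nat.
case: ifPn => [k1N|_]; last by rewrite base_cb// (le_trans (ler_h kN))// (le_trans Ntau).
rewrite (@idx_def k.+1) ?cell_start//.
by rewrite ltr_pM2r// ltr_nat.
Qed.

Lemma resonant_speed_out t : N%:R * h <= t -> resonant_speed t = base t.
Proof. by move=> Nt; rewrite /resonant_speed ltNge Nt. Qed.

Let pert t := resonant_speed t - base t.

Let pert_out t : N%:R * h <= t -> pert t = 0.
Proof. by move=> /resonant_speed_out; rewrite /pert => ->; rewrite subrr. Qed.

Let in_cell (k : nat) t : (k < N)%N -> t <= k.+1%:R * h -> t <= 2 * tau.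
Proof. by move=> kN tk; rewrite (le_trans tk)// (le_trans (ler_h kN))// (le_trans Ntau). Qed.

Let pert_cell (k : nat) t : (k < N)%N -> k%:R * h <= t -> t <= k.+1%:R * h ->
  pert t = cell k t - cb.
Proof.
by move=> kN kt tk; rewrite /pert (resonant_speed_cell kN kt tk) base_cb// (in_cell kN).
Qed.

Let idxN t : t < N%:R * h -> 0 <= t -> (idx t < N)%N.
Proof.
move=> tN t0; have [h1 _] := idxP t0.
by rewrite -(ltr_nat R) -(ltr_pM2r h0) (le_lt_trans h1).
Qed.

Let pert_bound t : 0 <= t -> `|pert t| <= omega l^-1 / 4.
Proof.
have o0 : 0 <= omega l^-1 by rewrite (modulus_ge0 om)// invr_ge0 ltW.
move=> t0; have [Nt|tN] := leP (N%:R * h) t; first by rewrite pert_out// normr0 divr_ge0.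
have kN := idxN tN t0; have [h1 h2] := idxP t0.
rewrite (pert_cell kN h1 (ltW h2)) /cell -{2}(mulr1 cb) -mulrBr normrM gtr0_norm//.
have h3 := alpha_bound (pulsation * (t - (idx t)%:R * h)) (amplitude_ge0 kN) (amplitude_le1 kN).
apply: (@le_trans _ _ (cb * (12 * (k0 * omega l^-1)))).
  by rewrite ler_pM2l// (le_trans h3)// ler_wpM2l// amplitude_le.
rewrite (_ : cb * _ = 12 * cb * k0 * omega l^-1); last by ring.
by rewrite mulrC ler_wpM2l// k0_cb.1.
Qed.

Let pert_cell_lip (k : nat) s t : (k < N)%N -> k%:R * h <= s -> s <= k.+1%:R * h ->
  k%:R * h <= t -> t <= k.+1%:R * h -> `|pert t - pert s| <= l * omega l^-1 / 2 * `|t - s|.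
Proof.
have o0 : 0 <= omega l^-1 by rewrite (modulus_ge0 om)// invr_ge0 ltW.
move=> kN s1 s2 t1 t2; rewrite !(pert_cell kN)// opprB addrA subrK /cell.
rewrite -mulrBr normrM gtr0_norm//.
have h3 := alpha_lipschitz (pulsation * (t - k%:R * h)) (pulsation * (s - k%:R * h))
  (amplitude_ge0 kN) (amplitude_le1 kN).
have e : t - k%:R * h - (s - k%:R * h) = t - s by ring.
rewrite -mulrBr e normrM (gtr0_norm pulsation_gt0) in h3.
apply: (@le_trans _ _ (cb * (24 * (k0 * omega l^-1) * (pulsation * `|t - s|)))).
  rewrite ler_pM2l// (le_trans h3)// ler_wpM2r//.
    by rewrite mulr_ge0// ltW// pulsation_gt0.
  by rewrite ler_wpM2l// amplitude_le.
rewrite (_ : cb * _ = 24 * (cb * Num.sqrt cb) * k0 * (l * omega l^-1 * `|t - s|)); last first.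
  by rewrite /pulsation; ring.
rewrite (_ : l * omega l^-1 / 2 * _ = 2^-1 * (l * omega l^-1 * `|t - s|)); last by ring.
by rewrite ler_wpM2r ?k0_cb.2// mulr_ge0.
Qed.

(** The perturbation vanishes at every cell boundary. For s and t in different cells, its values are
    bounded from the end of the cell of s and from the start of the cell of t, so no sum over
    intermediate cells occurs. *)
Let pert_lip s t : 0 <= s -> s <= t -> `|pert t - pert s| <= l * omega l^-1 / 2 * (t - s).
Proof.
have C0 : 0 <= l * omega l^-1 / 2 by rewrite divr_ge0.
move=> s0 st; have t0 : 0 <= t by exact: le_trans st.
have [Ns|sN] := leP (N%:R * h) s.
  by rewrite !pert_out ?(le_trans Ns)// subrr normr0 mulr_ge0// subr_ge0.
have kN := idxN sN s0; have [s1 s2] := idxP s0.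
set k := idx s in kN s1 s2.
have [tk|kt] := leP t (k.+1%:R * h).
  have := pert_cell_lip kN s1 (ltW s2) (le_trans s1 st) tk.
  by rewrite [`|t - s|]ger0_norm// subr_ge0.
have e1 : pert (k.+1%:R * h) = 0.
  by rewrite (pert_cell kN) ?cell_end ?subrr// ler_h.
have := pert_cell_lip kN s1 (ltW s2) (ler_h (leqnSn k)) (lexx _).
rewrite e1 sub0r normrN [`|_ - s|]ger0_norm ?subr_ge0 ?(ltW s2)// => hs.
have ht : `|pert t| <= l * omega l^-1 / 2 * (t - k.+1%:R * h).
  have [Nt|tN] := leP (N%:R * h) t.
    by rewrite pert_out// normr0 mulr_ge0// subr_ge0 ltW.
  have jN := idxN tN t0; have [t1 t2] := idxP t0.
  set j := idx t in jN t1 t2.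
  have kj : (k.+1 <= j)%N by rewrite -ltnS -(ltr_nat R) -(ltr_pM2r h0) (lt_trans kt).
  have e2 : pert (j%:R * h) = 0.
    by rewrite (pert_cell jN) ?cell_start ?subrr// ler_h.
  have := pert_cell_lip jN (lexx _) (ler_h (leqnSn j)) t1 (ltW t2).
  rewrite e2 subr0 [`|t - _|]ger0_norm ?subr_ge0// => /le_trans; apply.
  by rewrite ler_wpM2l// lerB// ler_h.
rewrite (le_trans (ler_normB _ _))// (le_trans (lerD ht hs))// -mulrDr.
by rewrite ler_wpM2l// addrA subrK.
Qed.

(** Up to 2 tau only the perturbation varies. If t - s <= 1/l, its Lipschitz constant l omega (1/l)
    / 2 suffices, because sigma / omega sigma is nondecreasing; if t - s > 1/l, twice its size is
    below omega (t - s). If t > 2 tau, the base uses the fraction 1 - eta of omega, and the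
    perturbation, which lives before tau, meets t - s >= tau and fits in the rest by [om_tau]. *)
Lemma resonant_speed_modulus t s : t \in `[0, T0] -> s \in `[0, T0] ->
  `|resonant_speed t - resonant_speed s| <= omega `|t - s|.
Proof.
wlog st : s t / s <= t.
  move=> H tT sT; have [st|/ltW st] := leP s t; first exact: H.
  by rewrite distrC [`|t - _|]distrC; exact: H.
move=> tT sT; have [t0 s0] : 0 <= t /\ 0 <= s.
  by move: tT sT; rewrite !in_itv/= => /andP[-> _] /andP[-> _].
have o0 : 0 <= omega l^-1 by rewrite (modulus_ge0 om)// invr_ge0 ltW.
have ots : 0 <= omega `|t - s| by exact: (modulus_ge0 om).
have li0 : 0 < l^-1 by rewrite invr_gt0.
have [t2|t2] := leP t (2 * tau).
  have -> : resonant_speed t - resonant_speed s = pert t - pert s.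
    by rewrite /pert !base_cb ?(le_trans st)// opprB addrA subrK.
  have [->|nts] := eqVneq t s; first by rewrite subrr normr0 (modulus_ge0 om).
  have ts0 : 0 < t - s by rewrite subr_gt0 lt_neqAle eq_sym nts.
  rewrite [`|t - s|]gtr0_norm//; have [tsl|tsl] := leP (t - s) l^-1.
    have := modulus_div_nd om ts0 tsl.
    rewrite ler_pdivrMr ?(modulus_gt0 om)// mulrAC ler_pdivlMr ?(modulus_gt0 om)//.
    move=> hd; rewrite (le_trans (pert_lip s0 st))//.
    rewrite -(ler_pM2l li0).
    rewrite (_ : l^-1 * _ = (t - s) * omega l^-1 / 2); last by field; rewrite gt_eqF.
    rewrite (le_trans _ hd)// ler_pdivrMr// ler_peMr ?ler1n//.
    by rewrite mulr_ge0// ltW.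
  rewrite (le_trans (ler_normB _ _))//.
  rewrite (le_trans (lerD (pert_bound t0) (pert_bound s0)))//.
  have := modulus_nd om (ltW li0) (ltW tsl); lra.
have et : resonant_speed t = base t.
  by rewrite resonant_speed_out// (le_trans Ntau)// ltW// (le_lt_trans _ t2)//; lra.
have hb := base_speed_modulus om cPS eta1 tauT tT sT.
rewrite (_ : resonant_speed t - _ = base t - base s - pert s); last first.
  by rewrite et /pert; ring.
rewrite (le_trans (ler_normB _ _))//.
have hp : `|pert s| <= eta * omega `|t - s|.
  have [Ns|sN] := leP (N%:R * h) s.
    by rewrite pert_out// normr0 mulr_ge0// ltW.
  rewrite (le_trans (pert_bound s0))// (le_trans om_tau)// ler_wpM2l ?(ltW eta0)//.
  rewrite (modulus_nd om)//; first exact: ltW.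
  rewrite ger0_norm ?subr_ge0//.
  by have := le_trans (ltW sN) Ntau; move: t2; lra.
rewrite (le_trans (lerD hb hp))// -mulrDl subrK mul1r//.
Qed.

Lemma resonant_speed_bounds t : t \in `[0, T0] -> mu1 <= resonant_speed t <= mu2.
Proof.
move=> tT; have /andP[b1 b2] := base_speed_bounds cPS eta1 tauT tT.
have t0 : 0 <= t by move: tT; rewrite in_itv/= => /andP[].
have := le_trans (pert_bound t0) om_eta; rewrite /pert ler_norml => /andP[p1 p2].
by move: b1 b2 p1 p2; rewrite -/base => *; apply/andP; split; lra.
Qed.

Lemma resonant_speed_close t : t \in `[0, T0] ->
  `|resonant_speed t - c t| <= eta * (mu2 - mu1) + omega (2 * tau) + omega l^-1 / 4.
Proof.
move=> tT; have t0 : 0 <= t by move: tT; rewrite in_itv/= => /andP[].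
have hb := base_speed_close om cPS eta0 sig0 tauT tT.
rewrite (_ : _ - c t = (base t - c t) + pert t); last by rewrite /pert; ring.
by rewrite (le_trans (ler_normD _ _))// lerD// pert_bound.
Qed.

Variable g : R -> R.
Hypotheses (W : W1oo_loc T0 c g)
  (gth : {ae mu, forall t : R, t \in `]0, T0[ -> `|g t| <= theta t}).

Let gl t := if t < N%:R * h then dcell (idx t) t
  else if t < 2 * tau then 0 else (1 - eta) * g t.

Let cl_cont a b : 0 <= a -> b <= T0 -> {within `[a, b], continuous resonant_speed}.
Proof.
move=> a0 bT; apply: (within_continuous_modulus (modulus_cvg0 om)).
have sub u : u \in `[a, b] -> u \in `[0, T0].
  by rewrite !in_itv/= => /andP[au ub]; rewrite (le_trans a0)// (le_trans ub).
by move=> s t /sub sT /sub tT; exact: resonant_speed_modulus.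
Qed.

Let dcellE (k : nat) (t : R) : is_derive t 1 (cell k) (dcell k t).
Proof.
have sh : is_derive t 1 (fun t => pulsation * (t - k%:R * h)) pulsation.
  by apply: is_derive_eq; rewrite /GRing.scale /=; ring.
have d1 := @is_derive1_comp _ (alpha (amplitude k))
  (fun t => pulsation * (t - k%:R * h)) t _ _ (is_derive_alpha _ _) sh.
exact: (is_deriveZ cb d1).
Qed.

Let continuous_dcell (k : nat) : continuous (dcell k).
Proof.
move=> t; apply: cvgM; first exact: cvg_cst.
apply: cvgM; last exact: cvg_cst.
apply: (@continuous_comp _ _ _ (fun t => pulsation * (t - k%:R * h))); last exact: continuous_dalpha.
by apply: cvgM; [exact: cvg_cst|apply: cvgB; [exact: cvg_id|exact: cvg_cst]].
Qed.

Let ac_cells (k : nat) : (k <= N)%N -> abs_cont resonant_speed gl 0 (k%:R * h).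
Proof.
have kT (j : nat) : (j <= N)%N -> j%:R * h <= T0.
  by move=> /ler_h/le_trans; apply; rewrite (le_trans Ntau)// (le_trans tau2)// ltW.
elim: k => [_|k IHk kN].
  rewrite mul0r; split.
  - by apply: cl_cont => //; exact: ltW.
  - by apply: integrable_itv_cc; rewrite set_itvoo0; exact: integrable_set0.
  - by move=> psi dpsi _ _; rewrite set_itv1 Rintegral_set1 subrr.
apply: (@abs_cont_cat _ _ _ 0 (k%:R * h)).
- by rewrite mulr_ge0// ltW.
- exact: ler_h.
- by apply: cl_cont => //; exact: kT.
- exact: IHk (ltnW kN).
apply: (@abs_cont_eq _ (cell k) _ (dcell k)).
- exact: ler_h.
- by move=> t; rewrite in_itv/= => /andP[t1 t2]; rewrite (resonant_speed_cell kN).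
- move=> t; rewrite in_itv/= => /andP[t1 t2].
  by rewrite /gl (lt_le_trans t2 (ler_h kN)) (idx_def (ltW t1) t2).
- by apply: abs_cont_smooth; [exact: ler_h|exact: dcellE|exact: continuous_dcell].
Qed.

Let ac_const b : N%:R * h <= b -> b <= 2 * tau -> abs_cont resonant_speed gl 0 b.
Proof.
have N0 : 0 <= N%:R * h by rewrite mulr_ge0// ltW.
move=> Nb b2; apply: (abs_cont_cat N0 Nb _ (ac_cells (leqnn N))).
  by apply: cl_cont => //; rewrite (le_trans b2)// ltW.
apply: (@abs_cont_eq _ (cst cb) _ (cst 0)) => //.
- move=> t; rewrite in_itv/= => /andP[t1 t2].
  by rewrite resonant_speed_out// base_cb// (le_trans t2).
- move=> t; rewrite in_itv/= => /andP[t1 t2].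
  by rewrite /gl ltNge (ltW t1)/= (lt_le_trans t2 b2).
- by apply: abs_cont_smooth => //; exact: cst_continuous.
Qed.

Let N2 : N%:R * h <= 2 * tau. Proof. exact: le_trans Ntau _. Qed.

Lemma resonant_speed_abs_cont b : 2 * tau <= b -> b < T0 -> abs_cont resonant_speed gl 0 b.
Proof.
move=> b2 bT; apply: (abs_cont_cat (ltW sig0) b2 _ (ac_const N2 (lexx _))).
  by apply: cl_cont => //; exact: ltW.
apply: (abs_cont_eq b2 _ _ (base_speed_abs_cont eta cPS sig0 W b2 bT)).
- move=> t; rewrite in_itv/= => /andP[t1 _].
  by rewrite resonant_speed_out// (le_trans N2).
- move=> t; rewrite in_itv/= => /andP[t1 _].
  by rewrite /gl ltNge (le_trans N2 (ltW t1))/= ltNge (ltW t1).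
Qed.

Lemma resonant_speed_PS : PS T0 mu1 mu2 omega theta resonant_speed.
Proof.
have [_ [mg _] _] := W.
apply: (@PS_intro _ T0 mu1 mu2 omega theta mu1_gt0 om theta_nd (2 * tau) resonant_speed gl) => //.
- exact: resonant_speed_bounds.
- exact: resonant_speed_modulus.
- exact: resonant_speed_abs_cont.
- have -> : `]0, T0[%classic = `]0, 2 * tau] `|` `]2 * tau, T0[.
    apply/seteqP; split => t /=; rewrite !in_itv/=.
      by move=> /andP[t0 tT]; have [t2|t2] := leP t (2 * tau); [left|right]; apply/andP.
    case=> /andP[? ?]; apply/andP; split => //; last exact: lt_trans sig0 _.
    exact: le_lt_trans tauT.
  apply/measurable_funU => //; split.
    have [_ igl _] := ac_const N2 (lexx _).
    have /measurable_EFinP := measurable_int mu igl.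
    by apply: measurable_funS => //; apply: subset_itv; rewrite bnd_simp.
  apply: (@eq_measurable_fun _ _ _ _ _ (fun t => (1 - eta) * g t)).
    move=> t /set_mem /=; rewrite in_itv/= => /andP[t2 _].
    by rewrite /gl ltNge (le_trans N2 (ltW t2))/= ltNge (ltW t2).
  apply: measurable_funM => //; apply: measurable_funS mg => //.
  by apply: subset_itv; rewrite bnd_simp// ltW.
apply: filterS gth; first exact: (ae_filter_ringOfSetsType mu).
move=> t gt tT; move: (tT); rewrite in_itv/= => /andP[t0 tT0]; rewrite /gl.
have th0 : 0 < theta t by exact: theta_gt0.
case: ifPn => [tN|_]; last first.
  case: ifPn => _; first by rewrite normr0 ltW.
  rewrite normrM ger0_norm ?subr_ge0 ?(ltW eta1)//.
  apply: (@le_trans _ _ `|g t|); last exact: gt.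
  by rewrite ler_piMl// gerBl ltW.
have kN := idxN tN (ltW t0); have [t1 t2] := idxP (ltW t0).
set k := idx t in kN t1 t2 *.
have ak : amplitude k <= k0 * (theta t / l).
  rewrite /amplitude ler_pM2l// ler_pM2r ?invr_gt0//.
  apply: (@le_trans _ _ (theta (k.+1%:R * h))); first by rewrite /rate ge_min lexx orbT.
  by apply: theta_nd => //; [exact: cell_time|exact: ltW].
rewrite /dcell normrM gtr0_norm// normrM (gtr0_norm pulsation_gt0).
have hd := dalpha_bound (pulsation * (t - k%:R * h)) (amplitude_ge0 kN) (amplitude_le1 kN).
apply: (@le_trans _ _ (cb * (24 * (k0 * (theta t / l)) * pulsation))).
  rewrite ler_pM2l// ler_pM2r ?pulsation_gt0// (le_trans hd)//.
  by rewrite ler_wpM2l.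
rewrite (_ : cb * _ = 24 * (cb * Num.sqrt cb) * k0 * theta t); last first.
  by rewrite /pulsation; field; rewrite gt_eqF.
apply: (@le_trans _ _ (2^-1 * theta t)); first by rewrite ler_wpM2r ?(ltW th0)// k0_cb.2.
by rewrite ler_piMl ?(ltW th0)// invf_le1// ler1n.
Qed.

(** At each cell boundary y vanishes again, so the next cell starts from a multiple of the same
    profile, and [solves_unique] identifies the solution with it. Each cell multiplies |z| by exp
    (pi amplitude k). *)
Lemma resonant_growth y z (k : nat) :
  solves 0 T0 (fun t => l ^+ 2 * resonant_speed t) y z -> y 0 = 0 -> z 0 = 1 ->
  (k <= N)%N ->
  y (k%:R * h) = 0 /\ `|z (k%:R * h)| = expR (pi * \sum_(i < k) amplitude i).
Proof.
move=> sol y0 z0; elim: k => [_|k IHk kN].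
  by rewrite mul0r big_ord0 mulr0 expR0 z0 normr1.
have [yk zk] := IHk (ltnW kN).
have k_ge0 : 0 <= k%:R * h by rewrite mulr_ge0// ltW.
have kT : k.+1%:R * h <= T0 by have := cell_time kN; rewrite in_itv/= => /andP[_ /ltW].
have kk : k%:R * h <= k.+1%:R * h by exact: ler_h.
have hE : k%:R * h + pi / pulsation = k.+1%:R * h.
  by rewrite -[_ / _]/h -natr1 mulrDl mul1r.
have s1 := solvesS k_ge0 kT sol.
have := @solves_resonant R cb l (amplitude k) (k%:R * h) (z (k%:R * h)) cb_gt0 l_gt0.
rewrite -/pulsation /= hE => s2.
have {}s2 := solves_eq_coef (k' := fun t => l ^+ 2 * resonant_speed t) _ s2.
have {}s2 := s2 ltac:(by move=> t; rewrite in_itv/= => /andP[/ltW t1 /ltW t2];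
  rewrite (resonant_speed_cell kN t1 t2)).
have L0 : 0 <= l ^+ 2 * mu2 by rewrite mulr_ge0 ?sqr_ge0// ltW.
have kL t : t \in `]k%:R * h, k.+1%:R * h[ -> `|l ^+ 2 * resonant_speed t| <= l ^+ 2 * mu2.
  rewrite in_itv/= => /andP[t1 t2]; rewrite normrM ger0_norm ?sqr_ge0//.
  have tT : t \in `[0, T0].
    by rewrite in_itv/= (le_trans k_ge0 (ltW t1)) (le_trans (ltW t2)).
  have /andP[b1 b2] := resonant_speed_bounds tT.
  by rewrite ler_wpM2l ?sqr_ge0// ger0_norm// (le_trans (ltW mu1_gt0)).
have kend : k.+1%:R * h \in `[k%:R * h, k.+1%:R * h] by rewrite in_itv/= lexx kk.
have [||yE zE] := solves_unique kk L0 kL s1 s2 _ _ kend.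
- by rewrite subrr mulr0 resonant0 mulr0 yk.
- by rewrite subrr mulr0 dresonant0 mulr1.
rewrite phase_end resonantpi mulr0 in yE; rewrite phase_end dresonantpi in zE.
split=> //; rewrite zE normrM zk normrN gtr0_norm ?expR_gt0// -expRD; congr expR.
by rewrite big_ord_recr/=; ring.
Qed.

Let rate_nd s t : s \in `]0, T0[ -> t \in `]0, T0[ -> s <= t ->
  rate omega theta l t <= rate omega theta l s.
Proof.
move=> sT tT st; rewrite /rate le_min ge_min lexx/= ge_min.
by rewrite (theta_nd sT tT st) orbT.
Qed.

Variable G : R -> R.
Hypotheses (cG : {within `[0, T0], continuous G})
  (dG : forall t, t \in `]0, T0[ -> is_derive t 1 G (rate omega theta l t)).

Let G_increment s t B : 0 <= s -> s <= t -> t <= T0 ->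
  (forall u, s < u -> u < t -> rate omega theta l u <= B) -> G t - G s <= B * (t - s).
Proof.
move=> s0 st tT rB; move: st; rewrite le_eqVlt => /predU1P[->|st].
  by rewrite !subrr mulr0.
have dG' u : u \in `]s, t[ -> is_derive u 1 G (rate omega theta l u).
  rewrite in_itv/= => /andP[su ut]; apply: dG.
  by rewrite in_itv/= (le_lt_trans s0)// (lt_le_trans ut).
have cG' : {within `[s, t], continuous G}.
  by apply: (continuous_subspaceW _ cG); apply: subset_itv; rewrite bnd_simp.
have [u + ->] := MVT st dG' cG'; rewrite in_itv/= => /andP[su ut].
by rewrite ler_wpM2r ?subr_ge0 ?(ltW st)// rB.
Qed.

Let N1T : N.+1%:R * h <= 2 * tau.
Proof.
rewrite -natr1 mulrDl mul1r; have := Ntau; move: h_tau; rewrite -/h.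
by set X := _ * h; move: tau0; lra.
Qed.

(** Since pulsation times h is pi, pi amplitude k is k0 sqrt cb times the area of the rectangle of
    height rate ((k + 1) h) and width h. The rate is nonincreasing, so this area bounds its integral
    over the next cell; the shift leaves the first cell out. *)
Lemma amplitude_sum_ge :
  k0 * Num.sqrt cb * (G (N.+1%:R * h) - G h) <= pi * \sum_(i < N) amplitude i.
Proof.
suff H (k : nat) : (k <= N)%N ->
    k0 * Num.sqrt cb * (G (k.+1%:R * h) - G h) <= pi * \sum_(i < k) amplitude i.
  exact: H.
elim: k => [_|k IHk kN]; first by rewrite mul1r subrr big_ord0 !mulr0.
have {}IHk := IHk (ltnW kN); rewrite big_ord_recr/= [leRHS]mulrDr.
have -> : G (k.+2%:R * h) - G h =
    (G (k.+1%:R * h) - G h) + (G (k.+2%:R * h) - G (k.+1%:R * h)) by ring.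
rewrite mulrDr; apply: lerD => //.
have k2T : k.+2%:R * h < T0.
  by rewrite (le_lt_trans _ tauT)// (le_trans _ N1T)// ler_h.
have k1T := cell_time kN.
have kk : k.+1%:R * h <= k.+2%:R * h by exact: ler_h.
have k10 : 0 <= k.+1%:R * h by rewrite mulr_ge0// ltW.
have inc : G (k.+2%:R * h) - G (k.+1%:R * h) <=
    rate omega theta l (k.+1%:R * h) * (k.+2%:R * h - k.+1%:R * h).
  apply: G_increment => //; first exact: ltW.
  move=> u ku uk; apply: rate_nd => //; last exact: ltW.
  by rewrite in_itv/= (le_lt_trans k10)// (lt_trans uk).
have hE : k.+2%:R * h - k.+1%:R * h = h by rewrite -mulrBl -natrB// subSnn mul1r.
rewrite hE in inc.
have C0 : 0 <= k0 * Num.sqrt cb by rewrite mulr_ge0 ?sqrtr_ge0// ltW.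
rewrite (le_trans (ler_wpM2l C0 inc))// le_eqVlt; apply/orP; left; apply/eqP.
rewrite /amplitude {2}/h /half_period -/pulsation /pulsation -/cb.
by field; rewrite gt_eqF//= gt_eqF// sqrtr_gt0.
Qed.

(** Growth up to N h comes from [resonant_growth], and the backward half of [energy_estimate]
    carries it from N h to t. Three quantities are lost, none depending on l: the first cell holds
    at most pi / sqrt mu1 of the integral of the rate, the times after (N + 1) h > tau at most theta
    tau times T0, and the passage from N h > tau / 2 to t costs a factor exp (C theta (tau / 2)
    T0). *)
Lemma resonant_speed_energy y z t :
  PS T0 mu1 mu2 omega theta resonant_speed -> G T0 - G 0 = loss T0 omega theta l ->
  solves 0 T0 (fun t => l ^+ 2 * resonant_speed t) y z -> y 0 = 0 -> z 0 = 1 ->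
  tau <= t -> t <= T0 ->
  expR (2 * (k0 * Num.sqrt mu1) *
      (loss T0 omega theta l - (pi / Num.sqrt mu1 + theta tau * T0))) <=
    (1 + mu2) * (1 + mu1^-1) * (z t ^+ 2 + l ^+ 2 * y t ^+ 2) *
    expR ((1 + 2 * mu1^-1) * (theta (tau / 2) * T0)).
Proof.
move=> clPS GE sol y0 z0 taut tT.
have [yN zN] := resonant_growth sol y0 z0 (leqnn N).
have N0 : 0 <= N%:R * h by rewrite mulr_ge0// ltW.
have Nt : N%:R * h <= t by exact: le_trans taut.
have [_] := energy_estimate T0_gt0 mu1_gt0 mu12 om theta_gt0 theta_nd clPS l_gt0
  cG dG sol N0 Nt tT.
rewrite yN expr0n /= mulr0 addr0 => E1.
have tau2N : tau / 2 < N%:R * h.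
  have := cell_count_itv.2; rewrite -natr1 mulrDl mul1r; move: h_tau; rewrite -/h -/N.
  by set X := N%:R * h; lra.
have th (u v : R) : 0 < u -> u < v -> v < T0 -> rate omega theta l v <= theta u.
  move=> u0 uv vT; apply: (@le_trans _ _ (theta v)); first by rewrite /rate ge_min lexx orbT.
  apply: theta_nd; rewrite ?in_itv/= ?(lt_trans u0 uv) ?u0 ?(lt_trans uv vT)//.
  exact: ltW.
have th20 : 0 <= theta (tau / 2).
  rewrite ltW// theta_gt0// in_itv/= divr_gt0//=.
  by move: tau0 tauT; lra.
have tauT' : tau \in `]0, T0[ by rewrite in_itv/= tau0 (le_lt_trans tau2).
have th0 : 0 <= theta tau by rewrite ltW// theta_gt0.
have i1 : G t - G (N%:R * h) <= theta (tau / 2) * T0.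
  apply: (@le_trans _ _ (theta (tau / 2) * (t - N%:R * h))).
    apply: G_increment => // u u1 u2; apply: th => //.
    - by rewrite divr_gt0.
    - exact: lt_trans u1.
    - exact: lt_le_trans tT.
  by rewrite ler_wpM2l// lerBlDr (le_trans tT)// lerDl.
have C0 : 0 <= 1 + 2 * mu1^-1 by rewrite addr_ge0// mulr_ge0// invr_ge0 ltW.
have E2 : z (N%:R * h) ^+ 2 <= (1 + mu2) * (1 + mu1^-1) * (z t ^+ 2 + l ^+ 2 * y t ^+ 2) *
    expR ((1 + 2 * mu1^-1) * (theta (tau / 2) * T0)).
  have m1 : 0 <= 1 + mu2 by rewrite addr_ge0// ltW.
  have m2 : 0 <= 1 + mu1^-1 by rewrite addr_ge0// invr_ge0 ltW.
  have e0 : 0 <= z t ^+ 2 + l ^+ 2 * y t ^+ 2.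
    by rewrite addr_ge0 ?sqr_ge0// mulr_ge0 ?sqr_ge0.
  apply: (le_trans E1); rewrite ler_wpM2l//; first by rewrite mulr_ge0// mulr_ge0.
  by rewrite ler_expR ler_wpM2l.
apply: le_trans E2; rewrite -[z _ ^+ 2]real_normK ?num_real// zN expr2 -expRD ler_expR.
set S := pi * \sum_(i < N) amplitude i; have SE : k0 * Num.sqrt cb * (G (N.+1%:R * h) - G h) <= S.
  exact: amplitude_sum_ge.
have h_le2 : h <= 2 * tau by move: h_tau tau0; rewrite -/h; lra.
have hT : h <= T0 by rewrite (le_trans h_le2)// ltW.
have scb : Num.sqrt mu1 <= Num.sqrt cb.
  by rewrite ler_sqrt ?(ltW cb_gt0)//; case/andP: base_speed0_itv.
have sm0 : 0 < Num.sqrt mu1 by rewrite sqrtr_gt0.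
have i2 : G h - G 0 <= pi / Num.sqrt mu1.
  apply: (@le_trans _ _ (l * omega l^-1 * (h - 0))).
    by apply: G_increment => //; [exact: ltW|move=> u _ _; rewrite /rate ge_min lexx].
  rewrite subr0 /h /half_period -/pulsation /pulsation -/cb.
  have sc0 : 0 < Num.sqrt cb by rewrite sqrtr_gt0.
  rewrite (_ : _ * _ = omega l^-1 * (pi / Num.sqrt cb)); last first.
    by field; rewrite gt_eqF//= gt_eqF.
  apply: (@le_trans _ _ (1 * (pi / Num.sqrt cb))).
    by rewrite ler_wpM2r// divr_ge0 ?pi_ge0// ltW.
  by rewrite mul1r ler_wpM2l ?pi_ge0// lef_pV2 ?posrE.
have i3 : G T0 - G (N.+1%:R * h) <= theta tau * T0.
  have N1 : N.+1%:R * h <= T0 by rewrite (le_trans N1T)// ltW.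
  apply: (@le_trans _ _ (theta tau * (T0 - N.+1%:R * h))).
    apply: G_increment => //; first by rewrite mulr_ge0// ltW.
    move=> u u1 u2; apply: th => //.
    exact: lt_trans cell_count_itv.2 u1.
  by rewrite ler_wpM2l// gerBl mulr_ge0// ltW.
have mono : G h <= G (N.+1%:R * h).
  apply: (primitive_rate_mono om theta_gt0 l_gt0 cG dG (ltW h0)).
    by rewrite -[leLHS]mul1r ler_wpM2r ?(ltW h0)// ler1n.
  by rewrite (le_trans N1T)// ltW.
have X0 : loss T0 omega theta l - (pi / Num.sqrt mu1 + theta tau * T0) <=
    G (N.+1%:R * h) - G h by rewrite -GE; lra.
have X1 : k0 * Num.sqrt mu1 * (G (N.+1%:R * h) - G h) <= S.
  apply: le_trans SE; rewrite ler_wpM2r ?subr_ge0//.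
  by rewrite ler_wpM2l// ltW.
have X2 : k0 * Num.sqrt mu1 * (loss T0 omega theta l - (pi / Num.sqrt mu1 + theta tau * T0)) <= S.
  by apply: le_trans X1; rewrite ler_wpM2l//; apply: mulr_ge0; exact: ltW.
by rewrite -mulrA; move: X2; set X := k0 * _ * _; lra.
Qed.

End resonant_speed.

Section activators.
Context {R : realType}.
Variables (T0 mu1 mu2 : R) (omega theta : R -> R).
Hypotheses (T0_gt0 : 0 < T0) (mu1_gt0 : 0 < mu1) (mu12 : mu1 < mu2)
  (om : is_modulus omega) (theta_gt0 : {in `]0, T0[, forall t, 0 < theta t})
  (theta_cont : {in `]0, T0[, continuous theta})
  (theta_nd : {in `]0, T0[ &, forall s t, s <= t -> theta t <= theta s}).

Lemma modulus_small (e : R) : 0 < e ->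
  exists2 d, 0 < d & forall s, 0 < s -> s < d -> omega s <= e.
Proof.
move=> e0; have /cvgrPdist_le/(_ e e0) := modulus_cvg0 om; rewrite near_withinE.
move=> /nbhs_ballP[d /= d0 dP]; exists d => // s s0 sd.
have := dP s; rewrite /ball /= sub0r normrN gtr0_norm// => /(_ sd s0).
by rewrite sub0r normrN; apply: le_trans; exact: ler_norm.
Qed.

(** The factor 2 turns the growth of |z| into that of its square. *)
Definition activation_rate := 2 * (resonance_strength mu2 * Num.sqrt mu1).

Lemma activation_rate_gt0 : 0 < activation_rate.
Proof.
rewrite mulr_gt0// mulr_gt0 ?sqrtr_gt0//.
by rewrite invr_gt0 mulr_gt0// exprn_gt0// addr_gt0// (lt_trans mu1_gt0).
Qed.

(** A is fixed before l: it depends on the distance r and on the time t0 but not on the frequency,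
    so the exponential decides for large l. *)
Lemma activator c (r t0 : R) : PS T0 mu1 mu2 omega theta c -> 0 < r -> 0 < t0 ->
  exists2 A, 0 < A & exists L0, forall l, L0 <= l ->
    exists c', [/\ PS T0 mu1 mu2 omega theta c',
      forall t, t \in `[0, T0] -> `|c' t - c t| <= r
    & forall y z, solves 0 T0 (fun t => l ^+ 2 * c' t) y z -> y 0 = 0 -> z 0 = 1 ->
      forall t, t0 <= t -> t <= T0 ->
      A * expR (activation_rate * loss T0 omega theta l) <= z t ^+ 2 + l ^+ 2 * y t ^+ 2].
Proof.
move=> cPS r0 t00.
have dmu : 0 < mu2 - mu1 by rewrite subr_gt0.
have mu20 : 0 < mu2 by exact: lt_trans mu12.
have r3 : 0 < r / 3 by rewrite divr_gt0.
(* The distance r is spent in thirds on the three terms of [resonant_speed_close]. *)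
pose eta := Num.min 2^-1 (r / 3 / (mu2 - mu1)).
have eta0 : 0 < eta by rewrite lt_min invr_gt0 ltr0n /= divr_gt0.
have eta1 : eta < 1 by rewrite gt_min invf_lt1 ?ltr1n.
have etar : eta * (mu2 - mu1) <= r / 3 by rewrite -ler_pdivlMr// /eta ge_min lexx orbT.
have [d d0 dP] := modulus_small r3.
(* tau <= t0 makes the growth visible from t0 on, T0 / 4 leaves room for 2 tau, and d / 4 gives
   omega (2 tau) <= r / 3. *)
pose tau := Num.min t0 (Num.min (T0 / 4) (d / 4)).
have tau0 : 0 < tau by rewrite !lt_min t00 !divr_gt0.
have taut0 : tau <= t0 by rewrite /tau ge_min lexx.
have tauT4 : tau <= T0 / 4 by rewrite /tau !ge_min lexx orbT.
have taud : tau <= d / 4 by rewrite /tau !ge_min lexx !orbT.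
have tauT : 2 * tau < T0 by move: tauT4 T0_gt0; lra.
have om2 : omega (2 * tau) <= r / 3 by apply: dP; move: taud d0 tau0; lra.
have omt : 0 < omega tau by exact: (modulus_gt0 om).
(* The four entries stand for [om1], the last third of r, [om_eta] and [om_tau]. *)
pose e := Num.min (Num.min 1 (r / 3))
  (Num.min (4 * (eta * ((mu2 - mu1) / 2))) (4 * (eta * omega tau))).
have e0 : 0 < e.
  by rewrite !lt_min ltr01 r3 /= !mulr_gt0.
have [d' d'0 d'P] := modulus_small e0.
have sm0 : 0 < Num.sqrt mu1 by rewrite sqrtr_gt0.
(* The second entry makes 1 / l smaller than d', the third makes the half period at most tau / 2. *)
pose L0 := Num.max 1 (Num.max (2 / d') (2 * pi / (Num.sqrt mu1 * tau))).
pose Q := (1 + mu2) * (1 + mu1^-1) * expR ((1 + 2 * mu1^-1) * (theta (tau / 2) * T0)).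
have Q0 : 0 < Q.
  by rewrite mulr_gt0 ?expR_gt0// mulr_gt0// addr_gt0// invr_gt0.
pose B := pi / Num.sqrt mu1 + theta tau * T0.
exists (expR (- (activation_rate * B)) / Q); first by rewrite divr_gt0 ?expR_gt0.
exists L0 => l; rewrite /L0 !ge_max => /and3P[l1 l2 l3].
have l0 : 0 < l by exact: lt_le_trans l1.
have li0 : 0 < l^-1 by rewrite invr_gt0.
have ome : omega l^-1 <= e.
  apply: d'P => //; rewrite -(invrK d') ltf_pV2 ?posrE ?invr_gt0//.
  by rewrite (lt_le_trans _ l2)// ltr_pMl ?invr_gt0// ltr1n.
move: (ome); rewrite /e !le_min => /andP[/andP[e1 e2] /andP[e3 e4]].
have [g W gth] := PS_derivative cPS.
have o1 : omega l^-1 / 4 <= eta * ((mu2 - mu1) / 2) by rewrite ler_pdivrMr// mulrC.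
have o2 : omega l^-1 / 4 <= eta * omega tau by rewrite ler_pdivrMr// mulrC.
have /andP[cb1 cb2] := base_speed0_itv T0_gt0 mu12 cPS eta0 eta1 tauT.
have htau : half_period mu1 mu2 c eta tau l <= tau / 2.
  rewrite /half_period /pulsation; set cb := base_speed _ _ _ _ _ _ in cb1 cb2 *.
  have cb0 : 0 < cb by exact: lt_le_trans cb1.
  have scb : Num.sqrt mu1 <= Num.sqrt cb by rewrite ler_sqrt// ltW.
  have sc0 : 0 < Num.sqrt cb by rewrite sqrtr_gt0.
  rewrite ler_pdivrMr ?mulr_gt0//.
  move: l3; rewrite ler_pdivrMr ?mulr_gt0// => l3.
  have : l * (Num.sqrt mu1 * tau) <= l * (Num.sqrt cb * tau).
    by rewrite ler_pM2l// ler_pM2r.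
  by move: l3; set X := l * _; set Y := l * _ => h1 h2; rewrite (_ : tau / 2 * _ = Y / 2); [lra|rewrite /Y; field].
have c'PS := resonant_speed_PS T0_gt0 mu1_gt0 mu12 om theta_gt0 theta_nd cPS eta0
  eta1 tau0 tauT l0 e1 o1 o2 W gth.
exists (resonant_speed mu1 mu2 omega theta c eta tau l); split=> //.
  move=> t tT.
  have := resonant_speed_close T0_gt0 mu1_gt0 mu12 om theta_gt0 cPS eta0 eta1
    tau0 tauT l0 e1 tT.
  move/le_trans; apply; have o0 : 0 <= omega l^-1 by rewrite (modulus_ge0 om)// ltW.
  by move: o0 e2 om2 etar; lra.
move=> y z sol y0 z0 t t0t tT.
have [G [cG dG GE]] := loss_rate_integral T0_gt0 om theta_gt0 theta_cont theta_nd l0.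
have := resonant_speed_energy T0_gt0 mu1_gt0 mu12 om theta_gt0 theta_nd cPS eta0 eta1 tau0
  tauT l0 htau e1 o1 cG dG c'PS GE sol y0 z0 (le_trans taut0 t0t) tT.
rewrite -/B -/activation_rate => h.
rewrite mulrAC ler_pdivrMr// -expRD /Q.
rewrite (_ : - (activation_rate * B) + _ = activation_rate * (loss T0 omega theta l - B)); last by ring.
apply: (le_trans h); rewrite le_eqVlt; apply/orP; left; apply/eqP; ring.
Qed.

End activators.

(** * Residual sets of amplifying speeds *)

Section spectrum.
Context d (M : measurableType d) (R : realType) (mu : {measure set M -> \bar R})
  (lam : M -> R).
Hypotheses (mlam : measurable_fun [set: M] lam) (lam_ge0 : forall xi, 0 <= lam xi).

(** The essential range of lam, tested on sets of finite measure: these carry square integrable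
    data, while atoms of infinite measure are invisible to L^2. *)
Definition in_spectrum l := forall r : R, 0 < r ->
  exists B : set M, [/\ measurable B, (0 < mu B)%E, (mu B < +oo)%E
    & forall xi, B xi -> `|lam xi - l| < r].

Let measurable_gt (f : M -> R) (a : R) : measurable_fun [set: M] f ->
  measurable [set xi | a < f xi].
Proof.
move=> mf; rewrite (_ : [set _ | _] = [set: M] `&` f @^-1` `]a, +oo[); first exact: mf.
by rewrite setTI; apply/seteqP; split => xi /=; rewrite in_itv/= andbT.
Qed.

Let measurable_ge (f : M -> R) (a : R) : measurable_fun [set: M] f ->
  measurable [set xi | a <= f xi].
Proof.
move=> mf; rewrite (_ : [set _ | _] = [set: M] `&` f @^-1` `[a, +oo[); first exact: mf.
by rewrite setTI; apply/seteqP; split => xi /=; rewrite in_itv/= andbT.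
Qed.

Let measurable_lt (f : M -> R) (a : R) : measurable_fun [set: M] f ->
  measurable [set xi | f xi < a].
Proof.
move=> mf; rewrite (_ : [set _ | _] = [set: M] `&` f @^-1` `]-oo, a[); first exact: mf.
by rewrite setTI; apply/seteqP; split => xi /=; rewrite in_itv.
Qed.

(** The measure may fail to be sigma-finite, but by Markov's inequality each set where f ^ 2 >= 1 /
    (k + 1) has finite measure, and these sets exhaust the support of f. *)
Lemma L2_eq0_ae (K : R) (f : M -> R) :
  (forall B, measurable B -> (mu B < +oo)%E -> (forall xi, B xi -> K < lam xi) ->
    mu B = 0) ->
  f \in Lfun mu 2%:E -> {ae mu, forall xi, K < lam xi -> f xi = 0}.
Proof.
move=> B0 /Lfun2P[mf fi].
pose S (k : nat) := [set xi | K < lam xi] `&` [set xi | k.+1%:R^-1 <= f xi ^+ 2].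
have mf2 : measurable_fun [set: M] (fun xi => f xi ^+ 2) by exact: measurable_funX.
have mS k : measurable (S k).
  by apply: measurableI; [exact: measurable_gt|exact: measurable_ge].
have S0 k : mu.-negligible (S k).
  apply/negligibleP => //; apply: B0 => //; last by move=> xi [].
  have a0 : 0 < k.+1%:R^-1 :> R by rewrite invr_gt0.
  have me : measurable_fun [set: M] (fun xi => (f xi ^+ 2)%:E) by exact/measurable_EFinP.
  have := le_integral_abse mu measurableT me a0.
  under eq_integral do rewrite gee0_abs ?lee_fin ?sqr_ge0//.
  set T := setT `&` _ => h.
  have ST : (mu (S k) <= mu T)%E.
    rewrite le_measure ?inE//.
      apply: measurableI => //.
      have -> : [set x | (k.+1%:R^-1%:E <= `|(f x ^+ 2)%:E|)%E] =
          [set x | k.+1%:R^-1 <= f x ^+ 2].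
        by apply/seteqP; split=> x /=; rewrite ger0_norm ?sqr_ge0.
      exact: measurable_ge.
    by move=> xi [_ /= h']; split => //=; rewrite ger0_norm ?sqr_ge0.
  apply: (le_lt_trans ST); rewrite ltNge leye_eq; apply/negP => /eqP TE.
  by move: h; rewrite TE gt0_muley ?lte_fin// leye_eq => /eqP hE; rewrite hE in fi.
apply: negligibleS (negligible_bigcup S0) => xi /= /not_implyP[Kxi /eqP fxi].
have f2 : 0 < f xi ^+ 2 by rewrite lt_neqAle eq_sym sqrf_eq0 fxi sqr_ge0.
exists (Num.truncn (f xi ^+ 2)^-1) => //; split => //=.
rewrite -[leRHS]invrK lef_pV2 ?posrE ?invr_gt0//.
by apply/ltW; exact: truncnS_gt.
Qed.

(** Otherwise the value of lam at each point of B lies in a rational interval whose preimage in B is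
    null, and countably many null sets cover B. *)
Lemma in_spectrum_ge (K : R) (B : set M) : measurable B -> (0 < mu B)%E -> (mu B < +oo)%E ->
  (forall xi, B xi -> K < lam xi) -> exists2 l, K < l & in_spectrum l.
Proof.
move=> mB B0 Boo BK; apply: contrapT => noS.
pose F (p : rat * rat) := B `&` [set xi | ratr p.1 < lam xi] `&` [set xi | lam xi < ratr p.2].
pose G n := if unpickle n is Some p then
  (if `[< mu (F p) = 0 >] then F p else set0) else set0.
have mF p : measurable (F p).
  by apply: measurableI; [apply: measurableI => //; exact: measurable_gt|exact: measurable_lt].
have G0 n : mu.-negligible (G n).
  rewrite /G; case: unpickle => [p|]; last exact: negligible_set0.
  case: asboolP => [p0|_]; last exact: negligible_set0.
  exact/negligibleP.
have : mu.-negligible B.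
  apply: negligibleS (negligible_bigcup G0) => xi Bxi.
  have nspec : ~ in_spectrum (lam xi).
    by move=> sp; apply: noS; exists (lam xi) => //; exact: BK.
  have [r [r0 rP]] : exists r, 0 < r /\ forall C, measurable C -> (mu C < +oo)%E ->
      (forall x, C x -> `|lam x - lam xi| < r) -> mu C = 0.
    apply: contrapT => nr; apply: nspec => r r0; apply: contrapT => nC; apply: nr.
    exists r; split=> // C mC Coo Cr; apply/eqP; rewrite eq_le measure_ge0 andbT leNgt.
    by apply/negP => C0; apply: nC; exists C.
  have [|p] := @rat_in_itvoo R (lam xi - r) (lam xi); first by rewrite gtrBl.
  rewrite in_itv/= => /andP[p1 p2].
  have [|q] := @rat_in_itvoo R (lam xi) (lam xi + r); first by rewrite ltrDl.
  rewrite in_itv/= => /andP[q1 q2].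
  move: (pickle (p, q)) (pickleK (p, q)) => n nE.
  exists n; first exact: I.
  rewrite /G nE.
  have F0 : mu (F (p, q)) = 0.
    apply: rP => //.
      apply: le_lt_trans Boo; rewrite le_measure ?inE//.
      by move=> x [[]].
    move=> x [[_ /= px] /= xq]; rewrite ltr_norml; apply/andP; split.
      by rewrite ltrBrDl (lt_trans p1).
    by rewrite ltrBlDl (lt_trans xq).
  by case: asboolP => // _; split => //; split.
by move=> /(measure_negligible mB) B00; rewrite B00 ltxx in B0.
Qed.

(** If no set of positive finite measure lies in the region lam > K, every U v vanishes there almost
    everywhere, and A is bounded by K ^ 2. *)
Lemma unbounded_spectrum (H : completeNormedModType R) (D : set H) (A : H -> H)
    (U : H -> M -> R) :
  spectral_representation D A mu lam U -> unbounded_operator D A ->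
  forall K : R, exists2 l, K < l & in_spectrum l.
Proof.
move=> [_ _ UL2 _ Uiso _ Udom Uop] unb K0.
pose K := `|K0|; have KK : K0 <= K by exact: ler_norm.
have K0' : 0 <= K by exact: normr_ge0.
suff [B [mB B0 Boo BK]] : exists B, [/\ measurable B, (0 < mu B)%E, (mu B < +oo)%E &
    forall xi, B xi -> K < lam xi].
  have [l Kl sl] := in_spectrum_ge mB B0 Boo BK.
  by exists l => //; exact: le_lt_trans Kl.
apply: contrapT => nB; apply: unb; exists (K ^+ 2) => v Dv.
have B0 B : measurable B -> (mu B < +oo)%E -> (forall xi, B xi -> K < lam xi) -> mu B = 0.
  move=> mB Boo BK; apply/eqP; rewrite eq_le measure_ge0 andbT leNgt.
  by apply/negP => B0; apply: nB; exists B.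
have normE w : (`|w| ^+ 2)%:E = (\int[mu]_x (U w x ^+ 2)%:E)%E.
  have := @powR_Lnorm _ _ _ mu (EFin \o U w) 2; rewrite Uiso pnatr_eq0 => /(_ isT).
  rewrite poweR_EFin powR_mulrn// => ->.
  apply: eq_integral => x _; rewrite /= powR_mulrn//.
  by rewrite real_normK// num_real.
have Uv0 := L2_eq0_ae B0 (UL2 v).
have mU w : measurable_fun [set: M] (U w) by have /Lfun2P[] := UL2 w.
have key : ((`|A v| ^+ 2)%:E <= ((K ^+ 2 * `|v|) ^+ 2)%:E)%E.
  rewrite exprMn (EFinM ((K ^+ 2) ^+ 2)) !normE -ge0_integralZl//; last first.
  - by rewrite lee_fin sqr_ge0.
  - by move=> x _; rewrite lee_fin sqr_ge0.
  - by apply/measurable_EFinP; exact: measurable_funX.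
  apply: ae_ge0_le_integral => //.
  - by move=> x _; rewrite lee_fin sqr_ge0.
  - by apply/measurable_EFinP; exact: measurable_funX.
  - by move=> x _; rewrite mule_ge0// lee_fin sqr_ge0.
  - by apply: measurable_funeM; apply/measurable_EFinP; exact: measurable_funX.
  apply: filterS2 Uv0 (Uop v Dv) => xi h0 hA _.
  rewrite -EFinM lee_fin hA; have [lK|Kl] := leP (lam xi) K.
    rewrite exprMn ler_wpM2r ?sqr_ge0// lerXn2r ?nnegrE ?sqr_ge0//.
    by rewrite lerXn2r ?nnegrE.
  by rewrite h0// mulr0 expr0n/= mulr0.
have KA : 0 <= K ^+ 2 * `|v| by rewrite mulr_ge0 ?sqr_ge0.
by rewrite -ler_sqr ?nnegrE//; rewrite lee_fin in key.
Qed.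

End spectrum.

Section essential_distance.
Context {R : realType}.
Variables (T0 : R) (T0_gt0 : 0 < T0).
Implicit Types (c : R -> R) (e : R).

Let mT := mrestr (@lebesgue_measure R) (measurable_itv `]0, T0[).

Let mT_gt0 : (0 < mT [set: R])%E.
Proof. by rewrite /mT /mrestr setTI lebesgue_measure_itv/= lte_fin T0_gt0 sube0 lte_fin. Qed.

(** A continuous function that exceeds e at a point exceeds it on an interval, which is not null; an
    essential bound is therefore a bound at every point. *)
Lemma Loo_dist_lt c1 c2 e : {within `[0, T0], continuous c1} ->
  {within `[0, T0], continuous c2} -> (Loo_dist T0 c1 c2 < e%:E)%E ->
  forall t, t \in `[0, T0] -> `|c1 t - c2 t| <= e.
Proof.
move=> cc1 cc2; rewrite /Loo_dist unlock /= mT_gt0 => /ltW/ess_supP[N [mN N0 NP]] t tT.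
rewrite leNgt; apply/negP => h.
have cf : {within `[0, T0], continuous (fun t => c1 t - c2 t)}.
  by move=> x; apply: cvgB; [exact: cc1|exact: cc2].
have e2 : 0 < (`|c1 t - c2 t| - e) / 2 by rewrite divr_gt0// subr_gt0.
have [d d0 dP] := within_continuous_eps cf tT e2.
move: (tT); rewrite in_itv/= => /andP[t0 tT'].
(* The interval is cut to ]0, T0[ because t may be an end point. *)
pose a := Num.max 0 (t - d); pose b := Num.min T0 (t + d).
have ab : a < b.
  by rewrite /a /b lt_min !gt_max T0_gt0; apply/andP; split; apply/andP; split => //; lra.
have sub : `]a, b[ `<=` N `&` `]0, T0[.
  move=> s /=; rewrite in_itv/= gt_max lt_min => /andP[/andP[s0 sd] /andP[sT sd']].
  have sT0 : s \in `[0, T0] by rewrite in_itv/= !ltW.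
  split; last by rewrite /= in_itv/= s0.
  apply: NP => /=; apply/negP; rewrite -ltNge lte_fin.
  have : `|s - t| < d by rewrite ltr_norml; apply/andP; split; lra.
  move=> /(dP s sT0) => h2.
  have := lerB_dist (c1 t - c2 t) (c1 s - c2 s); rewrite distrC in h2.
  move: h h2; set u := `|c1 t - c2 t|; set v := `|c1 s - c2 s|; set w := `|_ - _|.
  lra.
have : lebesgue_measure (`]a, b[ : set R) = 0.
  apply/eqP; rewrite eq_le measure_ge0 andbT -[leRHS]N0 /mT /mrestr.
  by rewrite le_measure// inE//; exact: measurableI.
rewrite lebesgue_measure_itv/= lte_fin ab -EFinB => /eqP; rewrite eqe subr_eq0.
by rewrite gt_eqF.
Qed.

Lemma lt_Loo_dist c1 c2 e : 0 < e ->
  (forall t, t \in `[0, T0] -> `|c1 t - c2 t| <= e / 2) ->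
  (Loo_dist T0 c1 c2 < e%:E)%E.
Proof.
move=> e0 h; apply: (@le_lt_trans _ _ (e / 2)%:E); last by rewrite lte_fin; lra.
rewrite /Loo_dist unlock /= mT_gt0; apply/ess_supP.
exists (~` `]0, T0[); split.
- by apply: measurableC; exact: measurable_itv.
- by rewrite /= /mrestr /= setICl measure0.
move=> t /= nt tT; apply: nt.
by rewrite lee_fin h//; exact: subset_itv_oo_cc.
Qed.

End essential_distance.

(** The amplitude |z| + l |y| obeys a triangle inequality, so a perturbation costs an additive term;
    for the energy, which is quadratic, it would not. *)
Lemma amplitude_perturbation {R : realType} (T L l y0 z0 : R) : 0 <= L -> 0 <= l ->
  exists2 C : R, 0 <= C & forall k1 k2 (e : R) y1 z1 y2 z2, 0 <= e ->
    (forall t, t \in `]0, T[ -> `|k1 t| <= L) ->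
    (forall t, t \in `]0, T[ -> `|k2 t| <= L) ->
    (forall t, t \in `]0, T[ -> `|k1 t - k2 t| <= e) ->
    solves 0 T k1 y1 z1 -> solves 0 T k2 y2 z2 ->
    y1 0 = y0 -> z1 0 = z0 -> y2 0 = y0 -> z2 0 = z0 ->
    forall t, t \in `[0, T] ->
      `|z1 t| + l * `|y1 t| <= `|z2 t| + l * `|y2 t| + C * e.
Proof.
move=> L0 l0; have [C C0 HC] := solves_lipschitz T y0 z0 L0.
exists ((1 + l) * C); first by rewrite mulr_ge0// addr_ge0.
move=> k1 k2 e y1 z1 y2 z2 e0 k1L k2L ke s1 s2 a1 b1 a2 b2 t tT.
have [hy hz] := HC _ _ _ _ _ _ _ e0 k1L k2L ke s1 s2 a1 b1 a2 b2 t tT.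
have hy' : `|y1 t| <= `|y2 t| + C * e.
  by rewrite -lerBlDl (le_trans (lerB_dist _ _)).
have hz' : `|z1 t| <= `|z2 t| + C * e.
  by rewrite -lerBlDl (le_trans (lerB_dist _ _)).
have : l * `|y1 t| <= l * (`|y2 t| + C * e) by rewrite ler_wpM2l.
by move: hz'; lra.
Qed.

(** One has 1 + x ^ 2 <= 5 (1 + l ^ 2), and [weight q 2] is the corresponding power of 5. *)
Lemma weight_shift {R : realType} (q l x : R) : 0 <= q -> 0 <= l -> 0 <= x ->
  x <= l + 1 -> weight q x <= weight q 2 * weight q l.
Proof.
move=> q0 l0 x0 xl; have b0 (u : R) : 0 <= 1 + u ^+ 2 by rewrite ltW// weight_base_gt0.
rewrite /weight -exprMn -powRM//.
rewrite lerXn2r ?nnegrE ?powR_ge0// ge0_ler_powR ?nnegrE//.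
- by rewrite mulr_ge0.
have : x ^+ 2 <= (l + 1) ^+ 2 by rewrite lerXn2r ?nnegrE// addr_ge0.
nra.
Qed.

Section amplification.
Context {R : realType}.
Variables (T0 mu1 mu2 : R) (omega theta : R -> R).
Hypotheses (T0_gt0 : 0 < T0) (mu1_gt0 : 0 < mu1) (mu12 : mu1 < mu2)
  (om : is_modulus omega) (theta_gt0 : {in `]0, T0[, forall t, 0 < theta t})
  (theta_cont : {in `]0, T0[, continuous theta})
  (theta_nd : {in `]0, T0[ &, forall s t, s <= t -> theta t <= theta s}).
Context d (M : measurableType d) (mu : {measure set M -> \bar R}) (lam : M -> R).
Hypotheses (lam_ge0 : forall xi, 0 <= lam xi).

Implicit Types (c : R -> R) (q : nat -> R) (B : set M).

Definition amplified c (t0 F l : R) B := forall xi y z, B xi ->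
  solves 0 T0 (fun t => lam xi ^+ 2 * c t) y z -> y 0 = 0 -> z 0 = 1 ->
  forall t, t0 <= t -> t <= T0 -> F <= `|z t| + l * `|y t|.

(* Bounding the weight at the frequency [l + 1] from below makes the bound
   uniform over the frequencies at distance at most 1 from [l]. *)
Definition gain (q : R) n l := 2 ^+ n * (1 + (l + 1) ^+ 2) `^ q.

(** The margin e makes the set open. The initial time 1 / (n + 1) and the factor 2 ^ n of the gain
    let the intersection over n reach every t > 0 and outgrow every constant. *)
Definition amplifying_speeds q (n : nat) : set (R -> R) :=
  [set c | PS T0 mu1 mu2 omega theta c /\
    exists l e B, [/\ 0 <= l /\ 0 < e, measurable B, (0 < mu B < +oo)%E,
      forall xi, B xi -> `|lam xi - l| <= 1
      & amplified c n.+1%:R^-1 (gain (q n) n l + e) l B]].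

Let mu2_gt0 : 0 < mu2. Proof. exact: lt_trans mu12. Qed.

Let coef_le c x K t : PS T0 mu1 mu2 omega theta c -> 0 <= x -> x <= K ->
  t \in `]0, T0[ -> `|x ^+ 2 * c t| <= K ^+ 2 * mu2.
Proof.
move=> cPS x0 xK tT; rewrite normrM ler_pM//.
  by rewrite ger0_norm ?sqr_ge0// lerXn2r ?nnegrE// (le_trans x0).
by apply: (PS_norm_le mu1_gt0 cPS); exact: subset_itv_oo_cc.
Qed.

(** Changing the speed by at most r changes the coefficient by at most (l + 1) ^ 2 r at every
    frequency in B, so half of the margin can be kept with the same l and B. *)
Lemma amplifying_open q n :
  open_in (PS T0 mu1 mu2 omega theta) (Loo_dist T0) (amplifying_speeds q n).
Proof.
split=> [c []//|c [cPS [l [e [B [[l0 e0] mB muB Bl amp]]]]]].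
have l1 : 0 <= l + 1 by rewrite addr_ge0.
pose L := (l + 1) ^+ 2 * mu2.
have L0 : 0 <= L by rewrite mulr_ge0 ?sqr_ge0// ltW.
have [C C0 HC] := amplitude_perturbation T0 0 1 L0 l0.
pose r := e / 2 / (1 + C * (l + 1) ^+ 2).
have D0 : 0 < 1 + C * (l + 1) ^+ 2.
  by rewrite ltr_pwDl// mulr_ge0// sqr_ge0.
have r0 : 0 < r by rewrite !divr_gt0.
exists r => // c' c'PS /(Loo_dist_lt T0_gt0 (PS_continuous cPS) (PS_continuous c'PS)) cc'.
split=> //; exists l, (e / 2), B; split=> //; first by rewrite divr_gt0.
move=> xi y' z' Bxi sol' y'0 z'0 t t0t tT.
have tT0 : t \in `[0, T0].
  by rewrite in_itv/= tT (le_trans _ t0t)// invr_ge0.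
have lxi : lam xi <= l + 1.
  by have := Bl xi Bxi; rewrite ler_norml => /andP[_]; lra.
have [y [z [sol y0 z0]]] := oscillator_exists 0 1 (lam xi) (PS_continuous cPS)
  (fun t => PS_norm_le mu1_gt0 cPS (t:=t)).
have h1 := amp xi y z Bxi sol y0 z0 t t0t tT.
have ce0 : 0 <= (l + 1) ^+ 2 * r by rewrite mulr_ge0 ?sqr_ge0// ltW.
have h2 := HC _ _ ((l + 1) ^+ 2 * r) _ _ _ _ ce0
  (fun u uT => coef_le cPS (lam_ge0 xi) lxi uT)
  (fun u uT => coef_le c'PS (lam_ge0 xi) lxi uT) _ sol sol' y0 z0 y'0 z'0 t tT0.
have {}h2 := h2 _.
have h3 : C * ((l + 1) ^+ 2 * r) <= e / 2.
  rewrite mulrA /r mulrCA ler_piMr//; first by rewrite divr_ge0// ltW.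
  by rewrite ler_pdivrMr// mul1r lerDr.
have : `|z t| + l * `|y t| <= `|z' t| + l * `|y' t| + C * ((l + 1) ^+ 2 * r).
  apply: h2 => u uT; rewrite -mulrBr normrM ler_pM//.
    by rewrite ger0_norm ?sqr_ge0// lerXn2r ?nnegrE.
  by apply: cc'; exact: subset_itv_oo_cc.
by lra.
Qed.

(** The activator resonates at one frequency l of the spectrum. The set B is then taken so close to
    l that replacing l by lam xi lowers the amplitude by at most 1; a further 1 is kept as the
    margin e. *)
Lemma amplifying_dense q n : 0 <= q n ->
  (forall A, exists L0, forall l, L0 <= l -> A * weight (q n) l <=
     expR (activation_rate mu1 mu2 * loss T0 omega theta l)) ->
  (forall K, exists2 l, K < l & in_spectrum mu lam l) ->
  dense_in (PS T0 mu1 mu2 omega theta) (Loo_dist T0) (amplifying_speeds q n).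
Proof.
move=> q0 growth spec c r cPS r0.
have t0 : 0 < n.+1%:R^-1 :> R by rewrite invr_gt0.
have r2 : 0 < r / 2 by rewrite divr_gt0.
have [A A0 [L1 HA]] := activator T0_gt0 mu1_gt0 mu12 om theta_gt0 theta_cont theta_nd
  cPS r2 t0.
(* The 9 comes from (g + 2) ^ 2 <= 9 g ^ 2 for a gain g >= 1, the 4 ^ n from squaring 2 ^ n, and
   [weight (q n) 2] from [weight_shift] at l + 1. *)
have [L2 HL2] := growth (9 * 4 ^+ n * weight (q n) 2 / A).
have [l] := spec (Num.max L1 (Num.max L2 0)).
rewrite !gt_max => /and3P[lL1 lL2 l0] spl.
have [c' [c'PS cc' amp]] := HA l (ltW lL1).
exists c'; split => //; last first.
  by apply: lt_Loo_dist => // t tT; rewrite distrC; exact: cc'.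
split=> //.
have l1 : 0 <= l + 1 by rewrite addr_ge0// ltW.
pose L := (l + 1) ^+ 2 * mu2.
have L0 : 0 <= L by rewrite mulr_ge0 ?sqr_ge0// ltW.
have [C C0 HC] := amplitude_perturbation T0 0 1 L0 (ltW l0).
(* When |lam xi - l| <= s <= 1 the coefficients differ by at most (2 l + 1) s mu2, which changes the
   amplitude by at most D s; s is chosen to make this at most 1. *)
pose D := C * ((2 * l + 1) * mu2).
have D0 : 0 <= D by rewrite !mulr_ge0// ?ltW// addr_gt0// mulr_gt0.
pose s := Num.min 1 (1 + D)^-1.
have s0 : 0 < s by rewrite lt_min ltr01 invr_gt0 ltr_pwDl.
have s1 : s <= 1 by rewrite /s ge_min lexx.
have sD : D * s <= 1.
  have : s <= (1 + D)^-1 by rewrite /s ge_min lexx orbT.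
  move=> /(ler_wpM2l D0)/le_trans; apply.
  by rewrite ler_pdivrMr ?mul1r ?lerDr// ltr_pwDl.
have [B [mB B0 Boo Bs]] := spl s s0.
exists l, 1, B; split=> //; first by rewrite ltW.
- by rewrite B0.
- by move=> xi /Bs/ltW/le_trans; apply.
move=> xi y' z' Bxi sol' y'0 z'0 t t0t tT.
have tT0 : t \in `[0, T0].
  by rewrite in_itv/= tT (le_trans _ t0t)// invr_ge0.
have Bxis := ltW (Bs xi Bxi).
have lxi : lam xi <= l + 1.
  by move: (Bxis); rewrite ler_norml => /andP[_]; lra.
have [y [z [sol y0 z0]]] := oscillator_exists 0 1 l (PS_continuous c'PS)
  (fun t => PS_norm_le mu1_gt0 c'PS (t:=t)).
have h1 := amp y z sol y0 z0 t t0t tT.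
have ll1 : l <= l + 1 by rewrite lerDl.
have ce0 : 0 <= (2 * l + 1) * s * mu2 by rewrite !mulr_ge0// ?ltW// addr_gt0// mulr_gt0.
have h2 := HC _ _ ((2 * l + 1) * s * mu2) _ _ _ _ ce0
  (fun u uT => coef_le c'PS (ltW l0) ll1 uT)
  (fun u uT => coef_le c'PS (lam_ge0 xi) lxi uT) _ sol sol' y0 z0 y'0 z'0 t tT0.
have {}h2 : `|z t| + l * `|y t| <= `|z' t| + l * `|y' t| + C * ((2 * l + 1) * s * mu2).
  apply: h2 => u uT; rewrite -mulrBl normrM ler_pM//; last first.
    by apply: (PS_norm_le mu1_gt0 c'PS); exact: subset_itv_oo_cc.
  rewrite subr_sqr normrM mulrC ler_pM//; last by rewrite distrC.
  by rewrite ger0_norm ?addr_ge0// ?(ltW l0)//; lra.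
have h3 : C * ((2 * l + 1) * s * mu2) <= 1.
  by rewrite (_ : C * _ = D * s)// /D; ring.
suff : gain (q n) n l + 2 <= `|z t| + l * `|y t| by lra.
have g1 : 1 <= gain (q n) n l.
  rewrite /gain mulr_ege1// ?exprn_ege1 ?ler1n//.
  by rewrite -[leLHS](powRr0 (1 + (l + 1) ^+ 2)) ler_powR// lerDl sqr_ge0.
have N0 : 0 <= `|z t| + l * `|y t| by rewrite addr_ge0// mulr_ge0// ltW.
have g0 : 0 <= gain (q n) n l by exact: le_trans g1.
rewrite -ler_sqr ?nnegrE ?(addr_ge0 g0)//.
apply: (@le_trans _ _ (z t ^+ 2 + l ^+ 2 * y t ^+ 2)); last first.
  rewrite -[z t ^+ 2]real_normK ?num_real// -[y t ^+ 2]real_normK ?num_real//.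
  have : 0 <= `|z t| * (l * `|y t|) by rewrite mulr_ge0// mulr_ge0// ltW.
  lra.
apply: le_trans h1; rewrite -ler_pdivrMl// .
apply: le_trans (HL2 l (ltW lL2)).
rewrite [leRHS](_ : _ = A^-1 * (9 * (4 ^+ n * (weight (q n) 2 * weight (q n) l)))); last first.
  by ring.
rewrite ler_pM2l ?invr_gt0//.
apply: (@le_trans _ _ (9 * gain (q n) n l ^+ 2)).
  by move: g1; set g := gain _ _ _; nra.
rewrite ler_pM2l// /gain exprMn -exprM mulnC exprM -(natrX _ 2 2).
rewrite ler_pM2l ?exprn_gt0//.
by apply: weight_shift => //; rewrite ltW.
Qed.

End amplification.

(** u is the sum of the indicators of the sets B n, each scaled to have integral 2 ^ (- n - 1). The
    sets may overlap, which is harmless because the terms are nonnegative and u is bounded below by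
    each of them. *)
Lemma integrable_bumps d (M : measurableType d) (R : realType)
    (mu : {measure set M -> \bar R}) (B : nat -> set M) :
  (forall n, measurable (B n)) -> (forall n, (0 < mu (B n) < +oo)%E) ->
  exists u : M -> R, [/\ measurable_fun [set: M] u, forall x, 0 <= u x,
    (\int[mu]_x (u x)%:E < +oo)%E
    & {ae mu, forall x n, B n x -> (2 ^+ n.+1 * fine (mu (B n)))^-1 <= u x}].
Proof.
move=> mB muB; pose m n := fine (mu (B n)).
have mE n : mu (B n) = (m n)%:E.
  by rewrite fineK// fin_numElt (lt_trans ltNy0); have /andP[] := muB n.
have m0 n : 0 < m n by have /andP[] := muB n; rewrite mE lte_fin.
pose a n := (2 ^+ n.+1 * m n)^-1.
have a0 n : 0 < a n by rewrite invr_gt0 mulr_gt0// exprn_gt0.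
pose h n x : \bar R := (a n * \1_(B n) x)%:E.
have h0 n x : (0 <= h n x)%E by rewrite lee_fin mulr_ge0// ltW.
have mh n : measurable_fun [set: M] (h n).
  by apply/measurable_EFinP; apply: measurable_funM => //; exact: measurable_indic.
pose S x := (\sum_(0 <= n <oo) h n x)%E.
have S0 x : (0 <= S x)%E by exact: nneseries_ge0.
have mS : measurable_fun [set: M] S by exact: ge0_emeasurable_sum.
have hi n : (\int[mu]_x h n x = (1 / (2 ^ n.+1)%:R)%:E)%E.
  under eq_integral do rewrite /h EFinM.
  rewrite ge0_integralZl//; last 2 first.
  - by apply/measurable_EFinP; exact: measurable_indic.
  - by rewrite lee_fin ltW.
  rewrite integral_indic// setIT -/(m n) mE -EFinM; congr (_%:E).
  by rewrite /a natrX invfM mul1r mulfVK// gt_eqF.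
have Si : (\int[mu]_x S x < +oo)%E.
  rewrite integral_nneseries//; under eq_eseriesr do rewrite hi.
  by apply: (le_lt_trans (epsilon_trick0 _ _)); rewrite ?ltry.
have iS : mu.-integrable [set: M] S.
  by apply/integrableP; split => //; under eq_integral do rewrite gee0_abs//.
(* [fine] sends +oo to 0, which would spoil the lower bound; integrability of S confines this to a
   null set. *)
exists (fine \o S); split.
- by apply: (measurableT_comp _ mS); exact: fine_measurable.
- by move=> x; rewrite fine_ge0.
- apply: le_lt_trans Si; apply: ge0_le_integral => //.
  + by move=> x _; rewrite lee_fin fine_ge0.
  + by apply/measurable_EFinP; apply: (measurableT_comp _ mS); exact: fine_measurable.
  + by move=> x _ /=; case: (S x) (S0 x) => //= r; rewrite leey.
apply: filterS (integrable_ae measurableT iS) => x /(_ I) Sx n Bx /=.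
rewrite -/(a n) -lee_fin fineK//; apply: (@le_trans _ _ (h n x)).
  by rewrite /h indicE mem_set// mulr1.
apply: (@le_trans _ _ (\sum_(0 <= i < n.+1) h i x)%E).
  by rewrite big_nat_recr//= leeDr// sume_ge0.
by apply: nneseries_lim_ge.
Qed.

(** * Initial data with loss *)

Section loss.
Context {R : realType}.
Variables (T0 mu1 mu2 : R) (omega theta : R -> R).
Hypotheses (T0_gt0 : 0 < T0) (mu1_gt0 : 0 < mu1) (mu12 : mu1 < mu2).
Context d (M : measurableType d) (mu : {measure set M -> \bar R}) (lam : M -> R).
Hypotheses (mlam : measurable_fun [set: M] lam) (lam_ge0 : forall xi, 0 <= lam xi).

(** [amplified] concerns the data (0, 1), to which division by z 0 reduces. The factor 1/4 is the
    cost of passing from the squared amplitude at l to the energy at lam xi, by l ^ 2 <= 2 (1 + lam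
    xi ^ 2). *)
Lemma amplified_energy (c : R -> R) q n l e B xi y z t :
  0 <= q -> 0 <= l -> 0 <= e -> `|lam xi - l| <= 1 -> B xi ->
  amplified T0 lam c n.+1%:R^-1 (gain q n l + e) l B ->
  solves 0 T0 (fun t => lam xi ^+ 2 * c t) y z -> y 0 = 0 ->
  n.+1%:R^-1 <= t -> t <= T0 ->
  4 ^+ n / 4 * weight q (lam xi) * z 0 ^+ 2 <=
    (1 + lam xi ^+ 2) * y t ^+ 2 + z t ^+ 2.
Proof.
move=> q0 l0 e0 lxi Bxi amp sol y0 tn tT.
have b0 (u : R) : 0 <= 1 + u ^+ 2 by rewrite ltW// weight_base_gt0.
have [z00|z00] := eqVneq (z 0) 0.
  by rewrite z00 expr0n/= mulr0 addr_ge0 ?sqr_ge0// mulr_ge0 ?sqr_ge0.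
pose u := z 0; have u2 : 0 < u ^+ 2 by rewrite lt_neqAle eq_sym sqrf_eq0 z00 sqr_ge0.
pose Y := u^-1 * y t; pose Z := u^-1 * z t.
have yE : y t = u * Y by rewrite /Y mulrA divff// mul1r.
have zE : z t = u * Z by rewrite /Z mulrA divff// mul1r.
have := amp xi _ _ Bxi (solvesZ u^-1 sol); rewrite y0 mulr0 mulVf// => h.
have {}h : gain q n l <= `|Z| + l * `|Y|.
  by apply: le_trans (h erefl erefl t tn tT); rewrite lerDl.
rewrite yE zE -/u [leRHS](_ : _ = ((1 + lam xi ^+ 2) * Y ^+ 2 + Z ^+ 2) * u ^+ 2); last by ring.
rewrite ler_pM2r//.
have g0 : 0 <= gain q n l by rewrite mulr_ge0 ?exprn_ge0// powR_ge0.
have h2 : gain q n l ^+ 2 <= (`|Z| + l * `|Y|) ^+ 2.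
  by rewrite lerXn2r ?nnegrE// addr_ge0// mulr_ge0.
have gE : gain q n l ^+ 2 = 4 ^+ n * weight q (l + 1).
  by rewrite /gain exprMn -exprM mulnC exprM -(natrX _ 2 2).
have wle : weight q (lam xi) <= weight q (l + 1).
  rewrite lerXn2r ?nnegrE ?powR_ge0// ge0_ler_powR ?nnegrE//.
  rewrite lerD2l lerXn2r ?nnegrE ?addr_ge0//.
  by move: lxi; rewrite ler_norml => /andP[_]; lra.
have ll : l ^+ 2 <= 2 * (1 + lam xi ^+ 2).
  move: lxi; rewrite ler_norml => /andP[lx _].
  have : l ^+ 2 <= (1 + lam xi) ^+ 2 by rewrite lerXn2r ?nnegrE ?addr_ge0//; lra.
  have := sqr_ge0 (1 - lam xi); lra.
have h3 : 4 ^+ n * weight q (lam xi) <= (`|Z| + l * `|Y|) ^+ 2.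
  by apply: le_trans h2; rewrite gE ler_pM2l// exprn_gt0.
have h4 : (`|Z| + l * `|Y|) ^+ 2 <= 2 * Z ^+ 2 + 2 * (l ^+ 2 * Y ^+ 2).
  rewrite -[Z ^+ 2]real_normK ?num_real// -[Y ^+ 2]real_normK ?num_real//.
  have := sqr_ge0 (`|Z| - l * `|Y|); lra.
have h5 : l ^+ 2 * Y ^+ 2 <= 2 * (1 + lam xi ^+ 2) * Y ^+ 2.
  by rewrite ler_wpM2r ?sqr_ge0.
have := sqr_ge0 Z; lra.
Qed.

(** A single datum serves all times and all losses delta that q eventually dominates: a constant q
    yields a fixed loss, and a q tending to infinity an infinite one. *)
Lemma amplified_loss (c : R -> R) (q : nat -> R) b : (forall n, 0 <= q n) ->
  (forall n, amplifying_speeds T0 mu1 mu2 omega theta mu lam q n c) ->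
  exists u1, phase_space mu lam b (fun=> 0) u1 /\
    the_solution mu lam T0 c (fun=> 0) u1 (fun y z => forall t delta,
      t \in `]0, T0] -> (exists N, forall n, (N <= n)%N -> delta <= q n) ->
      ~ phase_space mu lam (b - delta) (y t) (z t)).
Proof.
move=> q0 ampc; have cPS : PS T0 mu1 mu2 omega theta c by have [] := ampc 0.
have /choice[l /choice[e /choice[B HB]]] := fun n => (ampc n).2.
have mB n : measurable (B n) by have [] := HB n.
have muB n : (0 < mu (B n) < +oo)%E by have [] := HB n.
have [h [mh h0 hi hB]] := integrable_bumps mB muB.
have W0 r x : 0 < weight r (lam x) by exact: weight_gt0.
have WN r x : weight (- r) (lam x) = (weight r (lam x))^-1.
  apply: (mulfI (lt0r_neq0 (W0 r x))); rewrite divff ?gt_eqF//.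
  by rewrite -weightD subrr /weight powRr0 expr1n.
(* With this choice the density of [phase_energy] at order b for the data (0, u1) is exactly h. *)
pose u1 x := Num.sqrt (h x * weight (- b) (lam x)).
have u1E x : u1 x ^+ 2 = h x / weight b (lam x).
  by rewrite sqr_sqrtr -?WN// mulr_ge0// ltW.
have mu1_ : measurable_fun [set: M] u1.
  apply: measurableT_comp.
    by apply: continuous_measurable_fun; exact: sqrt_continuous.
  by apply: measurable_funM => //; exact: measurable_weight.
exists u1; split.
  apply/(phase_spaceP mu mlam); split=> //.
  apply: le_lt_trans hi; rewrite le_eqVlt; apply/orP; left; apply/eqP.
  apply: eq_integral => x _; rewrite expr0n/= mulr0 add0r u1E mulrC divfK//.
  by rewrite gt_eqF.
split; first exact: (PS_solution_exists T0_gt0 mu1_gt0 mu mlam cPS (measurable_cst _) mu1_).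
move=> y z [myz sol] t delta tT [N Nq] /(phase_spaceP mu mlam)[my mz].
apply/negP; rewrite -leNgt leye_eq; apply/eqP/eqyP => A A0.
move: (tT); rewrite in_itv/= => /andP[t0 tT0].
(* The three entries give delta <= q n, 1 / (n + 1) <= t and 8 A <= 2 ^ n. *)
pose n := maxn N (maxn (Num.truncn t^-1) (Num.truncn (8 * A))).
have nN : (N <= n)%N by rewrite leq_maxl.
have nt : n.+1%:R^-1 <= t.
  rewrite -[leRHS]invrK lef_pV2 ?posrE ?invr_gt0//.
  rewrite (le_trans (ltW (truncnS_gt _)))// ler_nat ltnS.
  by rewrite leq_max; apply/orP; right; exact: leq_maxl.
have nA : 8 * A <= 2 ^+ n.
  rewrite (le_trans (ltW (truncnS_gt _)))//.
  rewrite -natrX ler_nat (leq_trans _ (ltn_expl n (ltnSn 1)))// ltnS.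
  by rewrite leq_max; apply/orP; right; exact: leq_maxr.
have [[l0 e0] mBn muBn Bl amp] := HB n.
pose m := fine (mu (B n)).
have mE : mu (B n) = m%:E.
  by rewrite fineK// fin_numElt (lt_trans ltNy0); have /andP[] := muB n.
have m0 : 0 < m by have /andP[] := muB n; rewrite mE lte_fin.
(* This is 4 ^ n / 4 times the lower bound of h on B n; its integral over B n is 2 ^ n / 8. *)
pose k := 4 ^+ n / 4 * (2 ^+ n.+1 * m)^-1.
have k0 : 0 <= k.
  by rewrite mulr_ge0 ?divr_ge0 ?exprn_ge0// invr_ge0 mulr_ge0 ?exprn_ge0// ltW.
apply: (@le_trans _ _ (\int[mu]_(x in B n) (cst k%:E x))%E).
  rewrite integral_cst// mE -EFinM lee_fin.
  rewrite (_ : k * m = 2 ^+ n / 8); first by rewrite ler_pdivlMr// mulrC.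
  rewrite /k (_ : 4 = 2 * 2 :> R); last by ring.
  rewrite exprMn exprS; field; rewrite gt_eqF//= gt_eqF//= ?exprn_gt0//.
apply: (@le_trans _ _ (\int[mu]_(x in B n) (weight (b - delta) (lam x) *
    ((1 + lam x ^+ 2) * y t x ^+ 2 + z t x ^+ 2))%:E)%E); last first.
  apply: ge0_subset_integral => //; first exact: measurable_phase_density.
  move=> x _; rewrite lee_fin mulr_ge0 ?(ltW (W0 _ _))// addr_ge0 ?sqr_ge0//.
  by rewrite mulr_ge0 ?sqr_ge0// ltW// weight_base_gt0.
apply: ae_ge0_le_integral => //.
- by move=> x _; rewrite lee_fin mulr_ge0 ?(ltW (W0 _ _))// addr_ge0 ?sqr_ge0//
    mulr_ge0 ?sqr_ge0// ltW// weight_base_gt0.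
- by apply: measurable_funTS; exact: measurable_phase_density.
apply: filterS2 sol hB => x [cy cz y0 z0 dyz] hBx Bx /=; rewrite lee_fin.
have := amplified_energy (q0 n) l0 (ltW e0) (Bl x Bx) Bx amp
  (And3 cy cz dyz) y0 nt tT0.
rewrite z0 u1E => en; have hx := hBx n Bx.
apply: (@le_trans _ _ (4 ^+ n / 4 * h x)).
  by rewrite ler_wpM2l// divr_ge0 ?exprn_ge0.
apply: (@le_trans _ _ (weight (b - delta) (lam x) *
    (4 ^+ n / 4 * weight (q n) (lam x) * (h x / weight b (lam x))))); last first.
  by rewrite ler_wpM2l// ltW.
rewrite (_ : weight b (lam x) = weight (b - delta) (lam x) * weight delta (lam x)); last first.
  by rewrite -weightD subrK.
set w1 := weight (b - delta) _; set w2 := weight delta _; set w3 := weight (q n) _.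
have w10 : w1 != 0 by rewrite gt_eqF// W0.
have w20 : 0 < w2 by exact: W0.
rewrite (_ : w1 * _ = 4 ^+ n / 4 * h x * (w3 / w2)); last first.
  by field; rewrite w10 gt_eqF.
rewrite ler_peMr//; first by rewrite mulr_ge0// divr_ge0 ?exprn_ge0.
by rewrite ler_pdivlMr// mul1r weight_le// Nq.
Qed.

End loss.

(** * Conclusions in each regime *)

Section regime_consequences.
Context {R : realType}.
Variables (T0 mu1 mu2 : R) (omega theta : R -> R).
Hypotheses (T0_gt0 : 0 < T0) (mu1_gt0 : 0 < mu1) (mu12 : mu1 < mu2)
  (om : is_modulus omega) (theta_gt0 : {in `]0, T0[, forall t, 0 < theta t})
  (theta_cont : {in `]0, T0[, continuous theta})
  (theta_nd : {in `]0, T0[ &, forall s t, s <= t -> theta t <= theta s}).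
Context d (M : measurableType d) (mu : {measure set M -> \bar R}) (lam : M -> R).
Hypotheses (mlam : measurable_fun [set: M] lam) (lam_ge0 : forall xi, 0 <= lam xi).
Variable beta : R.

Let PSc := PS T0 mu1 mu2 omega theta.
Let m := loss T0 omega theta.

Let growth_gt0 : 0 < growth_exponent mu1.
Proof. by rewrite addr_gt0// mulr_gt0// invr_gt0. Qed.

Let wp c gam K L0 : PSc c -> 0 <= gam ->
  (forall l, L0 <= l -> expR (growth_exponent mu1 * m l) <= K * weight gam l) ->
  forall u0 u1, phase_space mu lam beta u0 u1 ->
    the_solution mu lam T0 c u0 u1 (fun y z =>
      forall t, t \in `[0, T0] -> phase_space mu lam (beta - gam) (y t) (z t)).
Proof.
move=> cPS gam0 h u0 u1; exact: (well_posed T0_gt0 mu1_gt0 mu12 om theta_gt0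
  theta_cont theta_nd mlam lam_ge0 cPS gam0 h).
Qed.

Lemma bounded_no_loss c : PSc c -> bounded_regime m -> no_loss mu lam T0 beta c.
Proof.
move=> cPS /(bounded_regime_expR (ltW growth_gt0))[K [L0 h]] u0 u1.
by have := wp cPS (lexx 0) h; rewrite subr0; exact.
Qed.

Lemma sublog_small_loss c : PSc c -> sublog_regime m ->
  at_most_small_loss mu lam T0 beta c.
Proof.
move=> cPS reg u0 u1 ph.
have W eps : 0 < eps -> the_solution mu lam T0 c u0 u1 (fun y z =>
    forall t, t \in `[0, T0] -> phase_space mu lam (beta - eps) (y t) (z t)).
  move=> eps0; have [K [L0 h]] := sublog_regime_expR eps0 growth_gt0 reg.
  exact: (wp cPS (ltW eps0) h).
(* The existence of a solution does not involve eps, so any positive value gives it. *)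
split; first by have [] := W 1 ltr01.
by move=> y z sol t eps tT eps0; have [_] := W eps eps0; exact.
Qed.

Lemma log_finite_loss c : PSc c -> log_regime m -> at_most_finite_loss mu lam T0 beta c.
Proof.
move=> cPS /(log_regime_expR growth_gt0)[b [K [L0 [b0 h]]]].
by exists b => // u0 u1; exact: (wp cPS (ltW b0) h).
Qed.

(** The sequence q encodes the regime: 0 for an arbitrarily small loss, a positive constant for a
    finite one, and n for an infinite one. *)
Let residual_loss q (S : set (R -> R)) : (forall n, 0 <= q n) ->
  (forall n A, exists L0, forall l, L0 <= l -> A * weight (q n) l <=
     expR (activation_rate mu1 mu2 * m l)) ->
  (forall K, exists2 l, K < l & in_spectrum mu lam l) ->
  (forall c, PSc c -> (exists u1, phase_space mu lam beta (fun=> 0) u1 /\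
    the_solution mu lam T0 c (fun=> 0) u1 (fun y z => forall t delta,
      t \in `]0, T0] -> (exists N, forall n, (N <= n)%N -> delta <= q n) ->
      ~ phase_space mu lam (beta - delta) (y t) (z t))) -> S c) ->
  residual_in PSc (Loo_dist T0) S.
Proof.
move=> q0 growth spec HS; exists (amplifying_speeds T0 mu1 mu2 omega theta mu lam q).
split=> [n|c amp].
  split; first exact: amplifying_open.
  exact: (amplifying_dense T0_gt0 mu1_gt0 mu12 om theta_gt0 theta_cont theta_nd lam_ge0
    (q0 n) (growth n) spec).
have {}amp n : amplifying_speeds T0 mu1 mu2 omega theta mu lam q n c by exact: amp.
apply: HS; first by have [] := amp 0.
exact: (amplified_loss T0_gt0 mu1_gt0 mlam lam_ge0 beta q0 amp).
Qed.

Let rate0 : 0 < activation_rate mu1 mu2.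
Proof. exact: activation_rate_gt0. Qed.

(** No speed of the class loses derivatives, so the whole class serves as each of the dense open
    sets. *)
Lemma bounded_residual : bounded_regime m ->
  residual_in PSc (Loo_dist T0) [set c | PSc c /\ no_loss mu lam T0 beta c].
Proof.
move=> reg; exists (fun=> PSc); split=> [_|c /(_ 0 I) cPS]; last first.
  by split => //; exact: bounded_no_loss.
split=> [|c r cPS r0]; first by split=> // c cPS; exists 1.
exists c; split=> //; apply: lt_Loo_dist => // t _.
by rewrite subrr normr0 divr_ge0// ltW.
Qed.

Hypothesis spec : forall K, exists2 l, K < l & in_spectrum mu lam l.

Lemma sublog_residual : sublog_regime m ->
  residual_in PSc (Loo_dist T0) [set c | [/\ PSc c,
    at_most_small_loss mu lam T0 beta c & small_loss_happens mu lam T0 beta c]].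
Proof.
move=> reg; apply: (@residual_loss (fun=> 0)) => // [_|c cPS [u1 [ph [ex sol]]]].
  exact: sublog_regime_lower.
split=> //; first exact: sublog_small_loss.
exists (fun=> 0), u1; split=> //; split=> // y z /sol h t tT.
by rewrite -[beta]subr0; apply: h => //; exists 0%N.
Qed.

Lemma log_residual : log_regime m ->
  residual_in PSc (Loo_dist T0) [set c | [/\ PSc c,
    at_most_finite_loss mu lam T0 beta c & finite_loss_happens mu lam T0 beta c]].
Proof.
move=> reg; have [b b0 growth] := log_regime_lower rate0 reg.
apply: (@residual_loss (fun=> b)) => // [_|c cPS [u1 [ph [ex sol]]]]; first exact: ltW.
split=> //; first exact: log_finite_loss.
exists (fun=> b); split=> //; exists (fun=> 0), u1; split=> //; split=> // y z /sol h t tT.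
by apply: h => //; exists 0%N.
Qed.

Lemma superlog_residual : superlog_regime m ->
  residual_in PSc (Loo_dist T0) [set c | PSc c /\ infinite_loss mu lam T0 beta c].
Proof.
move=> reg; apply: (@residual_loss (fun n => n%:R)) => // [n|c cPS [u1 [ph [ex sol]]]].
  exact: superlog_regime_lower.
split=> //; exists (fun=> 0), u1; split=> //; split=> // y z /sol h gamma t g0 tT.
(* The order - gamma corresponds to the loss delta = beta + gamma, which q n = n eventually
   exceeds. *)
rewrite (_ : - gamma = beta - (beta + gamma)); last by rewrite opprD addrA subrr add0r.
apply: h => //; exists (Num.truncn (beta + gamma)).+1 => n Nn.
by rewrite (le_trans (ltW (truncnS_gt _)))// ler_nat.
Qed.

End regime_consequences.

Theorem theorem2p4 (R : realType) (T0 mu1 mu2 : R) (omega theta : R -> R)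
  (H : completeNormedModType R) (ip : {dot H for idfun})
  (D : set H) (A : H -> H)
  (d : measure_display) (M : measurableType d)
  (mu : {measure set M -> \bar R}) (lam : M -> R) (U : H -> M -> R)
  (beta : R) :
  0 < T0 -> 0 < mu1 -> 0 < mu2 -> mu1 < mu2 ->
  is_modulus omega ->
  {in `]0, T0[, forall t, 0 < theta t} ->
  {in `]0, T0[, continuous theta} ->
  {in `]0, T0[ &, forall s t, s <= t -> theta t <= theta s} ->
  compatible_inner_product ip ->
  self_adjoint ip D A ->
  nonnegative_operator ip D A ->
  spectral_representation D A mu lam U ->
  (forall c, PS T0 mu1 mu2 omega theta c ->
    [/\ bounded_regime (loss T0 omega theta) ->
          no_loss mu lam T0 beta c,
        sublog_regime (loss T0 omega theta) ->
          at_most_small_loss mu lam T0 beta c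
      & log_regime (loss T0 omega theta) ->
          at_most_finite_loss mu lam T0 beta c]) /\
  (unbounded_operator D A ->
    [/\ bounded_regime (loss T0 omega theta) ->
          residual_in (PS T0 mu1 mu2 omega theta) (Loo_dist T0)
            [set c | PS T0 mu1 mu2 omega theta c /\
                     no_loss mu lam T0 beta c],
        sublog_regime (loss T0 omega theta) ->
          residual_in (PS T0 mu1 mu2 omega theta) (Loo_dist T0)
            [set c | [/\ PS T0 mu1 mu2 omega theta c,
                         at_most_small_loss mu lam T0 beta c
                       & small_loss_happens mu lam T0 beta c]],
        log_regime (loss T0 omega theta) ->
          residual_in (PS T0 mu1 mu2 omega theta) (Loo_dist T0)
            [set c | [/\ PS T0 mu1 mu2 omega theta c,
                         at_most_finite_loss mu lam T0 beta c
                       & finite_loss_happens mu lam T0 beta c]]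
      & superlog_regime (loss T0 omega theta) ->
          residual_in (PS T0 mu1 mu2 omega theta) (Loo_dist T0)
            [set c | PS T0 mu1 mu2 omega theta c /\
                     infinite_loss mu lam T0 beta c]]).
Proof.
move=> T0_gt0 mu1_gt0 _ mu12 om th0 thc thd _ _ _ rep.
have mlam := spectral_measurable rep; have lam0 := spectral_ge0 rep.
split=> [c cPS|unb].
  split.
  - by move=> reg; apply: bounded_no_loss cPS reg.
  - by move=> reg; apply: sublog_small_loss cPS reg.
  - by move=> reg; apply: log_finite_loss cPS reg.
have spec := unbounded_spectrum mlam lam0 rep unb.
split.
- by move=> reg; apply: bounded_residual reg.
- by move=> reg; apply: sublog_residual reg.
- by move=> reg; apply: log_residual reg.
- by move=> reg; apply: superlog_residual reg.
Qed.
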